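(* Assume that the physical constants and the control parameters $\epsilon_1,\epsilon_2$ satisfy the structural assumption (S) given in the context. Then there exist $\Lambda>0$ and $K_\omega,K_{\omega_y},K_\phi>0$ such that for every initial condition $X_0\in D(\mathcal{A})$ and all $t\ge0$, the solution $X(t)=T(t)X_0=(\omega(\cdot,t),\omega_t(\cdot,t),\phi(\cdot,t),\phi_t(\cdot,t),\omega_t(l,t),\phi_t(l,t))$ of the Cauchy problem $\dot X=\mathcal{A}X$, $X(0)=X_0$, satisfies the augmented energy decay $\|X(t)\|_{\mathcal{H},2}^2\le\|X_0\|_{\mathcal{H},2}^2\exp(-\Lambda t)$ (that is, $\Lambda$ is a decay rate of the augmented energy) and, for each $\psi\in\{\omega,\omega_y,\phi\}$, $$\|\psi(\cdot,t)\|_\infty\le K_\psi\sqrt{E(0)}\,\exp(-\Lambda t/2),$$ where $E(0)=\frac12\|X_0\|_{\mathcal{H},1}^2$ is the initial energy and $\|f\|_\infty=\sup\{|f(y)|:y\in[0,l]\}$.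
   Context: Constants: $l,\rho,I_w,m_s,J_s,c_\omega,c_\phi,\eta_\omega,\eta_\phi,k_1,k_2,\epsilon_1,\epsilon_2$ are positive real numbers, $x_c\in\mathbb{R}$, and $\alpha_\omega,\beta_\omega,\gamma_\omega,\alpha_\phi,\beta_\phi,\gamma_\phi\ge 0$. Put $I_w^*=I_w+\rho x_c^2$, $J_s^*=J_s+m_sx_c^2$, and define the symmetric positive definite matrices $M=\begin{bmatrix}\rho&\rho x_c\\ \rho x_c&I_w^*\end{bmatrix}$, $M_s=\begin{bmatrix}m_s&m_sx_c\\ m_sx_c&J_s^*\end{bmatrix}$. $\lambda_m(\cdot)$ denotes the smallest eigenvalue. Spaces: $H^m(0,l)$ is the usual real Sobolev space of functions in $L^2(0,l)$ with $m$ weak derivatives in $L^2(0,l)$, $\mathrm{AC}[0,l]$ is the set of absolutely continuous functions on $[0,l]$, and $H_L^m(0,l)=\{f\in H^m(0,l): f(0)=f'(0)=\dots=f^{(m-1)}(0)=0\}$ (elements of $H^1(0,l)$ are identified with their absolutely continuous representatives). Let $\mathcal{H}=H_L^2(0,l)\times L^2(0,l)\times H_L^1(0,l)\times L^2(0,l)\times\mathbb{R}\times\mathbb{R}$. For $X_i=(f_i,g_i,h_i,z_i,\zeta_{\omega,i},\zeta_{\phi,i})\in\mathcal{H}$ define $$\langle X_1,X_2\rangle_{\mathcal{H},1}=\int_0^l\big[\rho c_\omega^2f_1''f_2''+I_wc_\phi^2h_1'h_2'\big]dy+\int_0^l\begin{bmatrix}g_1\\ z_1\end{bmatrix}^\top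 M\begin{bmatrix}g_2\\ z_2\end{bmatrix}dy+\begin{bmatrix}\zeta_{\omega,1}\\ \zeta_{\phi,1}\end{bmatrix}^\top M_s\begin{bmatrix}\zeta_{\omega,2}\\ \zeta_{\phi,2}\end{bmatrix},$$ $$\Psi(X_1,X_2)=\int_0^l\Big(\begin{bmatrix}g_1\\ z_1\end{bmatrix}^\top M\begin{bmatrix}\epsilon_1f_2\\ \epsilon_2h_2\end{bmatrix}+\begin{bmatrix}g_2\\ z_2\end{bmatrix}^\top M\begin{bmatrix}\epsilon_1f_1\\ \epsilon_2h_1\end{bmatrix}\Big)dy+\begin{bmatrix}\zeta_{\omega,1}\\ \zeta_{\phi,1}\end{bmatrix}^\top M_s\begin{bmatrix}\epsilon_1f_2(l)\\ \epsilon_2h_2(l)\end{bmatrix}+\begin{bmatrix}\zeta_{\omega,2}\\ \zeta_{\phi,2}\end{bmatrix}^\top M_s\begin{bmatrix}\epsilon_1f_1(l)\\ \epsilon_2h_1(l)\end{bmatrix},$$ and $\langle X_1,X_2\rangle_{\mathcal{H},2}=\langle X_1,X_2\rangle_{\mathcal{H},1}+\Psi(X_1,X_2)$ (for $\epsilon_i\in(0,K_{m,i})$ this is an inner product on $\mathcal{H}$ whose norm $\|\cdot\|_{\mathcal{H},2}$ is equivalent to $\|\cdot\|_{\mathcal{H},1}$). The augmented energy is $\mathcal{E}(t)=\frac12\|X(t)\|_{\mathcal{H},2}^2$. Thresholds (if $x_c=0$, terms with $|x_c|$ as a factor of the denominator are read as $+\infty$, i.e. omitted): $$K_{m,1}=\min\Big(\tfrac{\pi^4\rho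 c_\omega^2}{4l^3(1+|x_c|)\{4l\rho^{3/2}c_\omega+\pi^2m_s\}},\tfrac{c_\omega\lambda_m(M)}{2\sqrt\rho},\tfrac{c_\omega\lambda_m(M)}{2\sqrt\rho|x_c|},\tfrac{\lambda_m(M_s)}{2m_s},\tfrac{\lambda_m(M_s)}{2m_s|x_c|}\Big),$$ $$K_{m,2}=\min\Big(\tfrac{\pi^2I_wc_\phi^2}{4l^2(I_w^*+\rho|x_c|)\sqrt{I_w}c_\phi+\pi^2l(J_s^*+m_s|x_c|)},\tfrac{\sqrt{I_w}c_\phi\lambda_m(M)}{2\rho|x_c|},\tfrac{\sqrt{I_w}c_\phi\lambda_m(M)}{2I_w^*},\tfrac{\lambda_m(M_s)}{2m_s|x_c|},\tfrac{\lambda_m(M_s)}{2J_s^*}\Big),$$ $$\epsilon_1^*=\min\Big(\tfrac{\pi^2I_w\eta_\phi c_\phi^2}{l|x_c|(4l\rho+\pi^2m_s)},\tfrac{2\pi^4\rho\eta_\omega c_\omega^2}{32l^4(2+|x_c|)\rho+8\pi^2l^3(2+|x_c|)m_s+\pi^4\rho\eta_\omega^2c_\omega^2}\Big),$$ $$\epsilon_2^*=\min\Big(\tfrac{\pi^4\rho\eta_\omega c_\omega^2}{4l^3|x_c|(4l\rho+\pi^2m_s)},\tfrac{2\pi^2I_w\eta_\phi c_\phi^2}{8l^2(2I_w^*+|x_c|\rho)+2\pi^2l(2J_s^*+|x_c|m_s)+\pi^2I_w\eta_\phi^2c_\phi^2}\Big).$$ Operators: $D(\mathcal{A})=D(\mathcal{A}_1)$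 is the set of $(f,g,h,z,\zeta_\omega,\zeta_\phi)\in\mathcal{H}$ such that $g\in H_L^2(0,l)$, $z\in H_L^1(0,l)$, $f''+\eta_\omega g''\in H^2(0,l)$, $h'+\eta_\phi z'\in H^1(0,l)$, $(f''+\eta_\omega g'')(l)=0$, $\zeta_\omega=g(l)$, $\zeta_\phi=z(l)$, and $f,f',g,g',h,z,(f''+\eta_\omega g''),(f''+\eta_\omega g'')',(h'+\eta_\phi z')\in\mathrm{AC}[0,l]$. On it, $\mathcal{A}=\mathcal{A}_1+\mathcal{A}_2$, where $\mathcal{A}_1(f,g,h,z,\zeta_\omega,\zeta_\phi)=(g,\tilde g,z,\tilde z,\tilde\zeta_\omega,\tilde\zeta_\phi)$ with $$\begin{bmatrix}\tilde g\\ \tilde z\end{bmatrix}=-M^{-1}\begin{bmatrix}\rho c_\omega^2(f''+\eta_\omega g'')''\\ -I_wc_\phi^2(h'+\eta_\phi z')'\end{bmatrix},\qquad \begin{bmatrix}\tilde\zeta_\omega\\ \tilde\zeta_\phi\end{bmatrix}=M_s^{-1}\begin{bmatrix}\rho c_\omega^2(f''+\eta_\omega g'')'(l)-k_1(g(l)+\epsilon_1f(l))\\ -I_wc_\phi^2(h'+\eta_\phi z')(l)-k_2(z(l)+\epsilon_2h(l))\end{bmatrix},$$ and $\mathcal{A}_2(f,g,h,z,\zeta_\omega,\zeta_\phi)=(0,\tilde F_a,0,\tilde M_a,0,0)$ with $$\begin{bmatrix}\tilde F_a\\ \tilde M_a\end{bmatrix}=M^{-1}\begin{bmatrix}\alpha_\omega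 h+\beta_\omega z+\gamma_\omega g\\ \alpha_\phi h+\beta_\phi z+\gamma_\phi g\end{bmatrix}.$$ When $0<\epsilon_i<\min(\epsilon_i^*,K_{m,i})$, $i=1,2$, the operator $\mathcal{A}$ generates a $C_0$-semigroup on $\mathcal{H}$, denoted $T(t)$; for $X_0\in D(\mathcal{A})$, $X(t)=T(t)X_0\in D(\mathcal{A})$ is the unique solution of $\dot X=\mathcal{A}X$, $X(0)=X_0$. The components $\omega$ and $\phi$ (first and third) are the bending and twisting displacements, and $\omega_y=\partial\omega/\partial y$. Structural assumption (S): $0<\epsilon_1<\min(\epsilon_1^*,K_{m,1})$, $0<\epsilon_2<\min(\epsilon_2^*,K_{m,2})$, and there exist $r_1,\dots,r_8>0$ such that the quantities $$\lambda_1=\epsilon_1\Big(1-\tfrac{\eta_\omega}{2r_1}-\tfrac{8l^4}{\pi^4\rho c_\omega^2}\big(\tfrac{\alpha_\omega}{r_4}+\tfrac{\beta_\omega}{r_5}+\tfrac{\gamma_\omega}{r_3}\big)\Big),$$ $$\lambda_2=\gamma_\omega+\tfrac{\alpha_\omega+\epsilon_2\gamma_\phi}{2r_6}+\tfrac{\epsilon_1\gamma_\omega r_3}{2}+\tfrac{\beta_\omega+\gamma_\phi}{2r_7}\ (\ge0),$$ $$\lambda_3=\rho\Big\{\eta_\omega c_\omega^2-\epsilon_2\tfrac{2l^3|x_c|}{\pi^2}\big(\tfrac{4l}{\pi^2}+\tfrac{m_s}{\rho}\big)-\epsilon_1\big(\tfrac{8l^4(2+|x_c|)}{\pi^4}+\tfrac{\eta_\omega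 c_\omega^2r_1}{2}+\tfrac{2l^3(2+|x_c|)m_s}{\pi^2\rho}\big)\Big\},$$ $$\lambda_4=\epsilon_2\big(1-\tfrac{\eta_\phi}{2r_2}\big)-\tfrac{4l^2}{\pi^2I_wc_\phi^2}\Big(\tfrac{(\alpha_\omega+\epsilon_2\gamma_\phi)r_6}{2}+\tfrac{\alpha_\phi+\epsilon_2\beta_\phi}{2r_8}+\tfrac{\epsilon_1\alpha_\omega r_4}{2}+\epsilon_2\alpha_\phi\Big),$$ $$\lambda_5=\beta_\phi+\tfrac{(\beta_\omega+\gamma_\phi)r_7}{2}+\tfrac{(\alpha_\phi+\epsilon_2\beta_\phi)r_8}{2}+\tfrac{\epsilon_1\beta_\omega r_5}{2}\ (\ge0),$$ $$\lambda_6=I_w\Big\{\eta_\phi c_\phi^2-\epsilon_1\tfrac{l|x_c|}{I_w}\big(\tfrac{2l\rho}{\pi^2}+\tfrac{m_s}{2}\big)-\epsilon_2\big(2l^2\tfrac{2I_w^*+|x_c|\rho}{\pi^2I_w}+\tfrac{\eta_\phi c_\phi^2r_2}{2}+\tfrac{l(2J_s^*+|x_c|m_s)}{2I_w}\big)\Big\}$$ satisfy $\lambda_1,\lambda_3,\lambda_4,\lambda_6>0$, $\mu_3=\pi^4\lambda_3/(16l^4)-\lambda_2>0$ and $\mu_6=\pi^2\lambda_6/(4l^2)-\lambda_5>0$. *)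

(* Defs.v *)
From HB Require Import structures.
From mathcomp Require Import all_boot all_order all_algebra.
From mathcomp Require Import all_classical all_reals all_analysis.

Set Implicit Arguments.
Unset Strict Implicit.
Unset Printing Implicit Defensive.

Import Order.TTheory GRing.Theory Num.Theory.
Import numFieldNormedType.Exports.

Local Open Scope classical_set_scope.
Local Open Scope ring_scope.

(* Elements of [L^2(0,l)] and of the Sobolev spaces are handled through Borel
   representatives [R -> R]; only their values on [0,l] matter, and equality in
   the space is equality almost everywhere on [0,l]. *)
Section FunctionSpaces.
Context {R : realType}.
Variable l : R.
Implicit Types (f g F phi : R -> R) (m n : nat).

Definition Rint f : R := \int[lebesgue_measure]_(y in `[0, l]) f y.

Definition eq_ae f g : Prop :=
  {ae (@lebesgue_measure R), forall y : R, 0 <= y <= l -> f y = g y}.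

Definition inL2 f : Prop :=
  measurable_fun `[0, l] f /\
  (@lebesgue_measure R).-integrable `[0, l] (fun y : R => (f y ^+ 2)%:E).

(* Test functions are taken in C^1_c(0,l); they define the same weak
   derivatives as C^oo_c(0,l). *)
Definition test_fun phi : Prop :=
  [/\ forall x : R, derivable phi x 1,
      continuous (derive1 phi) &
      exists a b : R, [/\ 0 < a, b < l &
        forall x : R, ~ (a <= x <= b) -> phi x = 0]].

Definition is_weak_deriv f g : Prop :=
  [/\ (@lebesgue_measure R).-integrable `[0, l] (EFin \o f),
      (@lebesgue_measure R).-integrable `[0, l] (EFin \o g) &
      forall phi, test_fun phi ->
        Rint (fun y => f y * derive1 phi y) = - Rint (fun y => g y * phi y)].

Fixpoint sobolev m f : Prop :=
  if m is n.+1 then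
    inL2 f /\ exists g, is_weak_deriv f g /\ sobolev n g
  else inL2 f.

(* A weak derivative of [f], unique up to [eq_ae] (junk if there is none). *)
Definition wderiv f : R -> R := xget (fun=> 0) [set g | is_weak_deriv f g].

Definition wderivn n f : R -> R := iter n wderiv f.

Definition abs_cont F : Prop :=
  forall e : R, 0 < e -> exists2 d : R, 0 < d &
    forall n (a b : 'I_n -> R),
      (forall i, 0 <= a i /\ a i <= b i /\ b i <= l) ->
      trivIset [set: 'I_n] (fun i => `]a i, b i[%classic) ->
      \sum_(i < n) (b i - a i) < d ->
      \sum_(i < n) `|F (b i) - F (a i)| < e.

(* [f], as an element of [L^2(0,l)], belongs to AC[0,l]. *)
Definition inAC f : Prop := exists F, abs_cont F /\ eq_ae F f.

(* The absolutely continuous representative of [f], unique on [0,l] when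
   [0 < l]; all pointwise values below are values of this representative. *)
Definition acrep f : R -> R := xget f [set F | abs_cont F /\ eq_ae F f].

Definition sobolevL m f : Prop :=
  sobolev m f /\ forall k, (k < m)%N -> acrep (wderivn k f) 0 = 0.

(* Taken in the extended reals, so that an unbounded function has norm +oo. *)
Definition supnorm f : \bar R :=
  ereal_sup [set `|acrep f y|%:E | y in `[0, l]].

End FunctionSpaces.

Section Matrices2.
Context {R : realType}.

Definition mx2 (a b c d : R) : 'M[R]_2 :=
  \matrix_(i < 2, j < 2) nth 0 (nth [::] [:: [:: a; b]; [:: c; d]] i) j.

Definition cv2 (a b : R) : 'cV[R]_2 := \col_(i < 2) nth 0 [:: a; b] i.

Definition bilin (A : 'M[R]_2) (u v : 'cV[R]_2) : R := (u^T *m A *m v) 0 0.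

(* For a symmetric matrix the set of eigenvalues is finite and nonempty, and
   the infimum is a minimum. *)
Definition lambda_min (A : 'M[R]_2) : R := inf [set a | eigenvalue A a].

End Matrices2.

Record params (R : realType) := Params {
  len : R; rho : R; Iw : R; ms : R; Js : R;
  cw : R; cphi : R; etaw : R; etaphi : R;
  k1 : R; k2 : R; eps1 : R; eps2 : R; xc : R;
  alw : R; bew : R; gaw : R; alphi : R; bephi : R; gaphi : R }.

(* [czw] and [czphi] are the last two components zeta_omega, zeta_phi. *)
Record state (R : realType) := State {
  cf : R -> R; cg : R -> R; ch : R -> R; cz : R -> R; czw : R; czphi : R }.

Section StateOperations.
Context {R : realType}.
Implicit Types X Y : state R.

Definition addS X Y : state R :=
  State (fun y => cf X y + cf Y y) (fun y => cg X y + cg Y y)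
        (fun y => ch X y + ch Y y) (fun y => cz X y + cz Y y)
        (czw X + czw Y) (czphi X + czphi Y).

Definition scaleS (a : R) X : state R :=
  State (fun y => a * cf X y) (fun y => a * cg X y)
        (fun y => a * ch X y) (fun y => a * cz X y)
        (a * czw X) (a * czphi X).

Definition subS X Y : state R := addS X (scaleS (-1) Y).

End StateOperations.

Section Model.
Context {R : realType}.
Variable p : params R.

Local Notation l := (len p).
Local Notation rho := (rho p).
Local Notation Iw := (Iw p).
Local Notation ms := (ms p).
Local Notation Js := (Js p).
Local Notation cw := (cw p).
Local Notation cphi := (cphi p).
Local Notation etaw := (etaw p).
Local Notation etaphi := (etaphi p).
Local Notation k1 := (k1 p).
Local Notation k2 := (k2 p).
Local Notation eps1 := (eps1 p).
Local Notation eps2 := (eps2 p).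
Local Notation xc := (xc p).
Local Notation alw := (alw p).
Local Notation bew := (bew p).
Local Notation gaw := (gaw p).
Local Notation alphi := (alphi p).
Local Notation bephi := (bephi p).
Local Notation gaphi := (gaphi p).

Definition constants_ok : Prop :=
  [/\ [/\ 0 < l, 0 < rho, 0 < Iw, 0 < ms & 0 < Js],
      [/\ 0 < cw, 0 < cphi, 0 < etaw & 0 < etaphi],
      [/\ 0 < k1, 0 < k2, 0 < eps1 & 0 < eps2],
      [/\ 0 <= alw, 0 <= bew & 0 <= gaw] &
      [/\ 0 <= alphi, 0 <= bephi & 0 <= gaphi]].

Definition Iws : R := Iw + rho * xc ^+ 2.
Definition Jss : R := Js + ms * xc ^+ 2.

Definition M : 'M[R]_2 := mx2 rho (rho * xc) (rho * xc) Iws.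
Definition Ms : 'M[R]_2 := mx2 ms (ms * xc) (ms * xc) Jss.

(* A quotient read as +oo when its denominator vanishes, which under
   [constants_ok] only happens to denominators with a factor [`|xc|]. *)
Definition equot (a b : R) : \bar R :=
  if b == 0 then +oo%E else (a / b)%:E.

Definition emin (s : seq (\bar R)) : \bar R :=
  \big[Order.min/+oo%E]_(x <- s) x.

Definition Km1 : \bar R := emin [::
  equot (pi ^+ 4 * rho * cw ^+ 2)
    (4 * l ^+ 3 * (1 + `|xc|)
      * (4 * l * rho `^ (3 / 2) * cw + pi ^+ 2 * ms));
  equot (cw * lambda_min M) (2 * Num.sqrt rho);
  equot (cw * lambda_min M) (2 * Num.sqrt rho * `|xc|);
  equot (lambda_min Ms) (2 * ms);
  equot (lambda_min Ms) (2 * ms * `|xc|)].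

Definition Km2 : \bar R := emin [::
  equot (pi ^+ 2 * Iw * cphi ^+ 2)
    (4 * l ^+ 2 * (Iws + rho * `|xc|) * Num.sqrt Iw * cphi
      + pi ^+ 2 * l * (Jss + ms * `|xc|));
  equot (Num.sqrt Iw * cphi * lambda_min M) (2 * rho * `|xc|);
  equot (Num.sqrt Iw * cphi * lambda_min M) (2 * Iws);
  equot (lambda_min Ms) (2 * ms * `|xc|);
  equot (lambda_min Ms) (2 * Jss)].

Definition eps1_star : \bar R := emin [::
  equot (pi ^+ 2 * Iw * etaphi * cphi ^+ 2)
    (l * `|xc| * (4 * l * rho + pi ^+ 2 * ms));
  equot (2 * pi ^+ 4 * rho * etaw * cw ^+ 2)
    (32 * l ^+ 4 * (2 + `|xc|) * rho
      + 8 * pi ^+ 2 * l ^+ 3 * (2 + `|xc|) * ms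
      + pi ^+ 4 * rho * etaw ^+ 2 * cw ^+ 2)].

Definition eps2_star : \bar R := emin [::
  equot (pi ^+ 4 * rho * etaw * cw ^+ 2)
    (4 * l ^+ 3 * `|xc| * (4 * l * rho + pi ^+ 2 * ms));
  equot (2 * pi ^+ 2 * Iw * etaphi * cphi ^+ 2)
    (8 * l ^+ 2 * (2 * Iws + `|xc| * rho)
      + 2 * pi ^+ 2 * l * (2 * Jss + `|xc| * ms)
      + pi ^+ 2 * Iw * etaphi ^+ 2 * cphi ^+ 2)].

Definition lam1 (r1 r3 r4 r5 : R) : R :=
  eps1 * (1 - etaw / (2 * r1)
    - 8 * l ^+ 4 / (pi ^+ 4 * rho * cw ^+ 2)
      * (alw / r4 + bew / r5 + gaw / r3)).

Definition lam2 (r3 r6 r7 : R) : R :=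
  gaw + (alw + eps2 * gaphi) / (2 * r6) + eps1 * gaw * r3 / 2
  + (bew + gaphi) / (2 * r7).

Definition lam3 (r1 : R) : R :=
  rho * (etaw * cw ^+ 2
    - eps2 * (2 * l ^+ 3 * `|xc| / pi ^+ 2) * (4 * l / pi ^+ 2 + ms / rho)
    - eps1 * (8 * l ^+ 4 * (2 + `|xc|) / pi ^+ 4 + etaw * cw ^+ 2 * r1 / 2
              + 2 * l ^+ 3 * (2 + `|xc|) * ms / (pi ^+ 2 * rho))).

Definition lam4 (r2 r4 r6 r8 : R) : R :=
  eps2 * (1 - etaphi / (2 * r2))
  - 4 * l ^+ 2 / (pi ^+ 2 * Iw * cphi ^+ 2)
    * ((alw + eps2 * gaphi) * r6 / 2 + (alphi + eps2 * bephi) / (2 * r8)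
       + eps1 * alw * r4 / 2 + eps2 * alphi).

Definition lam5 (r5 r7 r8 : R) : R :=
  bephi + (bew + gaphi) * r7 / 2 + (alphi + eps2 * bephi) * r8 / 2
  + eps1 * bew * r5 / 2.

Definition lam6 (r2 : R) : R :=
  Iw * (etaphi * cphi ^+ 2
    - eps1 * (l * `|xc| / Iw) * (2 * l * rho / pi ^+ 2 + ms / 2)
    - eps2 * (2 * l ^+ 2 * ((2 * Iws + `|xc| * rho) / (pi ^+ 2 * Iw))
              + etaphi * cphi ^+ 2 * r2 / 2
              + l * (2 * Jss + `|xc| * ms) / (2 * Iw))).

Definition structural_assumption : Prop :=
  [/\ 0 < eps1, (eps1%:E < Order.min eps1_star Km1)%E,
      0 < eps2, (eps2%:E < Order.min eps2_star Km2)%E &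
      exists r1 r2 r3 r4 r5 r6 r7 r8 : R,
        [/\ [/\ 0 < r1, 0 < r2, 0 < r3 & 0 < r4],
            [/\ 0 < r5, 0 < r6, 0 < r7 & 0 < r8],
            [/\ 0 < lam1 r1 r3 r4 r5, 0 < lam3 r1, 0 < lam4 r2 r4 r6 r8
              & 0 < lam6 r2],
            0 < pi ^+ 4 * lam3 r1 / (16 * l ^+ 4) - lam2 r3 r6 r7 &
            0 < pi ^+ 2 * lam6 r2 / (4 * l ^+ 2) - lam5 r5 r7 r8]].

Local Notation state := (state R).

Local Notation D1 := (wderivn l 1).
Local Notation D2 := (wderivn l 2).
Local Notation tip f := (acrep l f l).

Definition inH (X : state) : Prop :=
  [/\ sobolevL l 2 (cf X), inL2 l (cg X), sobolevL l 1 (ch X)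
    & inL2 l (cz X)].

Definition eqH (X Y : state) : Prop :=
  [/\ eq_ae l (cf X) (cf Y), eq_ae l (cg X) (cg Y),
      eq_ae l (ch X) (ch Y), eq_ae l (cz X) (cz Y)
    & czw X = czw Y /\ czphi X = czphi Y].

Definition ip1 (X Y : state) : R :=
  Rint l (fun y => rho * cw ^+ 2 * D2 (cf X) y * D2 (cf Y) y
                   + Iw * cphi ^+ 2 * D1 (ch X) y * D1 (ch Y) y)
  + Rint l (fun y => bilin M (cv2 (cg X y) (cz X y)) (cv2 (cg Y y) (cz Y y)))
  + bilin Ms (cv2 (czw X) (czphi X)) (cv2 (czw Y) (czphi Y)).

Definition Psi (X Y : state) : R :=
  Rint l (fun y =>
      bilin M (cv2 (cg X y) (cz X y)) (cv2 (eps1 * cf Y y) (eps2 * ch Y y))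
    + bilin M (cv2 (cg Y y) (cz Y y)) (cv2 (eps1 * cf X y) (eps2 * ch X y)))
  + bilin Ms (cv2 (czw X) (czphi X))
      (cv2 (eps1 * tip (cf Y)) (eps2 * tip (ch Y)))
  + bilin Ms (cv2 (czw Y) (czphi Y))
      (cv2 (eps1 * tip (cf X)) (eps2 * tip (ch X))).

Definition ip2 (X Y : state) : R := ip1 X Y + Psi X Y.

Definition norm1 (X : state) : R := Num.sqrt (ip1 X X).
Definition norm2 (X : state) : R := Num.sqrt (ip2 X X).

Definition energy (X : state) : R := norm1 X ^+ 2 / 2.

Definition moment (X : state) : R -> R :=
  fun y => D2 (cf X) y + etaw * D2 (cg X) y.
Definition torsion (X : state) : R -> R :=
  fun y => D1 (ch X) y + etaphi * D1 (cz X) y.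

Definition inD (X : state) : Prop :=
  [/\ inH X,
      [/\ sobolevL l 2 (cg X), sobolevL l 1 (cz X),
          sobolev l 2 (moment X) & sobolev l 1 (torsion X)],
      [/\ tip (moment X) = 0, czw X = tip (cg X) & czphi X = tip (cz X)],
      [/\ inAC l (cf X), inAC l (D1 (cf X)),
          inAC l (cg X), inAC l (D1 (cg X)) & inAC l (ch X)] &
      [/\ inAC l (cz X), inAC l (moment X), inAC l (D1 (moment X))
        & inAC l (torsion X)]].

Definition A1 (X : state) : state :=
  let gz y := - (invmx M *m cv2 (rho * cw ^+ 2 * D2 (moment X) y)
                                (- (Iw * cphi ^+ 2 * D1 (torsion X) y))) in
  let zeta := invmx Ms *m
    cv2 (rho * cw ^+ 2 * tip (D1 (moment X))
           - k1 * (tip (cg X) + eps1 * tip (cf X)))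
        (- (Iw * cphi ^+ 2 * tip (torsion X))
           - k2 * (tip (cz X) + eps2 * tip (ch X))) in
  State (cg X) (fun y => gz y 0 0) (cz X) (fun y => gz y 1 0)
    (zeta 0 0) (zeta 1 0).

Definition A2 (X : state) : state :=
  let gz y := invmx M *m cv2 (alw * ch X y + bew * cz X y + gaw * cg X y)
                             (alphi * ch X y + bephi * cz X y + gaphi * cg X y)
  in State (fun=> 0) (fun y => gz y 0 0) (fun=> 0) (fun y => gz y 1 0) 0 0.

Definition Aop (X : state) : state := addS (A1 X) (A2 X).

(* A family of maps on representatives, inducing on the quotient of [inH] by
   [eqH] a strongly continuous semigroup of bounded linear operators. *)
Definition C0_semigroup (T : R -> state -> state) : Prop :=
  [/\ [/\ forall (t : R) X, 0 <= t -> inH X -> inH (T t X),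
          forall (t : R) X Y, 0 <= t -> inH X -> inH Y -> eqH X Y ->
            eqH (T t X) (T t Y),
          forall (t a : R) X Y, 0 <= t -> inH X -> inH Y ->
            eqH (T t (addS (scaleS a X) Y)) (addS (scaleS a (T t X)) (T t Y))
        & forall t : R, 0 <= t ->
            exists C : R, forall X, inH X -> norm1 (T t X) <= C * norm1 X],
      forall X, inH X -> eqH (T 0 X) X,
      forall (s t : R) X, 0 <= s -> 0 <= t -> inH X ->
        eqH (T (s + t) X) (T s (T t X)) &
      forall X (t : R), inH X -> 0 <= t ->
        norm1 (subS (T s X) (T t X))
          @[s --> within `[0, +oo[ (nbhs t)] --> (0 : R)].

(* [Y] is the derivative at 0+ of the orbit of [X]. *)
Definition infinitesimal (T : R -> state -> state) (X Y : state) : Prop :=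
  norm1 (subS (scaleS h^-1 (subS (T h X) X)) Y) @[h --> 0^'+] --> (0 : R).

(* Equality of graphs: the infinitesimal generator of [T] is [Aop] with domain
   exactly [inD]. *)
Definition generated_by_A (T : R -> state -> state) : Prop :=
  C0_semigroup T /\
  forall X Y, inH X -> inH Y ->
    (infinitesimal T X Y <-> inD X /\ eqH Y (Aop X)).

End Model.

(* Main.v *)
Require Import Defs.
From HB Require Import structures.
From mathcomp Require Import all_boot all_order all_algebra.
From mathcomp Require Import all_classical all_reals all_analysis.
From mathcomp Require Import measurable_realfun ring lra.
Set Implicit Arguments.
Unset Strict Implicit.
Unset Printing Implicit Defensive.
Import Order.TTheory GRing.Theory Num.Theory.
Import numFieldNormedType.Exports.
Local Open Scope classical_set_scope.
Local Open Scope ring_scope.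

(* The algebra and reals libraries export another [Rint]. *)
Local Notation Rint := Defs.Rint.

(* By du Bois-Reymond's lemma a weakly differentiable function has a
   representative [F y = F 0 + Rint y f], for which pointwise values,
   integration by parts and the Poincare-Wirtinger inequality (whose optimal
   constant [4 l^2 / pi^2] for a function clamped at one end enters all
   thresholds) make sense. The bounds on [eps1], [eps2] by [Km1], [Km2] make
   [ip1 + Psi] and [ip1 - Psi] coercive; along an orbit, integration by
   parts computes [ip2 (Aop X) X], and Young's inequality with the weights
   [r_j] bounds it by a negative multiple of the squared norms of [f'', g'',
   h', z'], which dominate [ip2 X X]. An orbit starting in the domain stays
   there, so the continuous function [ip2 X(t) X(t)] has a right derivative
   at most [- Lambda] times itself, and a Dini version of Gronwall's lemma
   gives the decay. The sup norms are controlled by [f''] and [h'], hence by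
   the energy. *)

(** Weak derivatives and absolutely continuous representatives are obtained by choice, so nothing
    pointwise is known about them at the outset. [weak_deriv_prim] and [prim_unique] tie them to
    explicit primitives, and states are then compared only modulo [eqH]. Test functions are of class
    C^1, so du Bois-Reymond's lemma can be tested with the difference of two smoothed steps, whose
    derivative is a difference of two tents that concentrate at Lebesgue points. Coercivity carries
    a sign [s] with [s ^+ 2 = 1] in front of [Psi]. The sign 1 bounds [ip2] from below; the sign -1
    yields [ip2 X X <= 2 * ip1 X X], which is how the initial energy enters the sup norm bounds. The
    generator provides a derivative of an orbit at time 0 only, and from the right only. The
    semigroup law transports it to later times, and real induction draws the conclusion from such
    one-sided information. *)

Section AlmostEverywhere.
Context {R : realType}.
Local Notation mu := (@lebesgue_measure R).

Lemma aeS (P Q : R -> Prop) : (forall y, P y -> Q y) ->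
  {ae mu, forall y, P y} -> {ae mu, forall y, Q y}.
Proof. move=> PQ; apply: (@filterS _ _ (ae_filter_ringOfSetsType mu)); exact: PQ. Qed.

Lemma aeS2 (P Q S : R -> Prop) : (forall y, P y -> Q y -> S y) ->
  {ae mu, forall y, P y} -> {ae mu, forall y, Q y} -> {ae mu, forall y, S y}.
Proof. by move=> PQ; apply: (@filterS2 _ _ (ae_filter_ringOfSetsType mu)). Qed.

End AlmostEverywhere.

(** * Integrals on a segment *)

Section IntegralOnSegment.
Context {R : realType}.
Local Notation mu := (@lebesgue_measure R).
Implicit Types (l y a : R) (f g : R -> R).

Definition intg l f : Prop := mu.-integrable `[0, l] (EFin \o f).

Lemma intg_meas l f : intg l f -> measurable_fun `[0, l] f.
Proof. by case/integrableP => /measurable_EFinP. Qed.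

Lemma intg_eq l f g : (forall y, 0 <= y <= l -> f y = g y) -> intg l f -> intg l g.
Proof.
move=> fg; apply: eq_integrable => // y; rewrite inE/= in_itv/= => yl.
by rewrite fg.
Qed.

Lemma intgD l f g : intg l f -> intg l g -> intg l (fun y => f y + g y).
Proof.
move=> hf hg; apply: eq_integrable (integrableD _ hf hg) => //= y _.
Qed.

Lemma intgZ l a f : intg l f -> intg l (fun y => a * f y).
Proof.
move=> hf; apply: eq_integrable (integrableZl _ a hf) => //= y _.
Qed.

Lemma intgN l f : intg l f -> intg l (fun y => - f y).
Proof.
move=> hf; apply: intg_eq (intgZ (-1) hf) => y _.
by rewrite mulN1r.
Qed.

Lemma intgB l f g : intg l f -> intg l g -> intg l (fun y => f y - g y).
Proof. by move=> hf hg; apply: intgD => //; exact: intgN. Qed.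

Lemma intg_norm l f : intg l f -> intg l (fun y => `|f y|).
Proof. by move=> hf; exact: integrable_norm hf. Qed.

Lemma mu_segment l : 0 <= l -> mu `[0%R, l] = l%:E.
Proof.
move=> l0; rewrite lebesgue_measure_itv/= lte_fin.
have [l1|l1] := ltP 0 l; first by rewrite -EFinD subr0.
by congr EFin; apply/eqP; rewrite eq_le l0 l1.
Qed.

Lemma mu_segment_lty l : (mu `[0%R, l] < +oo)%E.
Proof.
rewrite lebesgue_measure_itv/= lte_fin; case: ifP => // _.
by rewrite -EFinD ltry.
Qed.

Lemma intg_cst l a : intg l (fun=> a).
Proof.
apply: measurable_bounded_integrable => //; first exact: mu_segment_lty.
by exists `|a|; split => [|x xa y _ /=]; [exact: num_real|exact: ltW].
Qed.

Lemma intg_le l f g : measurable_fun `[0, l] f -> intg l g ->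
  (forall y, 0 <= y <= l -> `|f y| <= g y) -> intg l f.
Proof.
move=> mf hg fg; apply: le_integrable hg => //; first exact/measurable_EFinP.
move=> y; rewrite /= in_itv/= => yl.
by rewrite lee_fin (le_trans (fg _ yl))// ler_norm.
Qed.

Lemma intgS l y f : y <= l -> intg l f -> intg y f.
Proof. by move=> yl; apply: integrableS => //; exact: subset_itvl. Qed.

Lemma intg_bounded l f a : measurable_fun `[0, l] f ->
  (forall y, 0 <= y <= l -> `|f y| <= a) -> intg l f.
Proof. by move=> mf fa; apply: (@intg_le l f (fun=> a)) => //; exact: intg_cst. Qed.

Lemma intgM_bounded l f g a : intg l f -> measurable_fun `[0, l] g ->
  (forall y, 0 <= y <= l -> `|g y| <= a) -> intg l (fun y => f y * g y).
Proof.
move=> hf mg ga; apply: (@intg_le l _ (fun y => a * `|f y|)).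
- by apply: measurable_funM => //; exact: intg_meas.
- by apply: intgZ; exact: intg_norm.
- by move=> y yl; rewrite normrM mulrC ler_wpM2r// ga.
Qed.

Lemma Rint_eq l f g : (forall y, 0 <= y <= l -> f y = g y) -> Rint l f = Rint l g.
Proof.
by move=> fg; apply: eq_Rintegral => y; rewrite inE/= in_itv/= => /fg.
Qed.

Lemma RintD l f g : intg l f -> intg l g ->
  Rint l (fun y => f y + g y) = Rint l f + Rint l g.
Proof. by move=> hf hg; rewrite /Rint RintegralD. Qed.

Lemma RintZ l a f : intg l f -> Rint l (fun y => a * f y) = a * Rint l f.
Proof. by move=> hf; rewrite /Rint RintegralZl. Qed.

Lemma RintB l f g : intg l f -> intg l g ->
  Rint l (fun y => f y - g y) = Rint l f - Rint l g.
Proof. by move=> hf hg; rewrite /Rint RintegralB. Qed.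

Lemma Rint_cst l a : 0 <= l -> Rint l (fun=> a) = a * l.
Proof. by move=> l0; rewrite /Rint Rintegral_cst//= mu_segment. Qed.

Lemma Rint_at0 f : Rint 0 f = 0.
Proof. by rewrite /Rint set_itv1 Rintegral_set1. Qed.

Lemma le_Rint l f g : intg l f -> intg l g ->
  (forall y, 0 <= y <= l -> f y <= g y) -> Rint l f <= Rint l g.
Proof.
move=> hf hg fg; apply: le_Rintegral => // y; rewrite /= in_itv/=; exact: fg.
Qed.

Lemma Rint_ge0 l f : (forall y, 0 <= y <= l -> 0 <= f y) -> 0 <= Rint l f.
Proof.
by move=> f0; apply: Rintegral_ge0 => y; rewrite /= in_itv/=; exact: f0.
Qed.

Lemma le_normr_Rint l f : intg l f -> `|Rint l f| <= Rint l (fun y => `|f y|).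
Proof. by move=> hf; exact: le_normr_Rintegral. Qed.

Lemma Rint_ae l f g : measurable_fun `[0, l] f -> measurable_fun `[0, l] g ->
  eq_ae l f g -> Rint l f = Rint l g.
Proof.
move=> mf mg fg; congr fine; apply: ae_eq_integral => //.
- exact/measurable_EFinP.
- exact/measurable_EFinP.
- apply: aeS fg => y H; rewrite /= in_itv/= => yl.
  by rewrite H.
Qed.

Lemma intg_ae l f g : measurable_fun `[0, l] g -> eq_ae l f g -> intg l f -> intg l g.
Proof.
move=> mg fg /integrableP[mf foo]; apply/integrableP; split.
  exact/measurable_EFinP.
rewrite (_ : (\int[mu]_(x in _) _)%E = (\int[mu]_(x in `[0%R, l]) `|(EFin \o f) x|)%E)//.
apply: ae_eq_integral => //.
- by apply: measurableT_comp => //; exact/measurable_EFinP.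
- exact: measurableT_comp.
- apply: aeS fg => y H; rewrite /= in_itv/= => yl.
  by rewrite H.
Qed.

Lemma eq_ae_refl l f : eq_ae l f f.
Proof. by apply: aeW => y. Qed.

Lemma eq_ae_sym l f g : eq_ae l f g -> eq_ae l g f.
Proof. by apply: aeS => y H yl; rewrite H. Qed.

Lemma eq_ae_trans l f g h : eq_ae l f g -> eq_ae l g h -> eq_ae l f h.
Proof. by move=> H1 H2; move: H1 H2; apply: aeS2 => y H1 H2 yl; rewrite H1// H2. Qed.

Lemma eq_ae_on l f g : (forall y, 0 <= y <= l -> f y = g y) -> eq_ae l f g.
Proof. by move=> fg; apply: aeW. Qed.

Lemma eq_ae_lin l a f f' g g' : eq_ae l f f' -> eq_ae l g g' ->
  eq_ae l (fun y => a * f y + g y) (fun y => a * f' y + g' y).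
Proof. by apply: aeS2 => y H1 H2 yl; rewrite H1// H2. Qed.

Lemma RintE l f y : intg l f -> 0 <= y <= l ->
  Rint l f = Rint y f + \int[mu]_(x in `]y, l]) f x.
Proof.
move=> hf /andP[y0 yl]; rewrite -(@Rintegral_itvB _ f (BLeft 0) (BRight l) y)//.
by rewrite addrC subrK.
Qed.

End IntegralOnSegment.

Section SquareIntegrable.
Context {R : realType}.
Implicit Types (l a : R) (f g : R -> R).

Lemma L2_meas l f : inL2 l f -> measurable_fun `[0, l] f.
Proof. by case. Qed.

Lemma L2_sqr l f : inL2 l f -> intg l (fun y => f y ^+ 2).
Proof. by case. Qed.

Lemma L2_intgM l f g : inL2 l f -> inL2 l g -> intg l (fun y => f y * g y).
Proof.
move=> [mf f2] [mg g2]; apply: (@intg_le R l _ (fun y => f y ^+ 2 + g y ^+ 2)).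
- exact: measurable_funM.
- exact: intgD.
- by move=> y _; rewrite ler_norml; apply/andP; split; nra.
Qed.

Lemma L2_cst l a : inL2 l (fun=> a).
Proof. by split => //; exact: intg_cst. Qed.

Lemma L2_intg l f : inL2 l f -> intg l f.
Proof.
move=> hf; have := L2_intgM hf (L2_cst l 1).
by apply: intg_eq => y _; rewrite mulr1.
Qed.

Lemma L2_add l f g : inL2 l f -> inL2 l g -> inL2 l (fun y => f y + g y).
Proof.
move=> hf hg; split; first by apply: measurable_funD; [case: hf|case: hg].
apply: (@intg_le R l _ (fun y => 2 * f y ^+ 2 + 2 * g y ^+ 2)).
- by apply: measurable_funX; apply: measurable_funD; [case: hf|case: hg].
- by apply: intgD; apply: intgZ; exact: L2_sqr.
- by move=> y _; rewrite ger0_norm ?sqr_ge0//; have := sqr_ge0 (f y - g y); nra.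
Qed.

Lemma L2_scale l a f : inL2 l f -> inL2 l (fun y => a * f y).
Proof.
move=> hf; split; first by apply: measurable_funM => //; case: hf.
have := intgZ (a ^+ 2) (L2_sqr hf).
by apply: intg_eq => y _; rewrite exprMn.
Qed.

Lemma L2_eq l f g : (forall y, 0 <= y <= l -> f y = g y) -> inL2 l f -> inL2 l g.
Proof.
move=> fg [mf f2]; split.
  by apply: eq_measurable_fun mf => y; rewrite inE/= in_itv/= => /fg.
by apply: intg_eq f2 => y /fg ->.
Qed.

Lemma L2_ae l f g : measurable_fun `[0, l] g -> eq_ae l f g -> inL2 l f -> inL2 l g.
Proof.
move=> mg fg [mf f2]; split => //; apply: intg_ae f2; first exact: measurable_funX.
by apply: aeS fg => y H yl; rewrite H.
Qed.

End SquareIntegrable.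

(** * Primitives *)

Section Primitive.
Context {R : realType}.
Local Notation mu := (@lebesgue_measure R).
Implicit Types (l y a : R) (f g F G : R -> R).

(** An integral form of absolute continuity with density [f]: pointwise values of [F] are available,
    and no differentiation theorem is involved in using it. *)
Definition prim l F f : Prop :=
  intg l f /\ forall y, 0 <= y <= l -> F y = F 0 + Rint y f.

Lemma prim_eq l F f F' : 0 <= l -> (forall y, 0 <= y <= l -> F y = F' y) ->
  prim l F f -> prim l F' f.
Proof.
move=> l0 FF' [hf FE]; split => // y yl.
by rewrite -(FF' y yl) -(FF' 0) ?lexx// FE.
Qed.

Lemma prim_lin l a F f G g : prim l F f -> prim l G g ->
  prim l (fun y => a * F y + G y) (fun y => a * f y + g y).
Proof.
move=> [hf FE] [hg GE]; split; first by apply: intgD => //; exact: intgZ.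
move=> y /[dup] /andP[y0 yl] yy; rewrite FE// GE// RintD ?RintZ; first by ring.
- exact: intgS hf.
- by apply: intgZ; exact: intgS hf.
- exact: intgS hg.
Qed.

Lemma primS l y F f : y <= l -> prim l F f -> prim y F f.
Proof.
move=> yl [hf FE]; split; first exact: intgS hf.
by move=> x /andP[x0 xy]; rewrite FE// x0 (le_trans xy).
Qed.

Lemma prim_continuous l F f : 0 <= l -> prim l F f -> {within `[0, l], continuous F}.
Proof.
move=> l0 [hf FE].
have H := parameterized_integral_continuous l0 hf.
apply: (@subspace_eq_continuous _ _ _ (fun y => F 0 + Rint y f)).
  by move=> y; rewrite inE/= in_itv/= => /FE.
move=> x; by apply: cvgD; [exact: cvg_cst|exact: H].
Qed.

Lemma prim_meas l F f : 0 <= l -> prim l F f -> measurable_fun `[0, l] F.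
Proof.
move=> l0 hF; apply: subspace_continuous_measurable_fun => //.
exact: prim_continuous hF.
Qed.

Lemma Rint_norm_le l y f : intg l f -> 0 <= y <= l ->
  `|Rint y f| <= Rint l (fun x => `|f x|).
Proof.
move=> hf /andP[y0 yl]; apply: (le_trans (le_normr_Rint (intgS yl hf))).
rewrite (@RintE _ l _ y) ?y0//; last exact: intg_norm.
by rewrite lerDl; apply: Rintegral_ge0.
Qed.

Lemma prim_bounded l F f : prim l F f ->
  forall y, 0 <= y <= l -> `|F y| <= `|F 0| + Rint l (fun x => `|f x|).
Proof.
move=> [hf FE] y yl; rewrite FE//; apply: (le_trans (ler_normD _ _)).
by rewrite lerD2l Rint_norm_le.
Qed.

Lemma prim_L2 l F f : 0 <= l -> prim l F f -> inL2 l F.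
Proof.
move=> l0 hF; have mF := prim_meas l0 hF; split => //.
apply: (intg_bounded (a := (`|F 0| + Rint l (fun x => `|f x|)) ^+ 2)).
  exact: measurable_funX.
move=> y yl; rewrite normrX lerXn2r ?nnegrE// ?(prim_bounded hF)//.
by rewrite addr_ge0// Rint_ge0.
Qed.

Lemma prim_intgM l F f g : 0 <= l -> prim l F f -> intg l g ->
  intg l (fun y => g y * F y).
Proof.
move=> l0 hF hg; apply: intgM_bounded => //; first exact: prim_meas hF.
exact: prim_bounded hF.
Qed.

Lemma prim_intgMl l F f g : 0 <= l -> prim l F f -> intg l g ->
  intg l (fun y => F y * g y).
Proof. by move=> l0 hF hg; apply: intg_eq (prim_intgM l0 hF hg) => y _; rewrite mulrC. Qed.

Lemma prim_Rint l f : intg l f -> prim l (fun y => Rint y f) f.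
Proof. by move=> hf; split => // y _; rewrite Rint_at0 add0r. Qed.

Lemma EFin_Rintegral (D : set R) f : measurable D -> mu.-integrable D (EFin \o f) ->
  (\int[mu]_(x in D) (f x)%:E)%E = (\int[mu]_(x in D) f x)%:E.
Proof. by move=> mD hf; rewrite fineK//; exact: integrable_fin_num. Qed.

(* Both sides are the integral of [f x * g y] over the triangle [y <= x]. *)
Lemma Rint_triangle l f g : 0 <= l -> intg l f -> intg l g ->
  Rint l (fun x => f x * Rint x g) = Rint l (fun y => g y * (Rint l f - Rint y f)).
Proof.
move=> l0 hf hg.
(* Both functions are extended by 0, so that the triangle is the only restriction left in the kernel
   [k] on the plane. *)
pose fD := f \_ `[0, l]; pose gD := g \_ `[0, l].
have mfD : measurable_fun setT fD.
  by apply/(measurable_restrictT _ _).1 => //; exact: intg_meas.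
have mgD : measurable_fun setT gD.
  by apply/(measurable_restrictT _ _).1 => //; exact: intg_meas.
have mnM (h : R -> R) c : measurable_fun setT h -> measurable_fun setT (fun x => c * `|h x|).
  by move=> mh; apply: measurable_funM => //; exact: measurableT_comp.
have ifD : mu.-integrable setT (EFin \o fD).
  by rewrite -restrict_EFin; apply/(integrable_mkcond _ _).1.
have igD : mu.-integrable setT (EFin \o gD).
  by rewrite -restrict_EFin; apply/(integrable_mkcond _ _).1.
pose MR := measurableTypeR R.
pose T : set (MR * MR) := [set z | z.2 <= z.1].
have mT : measurable T.
  have := @measurable_lee _ (MR * MR)%type R setT measurableT (EFin \o snd) (EFin \o fst).
  rewrite setTI; apply; apply/measurable_EFinP.
    exact: (@measurable_snd _ _ MR MR).
  exact: (@measurable_fst _ _ MR MR).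
pose k (z : MR * MR) : \bar R := (fD z.1 * gD z.2 * \1_T z)%:E.
have mk : measurable_fun setT k.
  apply/measurable_EFinP; apply: measurable_funM.
    by apply: measurable_funM; [exact: (measurableT_comp mfD (@measurable_fst _ _ MR MR))|exact: (measurableT_comp mgD (@measurable_snd _ _ MR MR))].
  exact: measurable_indic.
have TE x y : \1_T (x, y) = (y <= x)%R%:R :> R.
  by rewrite indicE; congr (nat_of_bool _)%:R; apply/idP/idP; rewrite inE.
have rE (D : set R) (h : R -> R) y : (h \_ D) y = if y \in D then h y else 0.
  exact: patchE.
pose C := \int[mu]_y `|gD y|.
have CE : (\int[mu]_y `|gD y|%:E)%E = C%:E.
  by apply: EFin_Rintegral => //; exact: integrable_norm igD.
have C0 : 0 <= C by exact: Rintegral_ge0.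
(* By Tonelli it is enough to bound the inner integral of the absolute value of [k], here by [C]
   times that of [fD x], where [C] is the L^1 norm of [gD]. *)
have ik : (mu \x mu)%E.-integrable setT k.
  apply/integrable12ltyP => //.
  apply: (@le_lt_trans _ _ (\int[mu]_x (C * `|fD x|)%:E)%E).
    apply: ge0_le_integral => //.
    - by move=> x _; exact: integral_ge0.
    - have := @measurable_fun_fubini_tonelli_F _ _ MR MR R mu (abse \o k).
      by move/(_ (measurableT_comp (@abse_measurable _ _) mk)); apply => z; exact: abse_ge0.
    - exact: ((measurable_EFinP _ _).2 (mnM fD C mfD)).
    - move=> x _; rewrite EFinM -CE muleC -ge0_integralZl//=; last first.
        by apply/measurable_EFinP; exact: (measurableT_comp (@normr_measurable _ _) mgD).
      apply: ge0_le_integral => //.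
      + exact: (measurableT_comp (measurableT_comp (@abse_measurable _ _) mk) (pair1_measurable x)).
      + exact: ((measurable_EFinP _ _).2 (mnM gD _ mgD)).
      + move=> y _; rewrite -EFinM lee_fin !normrM.
        rewrite -[leRHS]mulr1 ler_wpM2l//.
        by rewrite indicE; case: (_ \in _); rewrite ?normr1 ?normr0.
  rewrite (@EFin_Rintegral setT (fun x => C * `|fD x|)) ?ltry//.
  apply: eq_integrable (integrableZl _ C (integrable_norm ifD)) => //.
have hI g0 D c : measurable D -> D `<=` `[0, l] -> intg l g0 ->
    (\int[mu]_y (c * (g0 \_ D) y)%:E)%E = (c * \int[mu]_(y in D) g0 y)%:E.
  move=> mD Dl hg0.
  have ig0 : mu.-integrable setT (EFin \o (g0 \_ D)).
    rewrite -restrict_EFin; apply/(integrable_mkcond _ _).1 => //.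
    exact: integrableS hg0.
  rewrite (_ : (fun y => (c * _)%:E) = (fun y => c%:E * (EFin \o (g0 \_ D)) y)%E)//.
  rewrite integralZl// (@EFin_Rintegral setT (g0 \_ D))//.
  by rewrite -EFinM [in RHS]Rintegral_mkcond.
have : (\int[mu]_x \int[mu]_y k (x, y) = \int[mu]_y \int[mu]_x k (x, y))%E.
  exact: Fubini ik.
rewrite (_ : (\int[mu]_x \int[mu]_y k (x, y) =
    \int[mu]_(x in `[0%R, l]) (f x * Rint x g)%:E)%E); last first.
  rewrite [RHS]integral_mkcond; apply: eq_integral => x _.
  rewrite patchE; case: ifPn => xl; last first.
    by rewrite integral0_eq// => y _; rewrite /k /fD/= patchE (negbTE xl) !mul0r.
  move: (xl); rewrite inE/= in_itv/= => /andP[x0 xl'].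
  rewrite -hI//; last exact: subset_itvl.
  apply: eq_integral => y _; congr EFin.
  rewrite /k/= /fD patchE xl -mulrA; congr (_ * _).
  rewrite /gD !rE TE !mem_setE/= !in_itv/=.
  have [y0|y0] := leP 0 y; rewrite ?mul0r//=.
  have [yx|yx] := leP y x; last by rewrite mulr0.
  by rewrite (le_trans yx xl') mulr1.
rewrite (_ : (\int[mu]_y \int[mu]_x k (x, y) =
    \int[mu]_(y in `[0%R, l]) (g y * (Rint l f - Rint y f))%:E)%E); last first.
  rewrite [RHS]integral_mkcond; apply: eq_integral => y _.
  rewrite patchE; case: ifPn => yl; last first.
    rewrite integral0_eq// => x _.
    by rewrite /k /gD/= [in _ * _ y]patchE (negbTE yl) mulr0 mul0r.
  move: (yl); rewrite inE/= in_itv/= => /andP[y0 yl'].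
  rewrite (@RintE _ l f y) ?y0// addrAC subrr add0r.
  (* Closing the interval at [y] makes it match the indicator of [y <= x]. *)
  rewrite Rintegral_itv_obnd_cbnd; last first.
    by apply: integrableS hf => //; apply: subset_itvScc; rewrite bnd_simp.
  rewrite -hI//; last by apply: subset_itvScc; rewrite bnd_simp.
  apply: eq_integral => x _; congr EFin.
  rewrite /k/= /gD [in _ * _ y]patchE yl -mulrA mulrCA; congr (_ * _).
  rewrite /fD !rE TE !mem_setE/= !in_itv/=.
  have [yx|yx] := leP y x; last by rewrite mulr0.
  by rewrite (le_trans y0 yx) mulr1.
rewrite /Rint /Rintegral => ->//.
Qed.

(* A primitive is [F 0 + Rint y f]; the constants are split off so that only
   [Rint_triangle] is needed. *)
Lemma Rint_by_parts l F f G g : 0 <= l -> prim l F f -> prim l G g ->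
  Rint l (fun y => f y * G y + F y * g y) = F l * G l - F 0 * G 0.
Proof.
move=> l0 hF hG; have [hf FE] := hF; have [hg GE] := hG.
have ifG := prim_intgM l0 (prim_Rint hg) hf.
have igF := prim_intgM l0 (prim_Rint hf) hg.
have -> : Rint l (fun y => f y * G y + F y * g y) =
   Rint l (fun y => (G 0 * f y + f y * Rint y g) + (F 0 * g y + g y * Rint y f)).
  by apply: Rint_eq => y yl; rewrite GE// (FE y)//; ring.
rewrite !RintD//; [|exact: intgZ|exact: intgZ|by apply: intgD => //; exact: intgZ..].
rewrite !RintZ// Rint_triangle//.
have -> : Rint l (fun y => g y * (Rint l f - Rint y f)) =
   Rint l (fun y => Rint l f * g y - g y * Rint y f).
  by apply: Rint_eq => y _; ring.
rewrite RintB//; last exact: intgZ.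
rewrite RintZ// (FE l) ?l0 ?lexx// (GE l) ?l0 ?lexx//; ring.
Qed.

Lemma prim_mul l F f G g : 0 <= l -> prim l F f -> prim l G g ->
  prim l (fun y => F y * G y) (fun y => f y * G y + F y * g y).
Proof.
move=> l0 hF hG; have [hf _] := hF; have [hg _] := hG; split.
  by apply: intgD; [exact: prim_intgM hG hf|exact: prim_intgMl hF hg].
move=> y /andP[y0 yl].
rewrite (Rint_by_parts y0 (primS yl hF) (primS yl hG)).
by rewrite addrC subrK.
Qed.

Lemma prim_derivable l F f : 0 <= l ->
  (forall x : R, 0 <= x <= l -> is_derive x 1 F (f x)) ->
  {within `[0, l], continuous f} -> prim l F f.
Proof.
move=> l0 dF cf; split.
  apply: continuous_compact_integrable => //; exact: segment_compact.
move=> y /andP[+ yl]; rewrite le_eqVlt => /predU1P[<-|y0].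
  by rewrite Rint_at0 addr0.
have dF' x : 0 <= x <= l -> derivable F x 1 by move=> /dF [].
have cF x : 0 <= x <= l -> {for x, continuous F}.
  by move=> /dF' dFx; apply: differentiable_continuous; apply/derivable1_diffP.
rewrite /Rint /Rintegral (@continuous_FTC2 _ f F)//.
- by rewrite -EFinB/= addrC subrK.
- apply: continuous_subspaceW cf; exact: subset_itvl.
- split.
  + by move=> x; rewrite in_itv/= => /andP[x0 xy]; apply: dF'; lra.
  + by apply: cvg_at_right_filter; apply: cF; lra.
  + by apply: cvg_at_left_filter; apply: cF; lra.
- move=> x; rewrite in_itv/= => /andP[x0 xy]; rewrite derive1E.
  have [|_ ->//] := dF x; lra.
Qed.

End Primitive.

(** * Weak derivatives *)

Section HatKernel.
Context {R : realType}.
Implicit Types (x y a e d C : R).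

(** A quadratic remainder suits [hatP], which is of class C^1 but only piecewise twice
    differentiable. *)
Lemma is_derive_quadratic (F : R -> R) x d C : 0 <= C ->
  (forall h, `|F (x + h) - F x - h * d| <= C * h ^+ 2) -> is_derive x 1 F d.
Proof.
move=> C0 H.
have Fd : h^-1 *: ((F \o shift x) (h *: 1) - F x) @[h --> 0^'] --> d.
  apply/cvgrPdist_lt => eps eps0; near=> h.
  have h0 : h != 0 by near: h; exact: nbhs_dnbhs_neq.
  have hC : `|h| < eps / (C + 1).
    near: h; apply: dnbhs0_lt; by rewrite divr_gt0// ltr_wpDl.
  rewrite /= /GRing.scale/= mulr1 distrC (_ : _ - d = h^-1 * (F (x + h) - F x - h * d)); last first.
    by rewrite [h + x]addrC; field.
  rewrite normrM normfV ltr_pdivrMl ?normr_gt0//.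
  apply: (le_lt_trans (H h)).
  have hp : 0 < `|h| by rewrite normr_gt0.
  rewrite -real_normK ?num_real//.
  rewrite ltr_pdivlMr in hC; last by rewrite ltr_wpDl.
  nra.
split; last exact: cvg_lim Fd.
by apply/cvg_ex; exists d.
Unshelve. all: by end_near. Qed.

(** The second difference of the absolute value: a tent on [[a - e, a + e]], of height [2 / e] and
    hence of mass 2, whence the factor 2 in [hat_avg]. *)
Definition hat a e x : R := (`|x - a + e| + `|x - a - e| - 2 * `|x - a|) / e ^+ 2.

(** The same second difference taken on [q], an antiderivative of the absolute value. It is a
    primitive of [hat a e] that rises from -1 to 1: a smoothed step. *)
Definition hatP a e x : R :=
  let q t := t * `|t| / 2 in (q (x - a + e) + q (x - a - e) - 2 * q (x - a)) / e ^+ 2.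

Lemma half_sqr_is_derive x h :
  `|(x + h) * `|x + h| / 2 - x * `|x| / 2 - h * `|x| | <= h ^+ 2 / 2.
Proof.
rewrite ler_norml.
by case: (ger0P x) => hx; case: (ger0P (x + h)) => hxh; apply/andP; split; nra.
Qed.

Lemma hatP_quadratic a e x h : 0 < e ->
  `|hatP a e (x + h) - hatP a e x - h * hat a e x| <= 2 / e ^+ 2 * h ^+ 2.
Proof.
move=> e0; rewrite /hatP /hat; set P := (X in `|X| <= _).
have := half_sqr_is_derive (x - a + e) h.
have := half_sqr_is_derive (x - a - e) h.
have := half_sqr_is_derive (x - a) h.
rewrite (_ : x - a + e + h = x + h - a + e); last by ring.
rewrite (_ : x - a - e + h = x + h - a - e); last by ring.
rewrite (_ : x - a + h = x + h - a); last by ring.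
rewrite ler_norml => /andP[h1 h2]; rewrite ler_norml => /andP[h3 h4].
rewrite ler_norml => /andP[h5 h6].
have PE : P = ((x + h - a + e) * `|x + h - a + e| / 2
    - (x - a + e) * `|x - a + e| / 2 - h * `|x - a + e|
  + ((x + h - a - e) * `|x + h - a - e| / 2
    - (x - a - e) * `|x - a - e| / 2 - h * `|x - a - e|)
  - 2 * ((x + h - a) * `|x + h - a| / 2
    - (x - a) * `|x - a| / 2 - h * `|x - a|)) / e ^+ 2.
  by rewrite /P; ring.
rewrite PE normrM [X in _ * X]ger0_norm ?invr_ge0 ?sqr_ge0//.
rewrite (_ : 2 / e ^+ 2 * h ^+ 2 = (2 * h ^+ 2) / e ^+ 2); last by rewrite mulrAC.
by rewrite ler_wpM2r ?invr_ge0 ?sqr_ge0// ler_norml; apply/andP; split; lra.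
Qed.

Lemma hat_ge0 a e x : 0 <= hat a e x.
Proof.
rewrite divr_ge0// ?sqr_ge0// subr_ge0.
rewrite -[X in X <= _]ger0_norm ?mulr_ge0// (_ : 2 * `|x - a| = `|2 * (x - a)|); last first.
  by rewrite normrM normr_nat.
by rewrite normr_id (_ : 2 * (x - a) = (x - a + e) + (x - a - e)) ?ler_normD//; ring.
Qed.

Lemma hat_le a e x : 0 < e -> hat a e x <= 2 / e.
Proof.
move=> e0; rewrite /hat ler_pdivrMr ?exprn_gt0// expr2 mulrA divfK ?gt_eqF//.
have := ler_normD (x - a) e; have := ler_normB (x - a) e.
rewrite (gtr0_norm e0); lra.
Qed.

Lemma hat_out a e x : 0 < e -> e <= `|x - a| -> hat a e x = 0.
Proof.
move=> e0; rewrite /hat ler_normr => /orP[h|h].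
  by rewrite !ger0_norm; [rewrite -[RHS](mul0r (e ^+ 2)^-1); congr (_ / _); ring|lra..].
by rewrite !ler0_norm; [rewrite -[RHS](mul0r (e ^+ 2)^-1); congr (_ / _); ring|lra..].
Qed.

Lemma hatP_right a e x : 0 < e -> a + e <= x -> hatP a e x = 1.
Proof.
move=> e0 h; rewrite /hatP !ger0_norm; [|lra..].
have e1 : e != 0 by rewrite gt_eqF.
by field.
Qed.

Lemma hatP_left a e x : 0 < e -> x <= a - e -> hatP a e x = -1.
Proof.
move=> e0 h; rewrite /hatP !ler0_norm; [|lra..].
have e1 : e != 0 by rewrite gt_eqF.
by field.
Qed.

Lemma hat_continuous a e : continuous (hat a e).
Proof.
move=> x; apply: cvgM; last exact: cvg_cst.
have cabs c : `|y - a + c| @[y --> x] --> `|x - a + c|.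
  apply: cvg_norm; apply: cvgD; last exact: cvg_cst.
  by apply: cvgB; [exact: cvg_id|exact: cvg_cst].
apply: cvgB; first by apply: cvgD; exact: cabs.
apply: cvgM; first exact: cvg_cst.
by apply: cvg_norm; apply: cvgB; [exact: cvg_id|exact: cvg_cst].
Qed.

Lemma hatP_is_derive a e x : 0 < e -> is_derive x 1 (hatP a e) (hat a e x).
Proof.
move=> e0; apply: (@is_derive_quadratic _ _ _ (2 / e ^+ 2)).
  by rewrite divr_ge0// ?sqr_ge0.
by move=> h; exact: hatP_quadratic.
Qed.

End HatKernel.

(** * Lebesgue points *)

Section LebesguePoints.
Context {R : realType}.
Local Notation mu := (@lebesgue_measure R).
Implicit Types (l a e y : R) (v : R -> R).

(** A null set cannot contain an interval of positive length. *)
Lemma ae_exists (P : R -> Prop) (a b : R) : a < b ->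
  {ae mu, forall y, P y} -> exists y, a < y < b /\ P y.
Proof.
move=> ab [N [mN N0 hN]]; apply: contrapT => H.
have : (mu `]a, b[ <= mu N)%E.
  apply: le_measure; rewrite ?inE//.
  move=> y; rewrite /= in_itv/= => yab; apply: hN => /= Py.
  by apply: H; exists y.
by rewrite N0 lebesgue_measure_itv/= lte_fin ab -EFinD lee_fin leNgt subr_gt0 ab.
Qed.

Lemma integrable_center_ball v a e : mu.-integrable setT (EFin \o v) ->
  mu.-integrable (ball a e) (EFin \o (fun y => v y - v a)).
Proof.
move=> iv; have mB : measurable (ball a e : set R) by exact: measurable_ball.
have muB : (mu (ball a e) < +oo)%E.
  have [e0|e0] := leP 0 e; first by rewrite lebesgue_measure_ball// ltry.
  by rewrite (ball0 _ _).2 ?measure0// ltW.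
have iva : mu.-integrable (ball a e) (EFin \o cst (v a)).
  apply: measurable_bounded_integrable => //.
  by exists `|v a|; split => [|x xa y _ /=]; [exact: num_real|exact: ltW].
have ivB : mu.-integrable (ball a e) (EFin \o v) by exact: integrableS iv.
have := integrableB _ ivB iva; rewrite (_ : (_ \- _)%E = EFin \o (fun y => v y - v a))//; exact.
Qed.

Lemma lebesgue_pt_avg v a eta : mu.-integrable setT (EFin \o v) ->
  lebesgue_pt v a -> 0 < eta ->
  exists2 d, 0 < d & forall e, 0 < e -> e < d ->
    \int[mu]_(y in ball a e) `|v y - v a| <= eta * e.
Proof.
move=> iv va eta0.
(* The ball has measure [2 * e], so a mean below [eta / 2] gives an integral below [eta * e]. *)
have eta20 : 0 < eta / 2 by rewrite divr_gt0.
have H : nbhs (0%E : \bar R) [set x | (x < (eta / 2)%:E)%E].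
  by apply: open_nbhs_nbhs; split; [exact: open_ereal_lt_ereal|rewrite /= lte_fin].
have [d /= d0 Hd] := va _ H.
exists d => // e e0 ed; have := Hd e; rewrite /ball_/= sub0r normrN gtr0_norm//.
move=> /(_ ed e0).
rewrite /davg /iavg (lebesgue_measure_ball _ (ltW e0)). rewrite inver mulrn_eq0/= gt_eqF//.
rewrite (_ : (\int[mu]_(y in _) _)%E = (\int[mu]_(y in ball a e) `|v y - v a|)%:E); last first.
  by rewrite -EFin_Rintegral//; [exact: measurable_ball|
     apply: integrable_norm; exact: integrable_center_ball].
rewrite -EFinM lte_fin ltr_pdivrMl; last by rewrite mulrn_wgt0.
by move=> /ltW /le_trans; apply; rewrite -mulr_natr; lra.
Qed.

Lemma integrable_lebesgue_pt v : mu.-integrable setT (EFin \o v) ->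
  {ae mu, forall a, lebesgue_pt v a}.
Proof.
move=> iv; apply: lebesgue_differentiation.
have := integrable_locally_restrict measurableT iv.
by rewrite restrict_set1 || rewrite patch_setT.
Qed.

End LebesguePoints.

Section WeakDerivative.
Context {R : realType}.
Local Notation mu := (@lebesgue_measure R).
Implicit Types (l a b e y : R) (f g u v F G phi : R -> R).

Lemma integrable_restrict_segment l u : intg l u ->
  mu.-integrable setT (EFin \o (u \_ `[0, l])).
Proof. by move=> hu; rewrite -restrict_EFin; apply/(integrable_mkcond _ _).1. Qed.

Lemma hat_meas l a e : measurable_fun `[0, l] (hat a e : R -> R).
Proof.
apply: (@measurable_funS _ _ _ _ setT) => //.
by apply: continuous_measurable_fun; exact: hat_continuous.
Qed.

Lemma intg_hat l a e u : 0 < e -> intg l u -> intg l (fun y => u y * hat a e y).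
Proof.
move=> e0 hu; apply: (intgM_bounded (a := 2 / e)) => //; first exact: hat_meas.
by move=> y _; rewrite ger0_norm ?hat_ge0// hat_le.
Qed.

Lemma Rint_hat l a e : 0 < e -> e <= a -> a + e <= l -> Rint l (hat a e) = 2.
Proof.
move=> e0 ea ael; have l0 : 0 <= l by lra.
have ch : continuous (hat a e) by move=> x; exact: hat_continuous.
have [_ H] := @prim_derivable _ l (hatP a e) (hat a e) l0
  (fun x _ => hatP_is_derive a x e0) (continuous_subspaceT ch).
have := H l; rewrite l0 lexx => /(_ isT).
by rewrite hatP_right// (@hatP_left _ a e 0)//; [lra|lra].
Qed.

(** The tent has mass 2 and is at most [2 / e] on the ball of radius [e], outside which it vanishes;
    at a Lebesgue point the deviation of [u] from [u a] integrates over this ball to at most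
    [eta / 2 * e]. *)
Lemma hat_avg l a u (eta : R) : intg l u -> 0 < a < l ->
  lebesgue_pt (u \_ `[0, l]) a -> 0 < eta ->
  exists2 d, 0 < d & forall e, 0 < e -> e < d ->
    `|Rint l (fun y => u y * hat a e y) - 2 * u a| <= eta.
Proof.
move=> hu /andP[a0 al] ha eta0.
have iv := integrable_restrict_segment hu.
set v := u \_ `[0, l] in ha iv.
have uv y : 0 <= y <= l -> u y = v y.
  by move=> yl; rewrite /v patchE ifT// inE/= in_itv.
have eta20 : 0 < eta / 2 by rewrite divr_gt0.
have [d d0 Hd] := lebesgue_pt_avg iv ha eta20.
exists (Num.min d (Num.min a (l - a))).
  by rewrite !lt_min d0 a0 subr_gt0.
move=> e e0; rewrite !lt_min => /andP[ed /andP[ea el]].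
have l0 : 0 <= l by lra.
have hv : intg l v by apply: intg_eq hu.
have hw : intg l (fun y => v y - v a) by apply: intgB => //; exact: intg_cst.
have hh : intg l (hat a e).
  by apply: intg_eq (intg_hat a e0 (intg_cst l 1)) => y _; rewrite mul1r.
have -> : Rint l (fun y => u y * hat a e y) - 2 * u a =
    Rint l (fun y => (v y - v a) * hat a e y).
  rewrite -(@Rint_hat l a e) ?ltW//; last lra.
  rewrite [_ * u a]mulrC -RintZ// -RintB//; [|exact: intg_hat|exact: intgZ].
  apply: Rint_eq => y yl; rewrite (uv y)// (uv a) ?ltW//.
  by rewrite mulrBl.
apply: (le_trans (le_normr_Rint (intg_hat a e0 hw))).
have iB := integrable_center_ball a e iv.
have Bl : ball a e `<=` `[0, l].
  by rewrite ball_itv; apply: subset_itv; rewrite bnd_simp; lra.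
have hB : intg l ((fun y => `|v y - v a|) \_ (ball a e)).
  rewrite /intg -restrict_EFin; apply/integrable_restrict => //.
    exact: measurable_ball.
  rewrite setIidr//; exact: integrable_norm iB.
apply: (@le_trans _ _ (Rint l (fun y => (2 / e) * ((fun y => `|v y - v a|) \_ (ball a e)) y))).
  apply: le_Rint.
  - by apply: intg_norm; exact: intg_hat.
  - exact: intgZ.
  - move=> y _; rewrite normrM (ger0_norm (hat_ge0 _ _ _)).
    rewrite patchE; case: ifPn => [_|].
      by rewrite mulrC ler_wpM2r// hat_le.
    rewrite notin_setE/= /ball/= => /negP; rewrite -leNgt distrC => hy.
    by rewrite hat_out// !mulr0.
rewrite RintZ// /Rint -Rintegral_mkcondr setIidr//.
rewrite mulrAC ler_pdivrMr//; have := Hd e e0 ed; lra.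
Qed.

Lemma test_fun_prim l phi : 0 < l -> test_fun l phi ->
  [/\ prim l phi (derive1 phi), phi 0 = 0 & phi l = 0].
Proof.
move=> l0 [dphi cphi [a [b [a0 bl H]]]]; split.
- apply: prim_derivable; [exact: ltW| |exact: continuous_subspaceT].
  by move=> x _; rewrite derive1E; exact: derivableP.
- by apply: H; lra.
- by apply: H; lra.
Qed.

(** A single step is not compactly supported, but two steps agree to the left of both transitions,
    where they are -1, and to the right of both, where they are 1. *)
Lemma test_fun_hat l a b e : 0 < e -> e < a < l - e -> e < b < l - e ->
  test_fun l (fun x => hatP a e x - hatP b e x) /\
  derive1 (fun x => hatP a e x - hatP b e x) = (fun x => hat a e x - hat b e x).
Proof.
move=> e0 ha hb.
have D (x : R) : is_derive x 1 (fun x => hatP a e x - hatP b e x) (hat a e x - hat b e x).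
  by apply: is_deriveB; exact: hatP_is_derive.
have DE : derive1 (fun x => hatP a e x - hatP b e x) = (fun x => hat a e x - hat b e x).
  by apply/funext => x; rewrite derive1E; apply: (@derive_val _ _ _ _ _ _ _ (D x)).
split => //; split.
- by move=> x; apply: (@ex_derive _ _ _ _ _ _ _ (D x)).
- rewrite DE => x; apply: cvgB; exact: hat_continuous.
- exists (Num.min a b - e), (Num.max a b + e); split.
  + by rewrite subr_gt0 lt_min; apply/andP; split; lra.
  + by rewrite -ltrBrDr gt_max; apply/andP; split; lra.
  + move=> x /negP; rewrite negb_and -!ltNge => /orP[|].
      by rewrite ltrBrDr lt_min => /andP[h1 h2]; rewrite !hatP_left ?subrr//; lra.
    rewrite -ltrBrDr gt_max => /andP[h1 h2].
    by rewrite !hatP_right ?subrr//; lra.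
Qed.

(** Testing with two steps at Lebesgue points [a] and [b] equates the tent averages of [u] there;
    these approach [2 * u a] and [2 * u b]. With [b] fixed once and for all, [u b] is the
    constant. *)
Lemma du_bois_reymond l u : 0 < l -> intg l u ->
  (forall phi, test_fun l phi -> Rint l (fun y => u y * derive1 phi y) = 0) ->
  exists c, eq_ae l u (fun=> c).
Proof.
move=> l0 hu H.
have iv := integrable_restrict_segment hu.
have L := integrable_lebesgue_pt iv.
have [b [bl hb]] := ae_exists l0 L.
exists (u b).
(* The endpoints are discarded because the tents have to fit inside the open interval. *)
have L0 : {ae mu, forall y : R, y <> 0 /\ y <> l}.
  have N (c : R) : {ae mu, forall y : R, y <> c}.
    exists [set c]; split => //; first by rewrite lebesgue_measure_set1.
    by move=> y /= /contrapT.
  by apply: aeS2 (N 0) (N l).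
apply: aeS2 L L0 => a ha [a0 al] /andP[a0' al'].
have {a0' al' a0 al}al : 0 < a < l.
  by rewrite !lt_neqAle a0' al' eq_sym !andbT; apply/andP; split; apply/eqP.
apply/eqP; rewrite -subr_eq0 -normr_le0; apply/ler_addgt0Pr => eta eta0.
have [d1 d10 H1] := hat_avg hu al ha eta0.
have [d2 d20 H2] := hat_avg hu bl hb eta0.
move: al bl => /andP[a0 al] /andP[b0 bl].
pose m := Num.min (Num.min d1 d2) (Num.min (Num.min a b) (Num.min (l - a) (l - b))).
have m0 : 0 < m by rewrite !lt_min d10 d20 a0 b0 !subr_gt0 al bl.
have e0 : 0 < m / 2 by rewrite divr_gt0.
have em : m / 2 < m by rewrite ltr_pdivrMr// ltr_pMr// ltr1n.
move: (m / 2) e0 em => e e0 em.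
have : e < m by []; rewrite /m !lt_min.
move=> /andP[/andP[ed1 ed2] /andP[/andP[ea eb] /andP[ela elb]]].
have [||/H + E] := @test_fun_hat l a b e e0; [lra|lra|].
rewrite E.
have -> : Rint l (fun y => u y * (hat a e y - hat b e y)) =
   Rint l (fun y => u y * hat a e y) - Rint l (fun y => u y * hat b e y).
  by rewrite -RintB; [|exact: intg_hat..]; apply: Rint_eq => y _; rewrite mulrBr.
have := H1 e e0 ed1; have := H2 e e0 ed2.
rewrite add0r !ler_norml => /andP[h1 h2] /andP[h3 h4] h5; apply/andP; split; lra.
Qed.

(** Integration by parts against a test function shows that [f] minus the primitive of [g] has weak
    derivative 0, hence is constant by [du_bois_reymond]. *)
Lemma weak_deriv_prim l f g : 0 < l -> is_weak_deriv l f g ->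
  exists F, prim l F g /\ eq_ae l f F.
Proof.
move=> l0 [hf hg H]; have l0' := ltW l0.
have pG := prim_Rint hg.
have [|phi tphi|c hc] := @du_bois_reymond l (fun y => f y - Rint y g) l0.
- by apply: intgB => //; apply: L2_intg; exact: prim_L2 pG.
- have [pphi phi0 phil] := test_fun_prim l0 tphi.
  have [hphi _] := pphi.
  have bphi := intg_meas hphi.
  have i2 := prim_intgMl l0' pG hphi.
  have i3 := prim_intgM l0' pphi hg.
  have [_ cphi _] := tphi.
  (* The derivative of a test function is bounded on the segment; this makes its product with the
     merely integrable [f] integrable. *)
  have cn : {within `[0, l], continuous (fun y => `|derive1 phi y|)}.
    by apply: continuous_subspaceT => y; apply: cvg_norm; exact: cphi.
  have [c _ hc] := EVT_max l0' cn.
  have i1 : intg l (fun y => f y * derive1 phi y).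
    apply: (intgM_bounded (a := `|derive1 phi c|)) => //.
  have -> : Rint l (fun y => (f y - Rint y g) * derive1 phi y) =
     Rint l (fun y => f y * derive1 phi y - Rint y g * derive1 phi y).
    by apply: Rint_eq => y _; rewrite mulrBl.
  rewrite RintB// H//.
  have := Rint_by_parts l0' pG pphi.
  rewrite RintD// phi0 phil !mulr0 subrr; lra.
exists (fun y => c + Rint y g); split.
  split => // y yl; rewrite Rint_at0; ring.
by apply: aeS hc => y h yl; rewrite -h// subrK.
Qed.

End WeakDerivative.

(** * Absolute continuity and uniqueness of primitives *)

Section AbsoluteContinuity.
Context {R : realType}.
Local Notation mu := (@lebesgue_measure R).
Implicit Types (l a b y : R) (f g u v F G : R -> R).

Lemma prim_dist_le l F f a b : prim l F f -> 0 <= a -> a <= b -> b <= l ->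
  `|F b - F a| <= \int[mu]_(x in `]a, b[) `|(f \_ `[0, l]) x|.
Proof.
move=> [hf FE] a0 ab bl.
have sub : `]a, b[ `<=` `[0, l] by apply: subset_itv; rewrite bnd_simp.
have iab : mu.-integrable `]a, b[ (EFin \o f) by apply: integrableS hf.
have -> : F b - F a = \int[mu]_(x in `]a, b[) f x.
  rewrite (FE b) ?(le_trans a0)// (FE a) ?a0 ?(le_trans ab)//.
  rewrite (@RintE _ b f a) ?a0//; last exact: intgS hf.
  by rewrite Rintegral_itv_bndo_bndc//; ring.
apply: (le_trans (le_normr_Rintegral _ iab)) => //.
rewrite le_eqVlt; apply/orP; left; apply/eqP; apply: eq_Rintegral => x.
by rewrite inE => /sub xl; rewrite patchE mem_set.
Qed.

(** The increments over disjoint intervals add up to at most the integral of the absolute value of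
    [f] over their union [A], which is small with the measure of [A]. *)
Lemma prim_abs_cont l F f : prim l F f -> abs_cont l F.
Proof.
move=> hF e e0; have [hf _] := hF.
have iv := integrable_restrict_segment hf.
have [d [d0 Hd]] := integral_normr_continuous iv e0.
exists d => // n a b hab tab sd.
pose A := \big[setU/set0]_(i <- index_enum 'I_n) `]a i, b i[%classic.
have mA : measurable A by exact: bigsetU_measurable.
apply: le_lt_trans (Hd A mA _); last first.
  rewrite /A measure_bigsetU_ord//.
  rewrite (eq_bigr (fun i => (b i - a i)%:E)) ?sumEFin ?lte_fin// => i _.
  have [_ [ab _]] := hab i.
  transitivity (mu `]a i, b i[) => //.
  rewrite lebesgue_measure_itv/= lte_fin; case: ltP => [//|ba].
  by congr EFin; lra.
apply: (@le_trans _ _ (\sum_(i < n) \int[mu]_(x in `]a i, b i[) `|(f \_ `[0, l]) x|)).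
  by apply: ler_sum => i _; have [? [? ?]] := hab i; exact: prim_dist_le hF _ _ _.
have inv : mu.-integrable setT (EFin \o (fun x => `|(f \_ `[0, l]) x|)).
  exact: integrable_norm iv.
rewrite -lee_fin -EFin_Rintegral//; last exact: integrableS inv.
rewrite integral_bigsetU_EFin//.
- rewrite -sumEFin; apply: lee_sum => i _; rewrite EFin_Rintegral//.
  exact: integrableS inv.
- exact: index_enum_uniq.
- exact: sub_trivIset tab.
- apply: (@measurable_funS _ _ _ _ setT) => //; exact: (measurable_int mu inv).
Qed.

Lemma abs_cont_continuous l F y e : abs_cont l F -> 0 <= y <= l -> 0 < e ->
  exists2 d, 0 < d & forall x, 0 <= x <= l -> `|x - y| < d -> `|F x - F y| < e.
Proof.
move=> hF /andP[y0 yl] e0; have [d d0 Hd] := hF e e0; exists d => // x /andP[x0 xl] xy.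
have tr (a b : R) : trivIset [set: 'I_1] (fun=> `]a, b[%classic).
  by move=> i j _ _ _; rewrite [i]ord1 [j]ord1.
have [h|h] := leP x y.
  have := Hd 1%N (fun=> x) (fun=> y) (fun=> conj x0 (conj h yl)) (tr _ _).
  rewrite !big_ord1 distrC => ->//.
  by rewrite -(ger0_norm (_ : 0 <= y - x)) ?subr_ge0// distrC.
have := Hd 1%N (fun=> y) (fun=> x) (fun=> conj y0 (conj (ltW h) xl)) (tr _ _).
rewrite !big_ord1 => ->//.
by rewrite -(ger0_norm (_ : 0 <= x - y)) ?subr_ge0// ltW.
Qed.

Lemma abs_cont_ae_eq l F G : 0 < l -> abs_cont l F -> abs_cont l G ->
  eq_ae l F G -> forall y, 0 <= y <= l -> F y = G y.
Proof.
move=> l0 hF hG FG y yl; apply/eqP; rewrite -subr_eq0 -normr_le0.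
apply/ler_addgt0Pr => e e0; rewrite add0r.
have e20 : 0 < e / 2 by rewrite divr_gt0.
have [d1 d10 H1] := abs_cont_continuous hF yl e20.
have [d2 d20 H2] := abs_cont_continuous hG yl e20.
pose d := Num.min d1 d2.
have d0 : 0 < d by rewrite lt_min d10.
move: yl => /andP[y0 yl].
(* Truncated to the segment, the neighbourhood of [y] still has positive length, even when [y] is an
   endpoint, so it contains a point where [F] and [G] agree. *)
have ab : Num.max 0 (y - d) < Num.min l (y + d).
  by rewrite lt_min !gt_max l0 /=; apply/andP; split; [|apply/andP; split]; lra.
have [x [/andP[]]] := ae_exists ab FG.
rewrite gt_max lt_min => /andP[x0 xd] /andP[xl xd'] Fx.
have xy : `|x - y| < d by rewrite ltr_norml; apply/andP; split; lra.
move: xy; rewrite lt_min => /andP[xy1 xy2].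
have x0l : 0 <= x <= l by rewrite !ltW.
have := H1 x x0l xy1; have := H2 x x0l xy2; rewrite (Fx x0l).
rewrite !ltr_norml ler_norml => /andP[? ?] /andP[? ?].
by apply/andP; split; lra.
Qed.

(** The densities agree because [k = f - g] integrates to 0 over every ball inside the segment: at a
    Lebesgue point [a] this leaves [2 * e] times the absolute value of [k a] at most [eta * e]. *)
Lemma prim_unique l F f G g : 0 < l -> prim l F f -> prim l G g ->
  eq_ae l F G -> (forall y, 0 <= y <= l -> F y = G y) /\ eq_ae l f g.
Proof.
move=> l0 hF hG FG.
have FGe := abs_cont_ae_eq l0 (prim_abs_cont hF) (prim_abs_cont hG) FG.
split => //; have [hf FE] := hF; have [hg GE] := hG.
pose k y := f y - g y.
have hk : intg l k by exact: intgB.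
have k0 y : 0 <= y <= l -> Rint y k = 0.
  move=> /[dup] yl /andP[y0 yl']; rewrite RintB; [|exact: intgS hf|exact: intgS hg].
  have := FGe _ yl; rewrite (FE y)// (GE y)// (FGe 0) ?lexx ?ltW//; lra.
have iv := integrable_restrict_segment hk.
have L := integrable_lebesgue_pt iv.
have L0 : {ae mu, forall y : R, y <> 0 /\ y <> l}.
  have N (c : R) : {ae mu, forall y : R, y <> c}.
    exists [set c]; split => //; first by rewrite lebesgue_measure_set1.
    by move=> y /= /contrapT.
  by apply: aeS2 (N 0) (N l).
apply: aeS2 L L0 => a ha [a0 al] /andP[a0' al'].
have {a0' al' a0 al}/andP[a0 al] : 0 < a < l.
  by rewrite !lt_neqAle a0' al' eq_sym !andbT; apply/andP; split; apply/eqP.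
apply/eqP; rewrite -subr_eq0 -normr_le0; apply/ler_addgt0Pr => eta eta0.
rewrite add0r.
have [d d0 Hd] := lebesgue_pt_avg iv ha eta0.
pose e := Num.min d (Num.min a (l - a)) / 2.
have m0 : 0 < Num.min d (Num.min a (l - a)) by rewrite !lt_min d0 a0 subr_gt0.
have e0 : 0 < e by rewrite divr_gt0.
have : e < Num.min d (Num.min a (l - a)) by rewrite ltr_pdivrMr// ltr_pMr// ltr1n.
rewrite !lt_min => /andP[ed /andP[ea el]].
have Bl : ball a e `<=` `[0, l].
  by rewrite ball_itv; apply: subset_itv; rewrite bnd_simp; lra.
have iB := integrable_center_ball a e iv.
have ikB : mu.-integrable (ball a e) (EFin \o (k \_ `[0, l])).
  by apply: integrableS iv => //; exact: measurable_ball.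
have vB : \int[mu]_(y in ball a e) (k \_ `[0, l]) y = 0.
  have i2 : mu.-integrable `]a - e, a + e[ (EFin \o k).
    by apply: integrableS hk => //; rewrite -ball_itv.
  transitivity (\int[mu]_(y in `]a - e, a + e[) k y).
    rewrite -ball_itv; apply: eq_Rintegral => y; rewrite inE => /Bl yl.
    by rewrite patchE mem_set.
  rewrite Rintegral_itv_bndo_bndc//.
  have := @RintE _ (a + e) k (a - e).
  rewrite k0 ?k0; [|lra|lra].
  by rewrite add0r => <-//; [apply: intgS hk; lra|lra].
have vaE : (k \_ `[0, l]) a = k a.
  by rewrite patchE mem_set//= in_itv/= !ltW.
have muB : (mu (ball a e) < +oo)%E by rewrite lebesgue_measure_ball ?ltry ?ltW.
have icB : mu.-integrable (ball a e) (EFin \o (fun=> k a)).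
  apply: measurable_bounded_integrable => //; first exact: measurable_ball.
  by exists `|k a|; split => [|x xa y _ /=]; [exact: num_real|exact: ltW].
have := le_normr_Rintegral _ iB.
move=> /(_ (measurable_ball _ _)) /le_trans /(_ (Hd e e0 ed)).
rewrite vaE RintegralB//; last exact: measurable_ball.
rewrite vB sub0r normrN Rintegral_cst; last exact: measurable_ball.
rewrite (_ : fine _ = e *+ 2); last first.
  by transitivity (fine (mu (ball a e))) => //; rewrite lebesgue_measure_ball ?ltW.
rewrite normrM [X in _ * X]ger0_norm; last first.
  by rewrite mulrn_wge0// ltW.
rewrite -mulr_natr mulrA mulrAC ler_pM2r// /k.
have := normr_ge0 (f a - g a); lra.
Qed.

End AbsoluteContinuity.

(** * Sobolev functions and their absolutely continuous representatives *)

Section Sobolev.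
Context {R : realType}.
Implicit Types (l a b y : R) (f g u v F G : R -> R).

(** [acrep] is only a choice, but continuity leaves a single absolutely continuous candidate on the
    segment, so any explicit primitive computes it. *)
Lemma acrep_prim l F f g : 0 < l -> prim l F g -> eq_ae l f F ->
  [/\ prim l (acrep l f) g, (forall y, 0 <= y <= l -> acrep l f y = F y) &
      eq_ae l f (acrep l f)].
Proof.
move=> l0 hF fF; have acF := prim_abs_cont hF.
have [acA Af] : [set F | abs_cont l F /\ eq_ae l F f] (acrep l f).
  by apply: (xgetPex f); exists F; split => //; exact: eq_ae_sym.
have E : forall y, 0 <= y <= l -> acrep l f y = F y.
  by apply: abs_cont_ae_eq => //; exact: eq_ae_trans fF.
split => //; last exact: eq_ae_sym.
by apply: prim_eq hF => [|y yl]; [exact: ltW|rewrite E].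
Qed.

Lemma weak_deriv_acrep l f g : 0 < l -> is_weak_deriv l f g ->
  prim l (acrep l f) g /\ eq_ae l f (acrep l f).
Proof.
move=> l0 /(weak_deriv_prim l0) [F [hF fF]].
by have [] := acrep_prim l0 hF fF.
Qed.

Lemma weak_deriv_unique l f g g' : 0 < l -> is_weak_deriv l f g ->
  is_weak_deriv l f g' -> eq_ae l g g'.
Proof.
move=> l0 /(weak_deriv_acrep l0) [h1 _] /(weak_deriv_acrep l0) [h2 _].
by have [] := prim_unique l0 h1 h2 (eq_ae_refl _ _).
Qed.

Lemma wderivP l f g : is_weak_deriv l f g -> is_weak_deriv l f (wderiv l f).
Proof. by move=> h; apply: (xgetPex (fun=> 0)); exists g. Qed.

Lemma prim_weak_deriv l F f : 0 < l -> prim l F f -> is_weak_deriv l F f.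
Proof.
move=> l0 hF; have l0' := ltW l0; have [hf _] := hF.
split; [exact: L2_intg (prim_L2 l0' hF)|exact: hf|].
move=> phi /(test_fun_prim l0)[hphi phi0 phil]; have [hphi' _] := hphi.
have := Rint_by_parts l0' hF hphi.
rewrite RintD ?phi0 ?phil; [lra|exact: prim_intgM hphi hf|exact: prim_intgMl hF hphi'].
Qed.

(** Measurability of the new representatives has to be supplied, since Borel measurability does not
    survive modification on a null set. *)
Lemma weak_deriv_ae l f g f' g' : 0 < l -> is_weak_deriv l f g ->
  measurable_fun `[0, l] f' -> measurable_fun `[0, l] g' ->
  eq_ae l f f' -> eq_ae l g g' -> is_weak_deriv l f' g'.
Proof.
move=> l0 [hf hg H] mf' mg' ff' gg'; split.
- exact: intg_ae ff' hf.
- exact: intg_ae gg' hg.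
- move=> phi /[dup] tphi /(test_fun_prim l0)[hphi _ _].
  have mphi := prim_meas (ltW l0) hphi; have mphi' := intg_meas hphi.1.
  have E1 : Rint l (fun y => f y * derive1 phi y) = Rint l (fun y => f' y * derive1 phi y).
    apply: Rint_ae; [|exact: measurable_funM|].
    + by apply: measurable_funM => //; exact: intg_meas.
    + by apply: aeS ff' => y h yl; rewrite h.
  have E2 : Rint l (fun y => g y * phi y) = Rint l (fun y => g' y * phi y).
    apply: Rint_ae; [|exact: measurable_funM|].
    + by apply: measurable_funM => //; exact: intg_meas.
    + by apply: aeS gg' => y h yl; rewrite h.
  by rewrite -E1 -E2; exact: H.
Qed.

(* Linear combinations are taken on the absolutely continuous representatives,
   where they are immediate. *)
Lemma weak_deriv_lin l a f g f' g' : 0 < l -> is_weak_deriv l f g ->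
  is_weak_deriv l f' g' ->
  is_weak_deriv l (fun y => a * f y + f' y) (fun y => a * g y + g' y).
Proof.
move=> l0 hf hf'; have [h1 e1] := weak_deriv_acrep l0 hf.
have [h2 e2] := weak_deriv_acrep l0 hf'.
have [if_ _ _] := hf; have [if' _ _] := hf'.
have hp := prim_lin a h1 h2.
apply: (weak_deriv_ae l0 (prim_weak_deriv l0 hp)).
- by apply: intg_meas; apply: intgD => //; exact: intgZ.
- by apply: intg_meas; exact: hp.1.
- by apply: eq_ae_lin; exact: eq_ae_sym.
- exact: eq_ae_refl.
Qed.

Definition H1 l f : Prop := inL2 l f /\ exists2 g, is_weak_deriv l f g & inL2 l g.

Lemma sobolev1E l f : sobolev l 1 f <-> H1 l f.
Proof. by split => [[h [g [? ?]]]|[h [g ? ?]]]; split => //; exists g. Qed.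

Lemma sobolev_L2 l m f : sobolev l m f -> inL2 l f.
Proof. by case: m => [|m] []. Qed.

Lemma H1_wderiv l f : 0 < l -> H1 l f ->
  [/\ is_weak_deriv l f (wderiv l f), inL2 l (wderiv l f),
      prim l (acrep l f) (wderiv l f) & eq_ae l f (acrep l f)].
Proof.
move=> l0 [hf [g fg hg]].
have wf := wderivP fg; have [p e] := weak_deriv_acrep l0 wf.
split => //; apply: L2_ae hg; first by case: wf => _ /intg_meas.
exact: weak_deriv_unique fg wf.
Qed.

Lemma sobolevS_wderiv l m f : 0 < l -> sobolev l m.+1 f -> H1 l f.
Proof. by move=> l0 [hf [g [fg gm]]]; split => //; exists g => //; exact: sobolev_L2 gm. Qed.

Lemma H1_lin l a f g : 0 < l -> H1 l f -> H1 l g -> H1 l (fun y => a * f y + g y).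
Proof.
move=> l0 [hf [f' ff hf']] [hg [g' gg hg']]; split.
  by apply: L2_add => //; exact: L2_scale.
exists (fun y => a * f' y + g' y); first exact: weak_deriv_lin.
by apply: L2_add => //; exact: L2_scale.
Qed.

Lemma H1_ae l f g : 0 < l -> inL2 l g -> H1 l f -> eq_ae l f g -> H1 l g.
Proof.
move=> l0 mg [hf [f' ff hf']] fg; split => //; exists f' => //.
apply: (weak_deriv_ae l0 ff) => //; [exact: L2_meas|by case: hf'|exact: eq_ae_refl].
Qed.

Lemma wderiv_ae l f g : 0 < l -> H1 l f -> inL2 l g -> eq_ae l f g ->
  eq_ae l (wderiv l f) (wderiv l g).
Proof.
move=> l0 hf lg fg; have hg := H1_ae l0 lg hf fg.
have [wf lwf _ _] := H1_wderiv l0 hf; have [wg _ _ _] := H1_wderiv l0 hg.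
apply: (weak_deriv_unique l0 _ wg).
exact: (weak_deriv_ae l0 wf (L2_meas lg) (L2_meas lwf) fg (eq_ae_refl _ _)).
Qed.

Lemma wderiv_lin l a f g : 0 < l -> H1 l f -> H1 l g ->
  eq_ae l (wderiv l (fun y => a * f y + g y))
          (fun y => a * wderiv l f y + wderiv l g y).
Proof.
move=> l0 hf hg; have [wf _ _ _] := H1_wderiv l0 hf; have [wg _ _ _] := H1_wderiv l0 hg.
have [wfg _ _ _] := H1_wderiv l0 (H1_lin a l0 hf hg).
exact: (weak_deriv_unique l0 wfg (weak_deriv_lin a l0 wf wg)).
Qed.

Lemma acrep_ae l f g y : 0 < l -> H1 l f -> inL2 l g -> eq_ae l f g ->
  0 <= y <= l -> acrep l f y = acrep l g y.
Proof.
move=> l0 hf lg fg yl; have hg := H1_ae l0 lg hf fg.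
have [_ _ pf ef] := H1_wderiv l0 hf; have [_ _ pg eg] := H1_wderiv l0 hg.
have e : eq_ae l (acrep l f) (acrep l g).
  exact: eq_ae_trans (eq_ae_trans (eq_ae_sym ef) fg) eg.
by have [H _] := prim_unique l0 pf pg e; exact: H.
Qed.

Lemma acrep_lin l a f g y : 0 < l -> H1 l f -> H1 l g -> 0 <= y <= l ->
  acrep l (fun y => a * f y + g y) y = a * acrep l f y + acrep l g y.
Proof.
move=> l0 hf hg yl.
have [_ _ pf ef] := H1_wderiv l0 hf; have [_ _ pg eg] := H1_wderiv l0 hg.
have [_ _ pfg efg] := H1_wderiv l0 (H1_lin a l0 hf hg).
have [H _] := prim_unique l0 pfg (prim_lin a pf pg)
  (eq_ae_trans (eq_ae_sym efg) (eq_ae_lin a ef eg)).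
exact: H.
Qed.

(** Phrased with the chosen derivative [wderiv] rather than with some weak derivative, so that it
    applies directly to [wderivn l 2 f]. *)
Definition H2 l f : Prop := H1 l f /\ H1 l (wderiv l f).

Lemma sobolev2_H2 l f : 0 < l -> sobolev l 2 f -> H2 l f.
Proof.
move=> l0 hf; have h1 := sobolevS_wderiv l0 hf; split => //.
case: hf => _ [g [fg hg]].
have [wf lw _ _] := H1_wderiv l0 h1.
apply: H1_ae lw ((sobolev1E l g).1 hg) _ => //.
exact: weak_deriv_unique fg wf.
Qed.

Lemma H2_lin l a f g : 0 < l -> H2 l f -> H2 l g -> H2 l (fun y => a * f y + g y).
Proof.
move=> l0 [f1 f2] [g1 g2]; split; first exact: H1_lin.
have [_ lw _ _] := H1_wderiv l0 (H1_lin a l0 f1 g1).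
apply: (H1_ae l0 lw (H1_lin a l0 f2 g2)).
exact: eq_ae_sym (wderiv_lin a l0 f1 g1).
Qed.

Lemma wderiv2_lin l a f g : 0 < l -> H2 l f -> H2 l g ->
  eq_ae l (wderivn l 2 (fun y => a * f y + g y))
          (fun y => a * wderivn l 2 f y + wderivn l 2 g y).
Proof.
move=> l0 [f1 f2] [g1 g2].
have [h1 h2] := H2_lin a l0 (conj f1 f2) (conj g1 g2).
have h3 := H1_lin a l0 f2 g2.
have e := wderiv_ae l0 h2 h3.1 (wderiv_lin a l0 f1 g1).
exact: eq_ae_trans e (wderiv_lin a l0 f2 g2).
Qed.

Lemma wderiv2_ae l f g : 0 < l -> H2 l f -> H2 l g -> eq_ae l f g ->
  eq_ae l (wderivn l 2 f) (wderivn l 2 g).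
Proof.
move=> l0 [f1 f2] [g1 [lg2 _]] fg.
exact: (wderiv_ae l0 f2 lg2 (wderiv_ae l0 f1 g1.1 fg)).
Qed.

End Sobolev.

(** * Poincare inequalities *)

Section PoincareInequalities.
Context {R : realType}.
Implicit Types (l y k : R) (f F : R -> R).

Lemma prim_sqr_le l F f y : 0 < l -> prim l F f -> inL2 l f -> F 0 = 0 ->
  0 <= y <= l -> F y ^+ 2 <= l * Rint l (fun x => f x ^+ 2).
Proof.
move=> l0 [hf FE] lf F0 /andP[y0 yl]; rewrite FE ?y0// F0 add0r.
have if2 := L2_sqr lf.
have h : 0 <= Rint l (fun x => f x ^+ 2) by apply: Rint_ge0 => x _; exact: sqr_ge0.
move: y0; rewrite le_eqVlt => /predU1P[<-|y0].
  by rewrite Rint_at0 expr0n/= mulr_ge0// ltW.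
apply: (@le_trans _ _ (y * Rint y (fun x => f x ^+ 2))).
  (* The Cauchy-Schwarz inequality on [[0, y]] is the nonnegativity of the variance of [f] about its
     mean [a]. *)
  set a := Rint y f / y.
  have : 0 <= Rint y (fun x => (f x - a) ^+ 2) by apply: Rint_ge0 => x _; exact: sqr_ge0.
  have -> : Rint y (fun x => (f x - a) ^+ 2) =
      Rint y (fun x => f x ^+ 2 + ((- (2 * a)) * f x + a ^+ 2)).
    by apply: Rint_eq => x _; ring.
  have i1 := intgS yl if2; have i2 := intgS yl hf.
  have i3 := intgZ (- (2 * a)) i2; have i4 := intg_cst y (a ^+ 2).
  rewrite RintD//; last exact: intgD.
  rewrite RintD// RintZ// (Rint_cst _ (ltW y0)).
  have aE : a * y = Rint y f by rewrite divfK// gt_eqF.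
  rewrite -aE (_ : (a * y) ^+ 2 = y * (a ^+ 2 * y)); last by ring.
  rewrite (_ : - (2 * a) * (a * y) + a ^+ 2 * y = - (a ^+ 2 * y)); last by ring.
  by rewrite subr_ge0 => H; rewrite ler_wpM2l ?(ltW y0).
apply: ler_pM; [exact: ltW|by apply: Rint_ge0 => x _; exact: sqr_ge0|exact: yl|].
rewrite (@RintE _ l _ y) ?yl ?andbT ?(ltW y0)//.
by rewrite lerDl; apply: Rintegral_ge0 => x _; exact: sqr_ge0.
Qed.

(* [q y = k * tan (k * (l - y))] solves the Riccati equation [q' = - k^2 - q^2]
   and vanishes at [l], so integrating [(F^2 q)'] completes a square. *)
Lemma wirtinger_subcritical l F f k : 0 < l -> prim l F f -> inL2 l f -> F 0 = 0 ->
  0 < k -> k * l < pi / 2 ->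
  k ^+ 2 * Rint l (fun x => F x ^+ 2) <= Rint l (fun x => f x ^+ 2).
Proof.
move=> l0 hF lf F0 k0 kl; have l0' := ltW l0.
have lF := prim_L2 l0' hF.
pose q y := k * tan (k * (l - y)).
pose q' y := - (k ^+ 2 + q y ^+ 2).
have cosp y : 0 <= y <= l -> 0 < cos (k * (l - y)).
  move=> /andP[y0 yl]; apply: cos_gt0_pihalf; apply/andP; split.
    apply: (@lt_le_trans _ _ 0); first by rewrite oppr_lt0 divr_gt0 ?pi_gt0.
    by rewrite mulr_ge0 ?subr_ge0// ltW.
  by apply: le_lt_trans kl; rewrite ler_pM2l//; lra.
have dq y : 0 <= y <= l -> is_derive y 1 q (q' y).
  move=> yl; have c0 : cos (k * (l - y)) != 0 by rewrite gt_eqF// cosp.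
  have D1 : is_derive y 1 (fun y => k * (l - y)) (- k).
    apply: is_derive_eq.
    rewrite /GRing.scale/=; ring.
  have D2 := @is_derive1_comp _ tan (fun y => k * (l - y)) y _ _ (is_derive_tan c0) D1.
  have D3 := is_deriveZ k D2.
  apply: is_derive_eq D3 _.
  rewrite /q' /q /GRing.scale/= cos2_tan2//; ring.
have hq : prim l q q'.
  have cq : {within `[0, l], continuous q}.
    apply: continuous_in_subspaceT => x; rewrite inE/= in_itv/= => /dq [dx _].
    by apply: differentiable_continuous; apply/derivable1_diffP.
  apply: prim_derivable => //.
  move=> x; apply: cvgN; apply: cvgD; first exact: cvg_cst.
  by rewrite /=; apply: cvgM; exact: cq.
have hF2 := prim_mul l0' hF hF.
have := Rint_by_parts l0' hF2 hq.
rewrite F0 {2}/q subrr mulr0 tan0 !mulr0 !mul0r subrr => E.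
have ihs : intg l (fun y => (f y * F y + F y * f y) * q y + F y * F y * q' y).
  exact: (prim_mul l0' hF2 hq).1.
have iF2 := L2_sqr lF.
(* Adding the integral [E], which is 0, turns the integrand on the left into
   [2 * f * F * q - F ^+ 2 * q ^+ 2], at most [f ^+ 2]. *)
rewrite -RintZ// -[leLHS]addr0 -E -RintD//; last exact: intgZ.
apply: le_Rint => //.
- by apply: intgD => //; exact: intgZ.
- exact: L2_sqr.
- by move=> y _; rewrite /q'; have := sqr_ge0 (f y - F y * q y); nra.
Qed.

(** At the critical value [k = pi / (2 * l)] the tangent blows up at 0, so the inequality is taken
    at [s * pi / (2 * l)] with [s < 1] and passed to the limit. *)
Lemma wirtinger l F f : 0 < l -> prim l F f -> inL2 l f -> F 0 = 0 ->
  pi ^+ 2 * Rint l (fun x => F x ^+ 2) <= 4 * l ^+ 2 * Rint l (fun x => f x ^+ 2).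
Proof.
move=> l0 hF lf F0.
have A0 : 0 <= Rint l (fun x => F x ^+ 2) by apply: Rint_ge0 => x _; exact: sqr_ge0.
have B0 : 0 <= Rint l (fun x => f x ^+ 2) by apply: Rint_ge0 => x _; exact: sqr_ge0.
have H s : 0 < s -> s < 1 ->
    s ^+ 2 * (pi ^+ 2 * Rint l (fun x => F x ^+ 2)) <= 4 * l ^+ 2 * Rint l (fun x => f x ^+ 2).
  move=> s0 s1; have p0 := pi_gt0 R.
  have := @wirtinger_subcritical l F f (s * pi / (2 * l)) l0 hF lf F0.
  have l20 : 0 < 2 * l by rewrite mulr_gt0.
  have -> : s * pi / (2 * l) * l = s * (pi / 2) by field; rewrite gt_eqF.
  have pi2 : 0 < (pi : R) / 2 by rewrite divr_gt0.
  rewrite divr_gt0 ?mulr_gt0// => /(_ isT); rewrite gtr_pMl// => /(_ s1).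
  have -> : (s * pi / (2 * l)) ^+ 2 = s ^+ 2 * pi ^+ 2 / (4 * l ^+ 2) by field; rewrite gt_eqF.
  have l2 : 0 < 4 * l ^+ 2 by rewrite mulr_gt0// exprn_gt0.
  rewrite mulrAC ler_pdivrMr// mulrA [X in _ <= X -> _]mulrC.
  by rewrite !expr2 !mulrA.
move: A0 B0 H; move: (4 * _ * _) (Rint _ _) => B A A0 _ H.
have {}A0 : 0 <= pi ^+ 2 * A by rewrite mulr_ge0// sqr_ge0.
move: (pi ^+ 2 * A) A0 H => {}A A0 H.
apply/ler_addgt0Pr => e e0.
have den : 0 < 2 * A + 2 * e by lra.
(* With [s = 1 - d] the loss is at most [2 * d * A <= e]. *)
set d := e / (2 * A + 2 * e).
have d0 : 0 < d by rewrite divr_gt0.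
have dE : d * (2 * A + 2 * e) = e by rewrite divfK// gt_eqF.
have d1 : d < 1 by rewrite ltr_pdivrMr//; lra.
have := H (1 - d); rewrite subr_gt0 d1 => /(_ isT); rewrite gtrBl d0 => /(_ isT); nra.
Qed.

End PoincareInequalities.

(** * The inner product of L^2 and Young's inequality *)

Section L2InnerProduct.
Context {R : realType}.
Implicit Types (l a r y : R) (f g u v w : R -> R).

Definition I2 l u v : R := Rint l (fun y => u y * v y).

Lemma I2C l u v : I2 l u v = I2 l v u.
Proof. by apply: Rint_eq => y _; rewrite mulrC. Qed.

Lemma I2_linl l a u v w : inL2 l u -> inL2 l v -> inL2 l w ->
  I2 l (fun y => a * u y + v y) w = a * I2 l u w + I2 l v w.
Proof.
move=> hu hv hw; have i1 := L2_intgM hu hw; have i2 := L2_intgM hv hw.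
rewrite /I2 -RintZ// -RintD//; last exact: intgZ.
by apply: Rint_eq => y _; ring.
Qed.

Lemma I2_ae l u u' v : inL2 l u -> inL2 l u' -> inL2 l v -> eq_ae l u u' ->
  I2 l u v = I2 l u' v.
Proof.
move=> [mu _] [mu' _] [mv _] uu'; apply: Rint_ae.
- exact: measurable_funM.
- exact: measurable_funM.
- by apply: aeS uu' => y h yl; rewrite h.
Qed.

Lemma I2_ge0 l u : 0 <= I2 l u u.
Proof. by apply: Rint_ge0 => y _; rewrite -expr2 sqr_ge0. Qed.

(** Multiplied by [b], the difference of the two sides is the squared norm of [b u - c v] plus
    [(b * d - c ^+ 2) * I2 l v v]. This covers both Young's inequality with weights and the
    positivity of a 2 by 2 quadratic form. *)
Lemma I2_young l u v (b c d : R) : inL2 l u -> inL2 l v -> 0 <= b -> 0 <= d ->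
  c ^+ 2 <= b * d -> 2 * c * I2 l u v <= b * I2 l u u + d * I2 l v v.
Proof.
move=> hu hv; have uu := I2_ge0 l u; have vv := I2_ge0 l v.
rewrite le_eqVlt => /predU1P[<-|b0] d0 cbd.
  have -> : c = 0 by apply/eqP; rewrite -sqrf_eq0 eq_le sqr_ge0 (le_trans cbd)// mul0r.
  by rewrite mulr0 !mul0r add0r mulr_ge0.
have H : 0 <= b * (b * I2 l u u + d * I2 l v v - 2 * c * I2 l u v).
  have h1 := I2_ge0 l (fun y => b * u y + (- c) * v y).
  have hcv := L2_scale (- c) hv.
  have hb := L2_add (L2_scale b hu) hcv.
  have lin w : inL2 l w ->
      I2 l (fun y => b * u y + (- c) * v y) w = b * I2 l u w - c * I2 l v w.
    move=> hw; rewrite (I2_linl b hu hcv hw) -mulNr; congr (_ + _).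
    rewrite /I2 -RintZ; [apply: Rint_eq => y _; ring|exact: L2_intgM].
  rewrite (lin _ hb) [I2 l u _]I2C [I2 l v _]I2C (lin _ hu) (lin _ hv) in h1.
  by rewrite [I2 l v u]I2C in h1; nra.
by rewrite pmulr_rge0// subr_ge0 in H.
Qed.

(** The sign [s] lets one argument serve [ip1 + Psi] and [ip1 - Psi]. *)
Lemma I2_young_norm l u v (b c d s : R) : inL2 l u -> inL2 l v -> 0 <= b -> 0 <= d ->
  c ^+ 2 <= b * d -> s ^+ 2 = 1 ->
  - (b * I2 l u u + d * I2 l v v) <= s * (2 * c * I2 l u v).
Proof.
move=> hu hv b0 d0 cbd s1.
have := @I2_young l u v b (- (s * c)) d hu hv b0 d0.
by rewrite sqrrN exprMn s1 mul1r => /(_ cbd); lra.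
Qed.

End L2InnerProduct.

(** * Functions clamped at 0 *)

Section ClampedSpaces.
Context {R : realType}.
Implicit Types (l a : R) (f g : R -> R).

Definition H1L l f : Prop := H1 l f /\ acrep l f 0 = 0.
Definition H2L l f : Prop := [/\ H2 l f, acrep l f 0 = 0 & acrep l (wderiv l f) 0 = 0].

Lemma sobolevL1E l f : 0 < l -> sobolevL l 1 f <-> H1L l f.
Proof.
move=> l0; split => [[h1 h2]|[h1 h2]].
  by split; [exact/sobolev1E|exact: (h2 0%N)].
by split; [exact/sobolev1E|case].
Qed.

Lemma sobolev2E l f : 0 < l -> sobolev l 2 f <-> H2 l f.
Proof.
move=> l0; split; first exact: sobolev2_H2.
move=> [h1 h2]; split; first exact: h1.1.
have [w _ _ _] := H1_wderiv l0 h1.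
by exists (wderiv l f); split; [exact: w|exact/sobolev1E].
Qed.

Lemma sobolevL2E l f : 0 < l -> sobolevL l 2 f <-> H2L l f.
Proof.
move=> l0; split => [[h1 h2]|[h1 h2 h3]].
  by split; [exact/sobolev2E|exact: (h2 0%N)|exact: (h2 1%N)].
by split; [exact/sobolev2E|case => [|[]]].
Qed.

Lemma H1L_lin l a f g : 0 < l -> H1L l f -> H1L l g -> H1L l (fun y => a * f y + g y).
Proof.
move=> l0 [f1 f0] [g1 g0]; split; first exact: H1_lin.
by rewrite acrep_lin ?f0 ?g0 ?mulr0 ?addr0 ?lexx ?ltW.
Qed.

Lemma H2L_lin l a f g : 0 < l -> H2L l f -> H2L l g -> H2L l (fun y => a * f y + g y).
Proof.
move=> l0 [f2 f0 f0'] [g2 g0 g0'].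
have [fg1 fg2] := H2_lin a l0 f2 g2; split; first by split; [exact: fg1|exact: fg2].
  by rewrite acrep_lin ?f0 ?g0 ?mulr0 ?addr0 ?lexx ?ltW//; [exact: f2.1|exact: g2.1].
have l0' : (0 : R) <= 0 <= l by rewrite lexx ltW.
have L := (H1_lin a l0 f2.2 g2.2).1.
rewrite (acrep_ae l0 fg2 L (wderiv_lin a l0 f2.1 g2.1) l0').
by rewrite (acrep_lin a l0 f2.2 g2.2 l0') f0' g0' mulr0 addr0.
Qed.

Lemma H1L_poincare l f : 0 < l -> H1L l f ->
  pi ^+ 2 * I2 l f f <= 4 * l ^+ 2 * I2 l (wderiv l f) (wderiv l f).
Proof.
move=> l0 [f1 f0]; have [w lw p e] := H1_wderiv l0 f1.
have := wirtinger l0 p lw f0.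
have lA := prim_L2 (ltW l0) p.
rewrite /I2 -(@Rint_ae _ l (fun x => f x * f x) (fun x => acrep l f x ^+ 2)).
- exact.
- by have [mf _] := f1.1; exact: measurable_funM.
- by have [mA _] := lA; exact: measurable_funX.
- by apply: aeS e => y h yl; rewrite h// expr2.
Qed.

Lemma H1L_sup l f y : 0 < l -> H1L l f -> 0 <= y <= l ->
  acrep l f y ^+ 2 <= l * I2 l (wderiv l f) (wderiv l f).
Proof.
move=> l0 [f1 f0] yl; have [w lw p e] := H1_wderiv l0 f1.
exact: prim_sqr_le.
Qed.

Lemma H2L_wderiv l f : H2L l f -> H1L l (wderiv l f).
Proof. by case=> [[_ h] _ h']; split. Qed.

Lemma H2L_H1L l f : H2L l f -> H1L l f.
Proof. by case=> [[h _] h' _]; split. Qed.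

Lemma le_chain (P Q A B C a b : R) : 0 <= P -> 0 <= b ->
  Q * A <= b * B -> P * B <= a * C -> P * (Q * A) <= b * (a * C).
Proof.
move=> P0 b0 h1 h2; apply: (@le_trans _ _ (P * (b * B))); first exact: ler_wpM2l.
by rewrite mulrCA ler_wpM2l.
Qed.

(** Both [f] and its derivative vanish at 0, so Wirtinger's inequality applies twice and its
    constant is squared. *)
Lemma H2L_poincare l f : 0 < l -> H2L l f ->
  pi ^+ 4 * I2 l f f <= 16 * l ^+ 4 * I2 l (wderivn l 2 f) (wderivn l 2 f).
Proof.
move=> l0 hf; have h1 := H1L_poincare l0 (H2L_H1L hf).
have h2 := H1L_poincare l0 (H2L_wderiv hf).
have l2 : 0 <= 4 * l ^+ 2 by rewrite mulr_ge0 ?sqr_ge0.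
have := le_chain (sqr_ge0 pi) l2 h1 h2.
rewrite (_ : 16 * l ^+ 4 = 4 * l ^+ 2 * (4 * l ^+ 2)); last by ring.
by rewrite [pi ^+ 4](exprD _ 2 2) -!mulrA; apply.
Qed.

Lemma H2L_sup l f y : 0 < l -> H2L l f -> 0 <= y <= l ->
  pi ^+ 2 * acrep l f y ^+ 2 <= 4 * l ^+ 3 * I2 l (wderivn l 2 f) (wderivn l 2 f).
Proof.
move=> l0 hf yl; have := H1L_sup l0 (H2L_H1L hf) yl.
rewrite -[acrep l f y ^+ 2]mul1r => h1.
have h2 := H1L_poincare l0 (H2L_wderiv hf).
have := le_chain (sqr_ge0 pi) (ltW l0) h1 h2.
by rewrite mul1r mulrA (_ : l * (4 * l ^+ 2) = 4 * l ^+ 3)//; ring.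
Qed.

End ClampedSpaces.

Section EnergyIntegrals.
Context {R : realType}.
Implicit Types (l a : R) (u v w : R -> R).

Lemma I2Zr l a u v : inL2 l u -> inL2 l v -> I2 l u (fun y => a * v y) = a * I2 l u v.
Proof.
move=> hu hv; rewrite /I2 -RintZ; last exact: L2_intgM.
by apply: Rint_eq => y _; ring.
Qed.

Lemma I2_relin l a u v w z : inL2 l u -> inL2 l v -> inL2 l w -> inL2 l z ->
  eq_ae l w (fun y => a * u y + v y) -> I2 l w z = a * I2 l u z + I2 l v z.
Proof.
move=> hu hv hw hz e.
by rewrite (I2_ae hw (L2_add (L2_scale a hu) hv) hz e) I2_linl.
Qed.

Lemma I2_comb l (a b : R) u v w z : inL2 l u -> inL2 l v -> inL2 l w -> inL2 l z ->
  Rint l (fun y => a * (u y * v y) + b * (w y * z y)) = a * I2 l u v + b * I2 l w z.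
Proof.
move=> hu hv hw hz; have i1 := L2_intgM hu hv; have i2 := L2_intgM hw hz.
by rewrite RintD ?RintZ//; exact: intgZ.
Qed.

Lemma bilin_mx2 (a b c d u v u' v' : R) :
  bilin (mx2 a b c d) (cv2 u v) (cv2 u' v') =
  a * (u * u') + b * (u * v') + c * (v * u') + d * (v * v').
Proof.
rewrite /bilin !mxE !big_ord_recl big_ord0 !mxE !big_ord_recl !big_ord0 !mxE /=.
ring.
Qed.

Lemma Rint_bilin l (a b c d : R) u v u' v' :
  inL2 l u -> inL2 l v -> inL2 l u' -> inL2 l v' ->
  intg l (fun y => bilin (mx2 a b c d) (cv2 (u y) (v y)) (cv2 (u' y) (v' y))) /\
  Rint l (fun y => bilin (mx2 a b c d) (cv2 (u y) (v y)) (cv2 (u' y) (v' y))) =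
  a * I2 l u u' + b * I2 l u v' + c * I2 l v u' + d * I2 l v v'.
Proof.
move=> hu hv hu' hv'.
have i1 := intgZ a (L2_intgM hu hu'); have i2 := intgZ b (L2_intgM hu hv').
have i3 := intgZ c (L2_intgM hv hu'); have i4 := intgZ d (L2_intgM hv hv').
have i12 := intgD i1 i2; have i123 := intgD i12 i3; split.
  by apply: intg_eq (intgD i123 i4) => y _; rewrite bilin_mx2.
under [LHS]Rint_eq => y _ do rewrite bilin_mx2.
rewrite (RintD i123 i4) (RintD i12 i3) (RintD i1 i2).
by rewrite !RintZ//; exact: L2_intgM.
Qed.

End EnergyIntegrals.

(* The six L^2 functions [f'', h', g, z, f, h] and the four scalars
   [zeta_omega, zeta_phi, f(l), h(l)] through which the two inner products see
   a state.  Working with an abstract [coords] keeps weak derivatives folded. *)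
Record coords (R : realType) := Coords {
  kf2 : R -> R; kh1 : R -> R; kg : R -> R; kz : R -> R; kf : R -> R; kh : R -> R;
  kw : R; kp : R; kfl : R; khl : R }.

(** * The energy space *)

Section Coordinates.
Context {R : realType}.
Variable p : params R.
Implicit Types (K L W : coords R) (a : R).

Local Notation l := (len p).
Local Notation rho := (rho p).
Local Notation Iw := (Iw p).
Local Notation ms := (ms p).
Local Notation cw := (cw p).
Local Notation cphi := (cphi p).
Local Notation eps1 := (eps1 p).
Local Notation eps2 := (eps2 p).
Local Notation xc := (xc p).
Local Notation Iws := (Iws p).
Local Notation Jss := (Jss p).

Definition coordsL2 K : Prop :=
  [/\ inL2 l (kf2 K), inL2 l (kh1 K), inL2 l (kg K), inL2 l (kz K)
    & inL2 l (kf K) /\ inL2 l (kh K)].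

(** Linearity is tested against L^2 functions, because the derivative of a combination equals the
    combination of the derivatives only almost everywhere. *)
Definition coords_lin a K L W : Prop :=
  (forall v, inL2 l v ->
  [/\ I2 l (kf2 W) v = a * I2 l (kf2 K) v + I2 l (kf2 L) v,
      I2 l (kh1 W) v = a * I2 l (kh1 K) v + I2 l (kh1 L) v,
      I2 l (kg W) v = a * I2 l (kg K) v + I2 l (kg L) v,
      I2 l (kz W) v = a * I2 l (kz K) v + I2 l (kz L) v
    & I2 l (kf W) v = a * I2 l (kf K) v + I2 l (kf L) v /\
      I2 l (kh W) v = a * I2 l (kh K) v + I2 l (kh L) v]) /\
  [/\ kw W = a * kw K + kw L, kp W = a * kp K + kp L,
      kfl W = a * kfl K + kfl L & khl W = a * khl K + khl L].

Definition form1 K L : R :=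
  rho * cw ^+ 2 * I2 l (kf2 K) (kf2 L) + Iw * cphi ^+ 2 * I2 l (kh1 K) (kh1 L)
  + (rho * I2 l (kg K) (kg L) + rho * xc * I2 l (kg K) (kz L)
     + rho * xc * I2 l (kz K) (kg L) + Iws * I2 l (kz K) (kz L))
  + (ms * (kw K * kw L) + ms * xc * (kw K * kp L)
     + ms * xc * (kp K * kw L) + Jss * (kp K * kp L)).

Definition formPsi K L : R :=
  eps1 * (rho * (I2 l (kg K) (kf L) + I2 l (kf K) (kg L)))
  + eps2 * (rho * xc * (I2 l (kg K) (kh L) + I2 l (kh K) (kg L)))
  + eps1 * (rho * xc * (I2 l (kz K) (kf L) + I2 l (kf K) (kz L)))
  + eps2 * (Iws * (I2 l (kz K) (kh L) + I2 l (kh K) (kz L)))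
  + (eps1 * (ms * (kw K * kfl L + kw L * kfl K))
    + eps2 * (ms * xc * (kw K * khl L + kw L * khl K))
    + eps1 * (ms * xc * (kp K * kfl L + kp L * kfl K))
    + eps2 * (Jss * (kp K * khl L + kp L * khl K))).

Lemma form1C K L : form1 K L = form1 L K.
Proof.
rewrite /form1 [I2 _ (kf2 L) _]I2C [I2 _ (kh1 L) _]I2C [I2 _ (kg L) (kg K)]I2C.
rewrite [I2 _ (kg L) (kz K)]I2C [I2 _ (kz L) (kg K)]I2C [I2 _ (kz L) (kz K)]I2C.
ring.
Qed.

Lemma formPsiC K L : formPsi K L = formPsi L K.
Proof.
rewrite /formPsi [I2 _ (kg L) (kf K)]I2C [I2 _ (kf L) (kg K)]I2C.
rewrite [I2 _ (kg L) (kh K)]I2C [I2 _ (kh L) (kg K)]I2C.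
rewrite [I2 _ (kz L) (kf K)]I2C [I2 _ (kf L) (kz K)]I2C.
rewrite [I2 _ (kz L) (kh K)]I2C [I2 _ (kh L) (kz K)]I2C.
ring.
Qed.

Lemma form1_lin a K L W V : coordsL2 V -> coords_lin a K L W ->
  form1 W V = a * form1 K V + form1 L V.
Proof.
move=> [f h g z _] [E [ew ep _ _]].
rewrite /form1 ew ep.
have [-> _ _ _ _] := E _ f; have [_ -> _ _ _] := E _ h.
have [_ _ -> -> _] := E _ g; have [_ _ -> -> _] := E _ z.
ring.
Qed.

Lemma formPsi_lin a K L W V : coordsL2 V -> coords_lin a K L W ->
  formPsi W V = a * formPsi K V + formPsi L V.
Proof.
move=> [_ _ g z [f h]] [E [ew ep ef eh]].
rewrite /formPsi ew ep ef eh.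
have [_ _ -> -> _] := E _ f; have [_ _ -> -> _] := E _ h.
have [_ _ _ _ [-> ->]] := E _ g; have [_ _ _ _ [-> ->]] := E _ z.
ring.
Qed.

End Coordinates.

Section EnergySpace.
Context {R : realType}.
Variable p : params R.
Hypothesis l0 : 0 < len p.
Implicit Types (X Y Z W : state R) (a : R).

Local Notation l := (len p).
Local Notation rho := (rho p).
Local Notation Iw := (Iw p).
Local Notation cw := (cw p).
Local Notation cphi := (cphi p).
Local Notation eps1 := (eps1 p).
Local Notation eps2 := (eps2 p).
Local Notation xc := (xc p).
Local Notation Iws := (Iws p).
Local Notation D1 := (wderivn l 1).
Local Notation D2 := (wderivn l 2).
Local Notation tip f := (acrep l f l).

Lemma inHE X : inH p X <->
  [/\ H2L l (cf X), inL2 l (cg X), H1L l (ch X) & inL2 l (cz X)].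
Proof.
split => [[h1 h2 h3 h4]|[h1 h2 h3 h4]]; split.
- exact: (sobolevL2E _ l0).1 h1.
- exact: h2.
- exact: (sobolevL1E _ l0).1 h3.
- exact: h4.
- exact: (sobolevL2E _ l0).2 h1.
- exact: h2.
- exact: (sobolevL1E _ l0).2 h3.
- exact: h4.
Qed.

Lemma H2_L2 f : H2 l f -> inL2 l (D2 f).
Proof. by move=> [_ h]; have [] := H1_wderiv l0 h. Qed.

Lemma inH_L2 X : inH p X ->
  [/\ inL2 l (D2 (cf X)), inL2 l (cg X), inL2 l (D1 (ch X)), inL2 l (cz X)
    & inL2 l (cf X) /\ inL2 l (ch X)].
Proof.
move=> /inHE [[h1 _ _] h2 [h3 _] h4]; split.
- exact: H2_L2.
- exact: h2.
- by have [_ h _ _] := H1_wderiv l0 h3; exact: h.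
- exact: h4.
- by split; [exact: h1.1.1|exact: h3.1].
Qed.

Lemma inH_lin a X Y : inH p X -> inH p Y -> inH p (addS (scaleS a X) Y).
Proof.
move=> /inHE [h1 h2 h3 h4] /inHE [k1 k2 k3 k4]; apply/inHE; split.
- exact: H2L_lin.
- by apply: L2_add => //; exact: L2_scale.
- exact: H1L_lin.
- by apply: L2_add => //; exact: L2_scale.
Qed.

Definition crd X : coords R :=
  Coords (D2 (cf X)) (D1 (ch X)) (cg X) (cz X) (cf X) (ch X)
    (czw X) (czphi X) (tip (cf X)) (tip (ch X)).

Lemma crdL2 X : inH p X -> coordsL2 p (crd X).
Proof. by move=> /inH_L2 [f g h z [? ?]]; split => //; exact: h. Qed.

Lemma ip1E X Y : inH p X -> inH p Y -> ip1 p X Y = form1 p (crd X) (crd Y).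
Proof.
move=> /inH_L2[f1 g1 h1 z1 _] /inH_L2[f2 g2 h2 z2 _].
rewrite /ip1 (Rint_bilin _ _ _ _ g1 z1 g2 z2).2 bilin_mx2; congr (_ + _ + _).
rewrite -(@I2_comb _ l (rho * cw ^+ 2) (Iw * cphi ^+ 2) _ _ _ _ f1 f2 h1 h2).
by apply: Rint_eq => y _; rewrite !mulrA.
Qed.

Lemma PsiE X Y : inH p X -> inH p Y -> Psi p X Y = formPsi p (crd X) (crd Y).
Proof.
move=> /inH_L2[_ g1 _ z1 [f1 h1]] /inH_L2[_ g2 _ z2 [f2 h2]].
have ef1 := L2_scale eps1 f1; have eh1 := L2_scale eps2 h1.
have ef2 := L2_scale eps1 f2; have eh2 := L2_scale eps2 h2.
have [i1 E1] := Rint_bilin rho (rho * xc) (rho * xc) Iws g1 z1 ef2 eh2.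
have [i2 E2] := Rint_bilin rho (rho * xc) (rho * xc) Iws g2 z2 ef1 eh1.
rewrite /Psi !bilin_mx2 (RintD i1 i2) E1 E2 !I2Zr// /formPsi /=.
rewrite [I2 _ (cf X) (cg Y)]I2C [I2 _ (ch X) (cg Y)]I2C.
rewrite [I2 _ (cf X) (cz Y)]I2C [I2 _ (ch X) (cz Y)]I2C.
ring.
Qed.

Lemma ip1C X Y : inH p X -> inH p Y -> ip1 p X Y = ip1 p Y X.
Proof. by move=> hX hY; rewrite (ip1E hX hY) (ip1E hY hX) form1C. Qed.

Lemma ip2C X Y : inH p X -> inH p Y -> ip2 p X Y = ip2 p Y X.
Proof.
move=> hX hY; rewrite /ip2 (ip1C hX hY) (PsiE hX hY) (PsiE hY hX).
by rewrite formPsiC.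
Qed.

(** Equality almost everywhere determines the weak derivatives almost everywhere and the absolutely
    continuous representatives everywhere on the segment, so a linear relation modulo [eqH] reaches
    all coordinates, tip values included. *)
Lemma eqH_coords a X Y W : inH p X -> inH p Y -> inH p W ->
  eqH p W (addS (scaleS a X) Y) -> coords_lin p a (crd X) (crd Y) (crd W).
Proof.
move=> hX hY hW [ef eg eh ez [ew ep]].
have [f1 g1 h1 z1 [cf1 ch1]] := inH_L2 hX.
have [f2 g2 h2 z2 [cf2 ch2]] := inH_L2 hY.
have [f3 g3 h3 z3 [cf3 ch3]] := inH_L2 hW.
move: hX hY hW => /inHE [[X1 _ _] _ [X3 _] _] /inHE [[Y1 _ _] _ [Y3 _] _].
move=> /inHE [[W1 _ _] _ [W3 _] _].
have ll : 0 <= l <= l by rewrite lexx ltW.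
split; last first.
  split; [exact: ew|exact: ep| |].
  - transitivity (tip (fun y => a * cf X y + cf Y y)).
      exact: (acrep_ae l0 W1.1 (H1_lin a l0 X1.1 Y1.1).1 ef ll).
    exact: (acrep_lin a l0 X1.1 Y1.1 ll).
  - transitivity (tip (fun y => a * ch X y + ch Y y)).
      exact: (acrep_ae l0 W3 (H1_lin a l0 X3 Y3).1 eh ll).
    exact: (acrep_lin a l0 X3 Y3 ll).
move=> v hv; split.
- apply: (I2_relin f1 f2 f3 hv).
  exact: eq_ae_trans (wderiv2_ae l0 W1 (H2_lin a l0 X1 Y1) ef) (wderiv2_lin a l0 X1 Y1).
- apply: (I2_relin h1 h2 h3 hv).
  exact: eq_ae_trans (wderiv_ae l0 W3 (H1_lin a l0 X3 Y3).1 eh) (wderiv_lin a l0 X3 Y3).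
- exact: (I2_relin g1 g2 g3 hv eg).
- exact: (I2_relin z1 z2 z3 hv ez).
- by split; [exact: (I2_relin cf1 cf2 cf3 hv ef)|exact: (I2_relin ch1 ch2 ch3 hv eh)].
Qed.

Lemma ip1_lin a X Y W Z : inH p X -> inH p Y -> inH p W -> inH p Z ->
  eqH p W (addS (scaleS a X) Y) -> ip1 p W Z = a * ip1 p X Z + ip1 p Y Z.
Proof.
move=> hX hY hW hZ e; rewrite (ip1E hX hZ) (ip1E hY hZ) (ip1E hW hZ).
exact: form1_lin (crdL2 hZ) (eqH_coords hX hY hW e).
Qed.

Lemma Psi_lin a X Y W Z : inH p X -> inH p Y -> inH p W -> inH p Z ->
  eqH p W (addS (scaleS a X) Y) -> Psi p W Z = a * Psi p X Z + Psi p Y Z.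
Proof.
move=> hX hY hW hZ e; rewrite (PsiE hX hZ) (PsiE hY hZ) (PsiE hW hZ).
exact: formPsi_lin (crdL2 hZ) (eqH_coords hX hY hW e).
Qed.

Lemma ip2_lin a X Y W Z : inH p X -> inH p Y -> inH p W -> inH p Z ->
  eqH p W (addS (scaleS a X) Y) -> ip2 p W Z = a * ip2 p X Z + ip2 p Y Z.
Proof.
move=> hX hY hW hZ e.
by rewrite /ip2 (ip1_lin hX hY hW hZ e) (Psi_lin hX hY hW hZ e); ring.
Qed.

End EnergySpace.

(** * Coercivity *)

Section SmallestEigenvalue.
Context {R : realType}.
Implicit Types a b d x : R.

Lemma eigenvalue_mx2 a b d x :
  eigenvalue (mx2 a b b d) x = ((a - x) * (d - x) == b ^+ 2).
Proof.
rewrite /eigenvalue kermx_eq0 row_free_unit unitmxE (expand_det_row _ 0) !big_ord_recl big_ord0.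
rewrite /cofactor !det_mx11 !mxE /= unitfE negbK.
rewrite -[RHS]subr_eq0; congr (_ == _); rewrite /bump/= !mulr1n !mulr0n; ring.
Qed.

(** The conclusion says that the matrix minus [x] times the identity is positive semidefinite, in
    the form that [I2_young] and [young_norm] consume. It holds with equality in the determinant at
    the smaller characteristic root [m], hence for every [x <= m]. *)
Lemma lambda_minP a b d (x := lambda_min (mx2 a b b d)) :
  [/\ 0 <= a - x, 0 <= d - x & b ^+ 2 <= (a - x) * (d - x)].
Proof.
pose s := Num.sqrt ((a - d) ^+ 2 + 4 * b ^+ 2).
have D0 : 0 <= (a - d) ^+ 2 + 4 * b ^+ 2 by rewrite addr_ge0 ?sqr_ge0// mulr_ge0 ?sqr_ge0.
have s0 : 0 <= s by exact: sqrtr_ge0.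
have s2 : s ^+ 2 = (a - d) ^+ 2 + 4 * b ^+ 2 by rewrite sqr_sqrtr.
pose m := (a + d - s) / 2.
have ads : `|a - d| <= s.
  rewrite -(@ler_pXn2r _ 2)// ?nnegrE// s2 real_normK ?num_real// lerDl.
  by rewrite mulr_ge0 ?sqr_ge0.
have [am dm] : 0 <= a - m /\ 0 <= d - m.
  by move: ads; rewrite ler_norml /m => /andP[h1 h2]; split; lra.
have bm : (a - m) * (d - m) = b ^+ 2 by rewrite /m; nra.
have xm : x <= m.
  apply: ge_inf; last by rewrite /= eigenvalue_mx2 bm.
  exists m => e /=; rewrite eigenvalue_mx2 => /eqP E.
  rewrite leNgt; apply/negP => em.
  (* This is the excess of [(a - e) * (d - e)] over [(a - m) * (d - m)], so an [e] below [m] is not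
     an eigenvalue and the infimum is taken over a bounded set. *)
  have : 0 < (m - e) * ((a - m) + (d - m) + (m - e)).
    by rewrite mulr_gt0 ?subr_gt0//; lra.
  nra.
by split; [lra|lra|nra].
Qed.

End SmallestEigenvalue.

Section ExtendedMinimum.
Context {R : realType}.
Implicit Types (x a b : R).

Lemma lt_emin (x : \bar R) (s : seq (\bar R)) (i : nat) : (x < emin s)%E ->
  (i < size s)%N -> (x < nth +oo s i)%E.
Proof.
rewrite /emin; elim: s i => [//|h s IH] [|i]; rewrite big_cons lt_min => /andP[xh xs] //=.
exact: IH.
Qed.

(** For [b = 0] the quotient is read as [+oo] and the conclusion becomes [0 < a], which the second
    alternative supplies. *)
Lemma lt_equot x a b : 0 <= b -> (0 < b \/ 0 < a) -> (x%:E < equot a b)%E -> x * b < a.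
Proof.
rewrite /equot le_eqVlt => /predU1P[<-|b0] ab.
  by rewrite eqxx mulr0 => _; case: ab; rewrite ?ltxx.
by rewrite gt_eqF// lte_fin ltr_pdivlMr.
Qed.

End ExtendedMinimum.

Ltac nonneg := repeat match goal with
  | |- is_true (0 <= _ * _) => apply: mulr_ge0
  | |- is_true (0 <= _ + _) => apply: addr_ge0
  | |- is_true (0 <= `|_|) => exact: normr_ge0
  | |- is_true (0 <= pi) => exact: pi_ge0
  | |- is_true (0 <= Num.sqrt _) => exact: sqrtr_ge0
  | |- is_true (0 <= _ `^ _) => exact: powR_ge0
  | |- is_true (0 <= _ ^+ _) => apply: exprn_ge0
  | |- is_true (0 <= _%:R) => exact: ler0n
  | |- is_true (0 <= 1) => exact: ler01
  | |- _ => first [assumption | apply: ltW; assumption]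
  end.

Ltac positive := repeat match goal with
  | |- is_true (0 < _ * _) => apply: mulr_gt0
  | |- is_true (0 < pi) => exact: pi_gt0
  | |- is_true (0 < _ ^+ _) => apply: exprn_gt0
  | |- is_true (0 < _%:R) => exact: ltr0Sn
  | |- _ => assumption
  end.

Section Thresholds.
Context {R : realType}.
Variable p : params R.
Hypothesis hp : constants_ok p.
Hypothesis hS : structural_assumption p.

Local Notation l := (len p).
Local Notation rho := (rho p).
Local Notation Iw := (Iw p).
Local Notation ms := (ms p).
Local Notation cw := (cw p).
Local Notation cphi := (cphi p).
Local Notation eps1 := (eps1 p).
Local Notation eps2 := (eps2 p).
Local Notation xc := (xc p).
Local Notation Iws := (Iws p).
Local Notation Jss := (Jss p).
Local Notation lM := (lambda_min (M p)).
Local Notation lMs := (lambda_min (Ms p)).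

Lemma Iws_gt0 : 0 < Iws.
Proof.
case: hp => [[_ r0 i0 _ _] _ _ _ _].
by rewrite /Defs.Iws ltr_wpDr// mulr_ge0 ?sqr_ge0// ltW.
Qed.

Lemma Jss_gt0 : 0 < Jss.
Proof.
case: hp => [[_ _ _ m0 j0] _ _ _ _].
by rewrite /Defs.Jss ltr_wpDr// mulr_ge0 ?sqr_ge0// ltW.
Qed.

Lemma powR32 (x : R) : 0 < x -> x `^ (3 / 2) = x * Num.sqrt x.
Proof.
move=> x0; have -> : 3 / 2 = 1 + 2^-1 :> R by field.
by rewrite powRD ?gt_eqF ?implybT// powRr1 ?ltW// powR12_sqrt// ltW.
Qed.

(** The entries at positions 1 and 3 have positive denominators and force both smallest eigenvalues
    to be positive; this positivity then settles the entries whose denominator vanishes with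
    [xc]. *)
Lemma Km1_bounds : [/\ 0 < lM, 0 < lMs &
  [/\ eps1 * (4 * l ^+ 3 * (1 + `|xc|)
       * (4 * l * (rho * Num.sqrt rho) * cw + pi ^+ 2 * ms)) < pi ^+ 4 * rho * cw ^+ 2,
    eps1 * (2 * Num.sqrt rho) < cw * lM,
    eps1 * (2 * Num.sqrt rho * `|xc|) < cw * lM,
    eps1 * (2 * ms) < lMs & eps1 * (2 * ms * `|xc|) < lMs]].
Proof.
case: hp => [[L0 r0 i0 m0 j0] [c0 cp0 _ _] _ _ _].
case: hS => e0; rewrite lt_min => /andP[_ h] _ _ _.
have H i := @lt_emin _ _ _ i h; have s0 : 0 < Num.sqrt rho by rewrite sqrtr_gt0.
have h2 : eps1 * (2 * Num.sqrt rho) < cw * lM.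
  apply: lt_equot; [|left|exact: (H 1%N isT)].
    by rewrite mulr_ge0// ltW.
  by rewrite mulr_gt0.
have h4 : eps1 * (2 * ms) < lMs.
  apply: lt_equot; [|left|exact: (H 3%N isT)].
    by rewrite mulr_ge0// ltW.
  by rewrite mulr_gt0.
have clM : 0 < cw * lM by apply: lt_trans h2; rewrite !mulr_gt0.
have lM0 : 0 < lM by rewrite -(pmulr_rgt0 _ c0).
have lMs0 : 0 < lMs by apply: lt_trans h4; rewrite !mulr_gt0.
split; [exact: lM0|exact: lMs0|split; [|exact: h2| |exact: h4|]].
- rewrite -powR32//; apply: lt_equot; [|right|exact: (H 0%N isT)].
    by nonneg.
  by rewrite !mulr_gt0 ?exprn_gt0 ?pi_gt0.
- apply: lt_equot; [by nonneg|by right|exact: (H 2%N isT)].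
- apply: lt_equot; [by nonneg|by right|exact: (H 4%N isT)].
Qed.

Lemma Km2_bounds :
  [/\ eps2 * (4 * l ^+ 2 * (Iws + rho * `|xc|) * Num.sqrt Iw * cphi
      + pi ^+ 2 * l * (Jss + ms * `|xc|)) < pi ^+ 2 * Iw * cphi ^+ 2,
    eps2 * (2 * rho * `|xc|) < Num.sqrt Iw * cphi * lM,
    eps2 * (2 * Iws) < Num.sqrt Iw * cphi * lM,
    eps2 * (2 * ms * `|xc|) < lMs & eps2 * (2 * Jss) < lMs].
Proof.
have [lM0 lMs0 _] := Km1_bounds.
have i'0 := Iws_gt0; have j'0 := Jss_gt0.
case: hp => [[L0 r0 i0 m0 j0] [c0 cp0 _ _] _ _ _].
case: hS => _ _ e0; rewrite lt_min => /andP[_ h] _.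
have H i := @lt_emin _ _ _ i h; have s0 : 0 < Num.sqrt Iw by rewrite sqrtr_gt0.
have X0 : 0 <= `|xc| by [].
split.
- by apply: lt_equot (H 0%N isT); [nonneg|right; positive].
- by apply: lt_equot (H 1%N isT); [nonneg|right; exact: mulr_gt0 (mulr_gt0 s0 cp0) lM0].
- by apply: lt_equot (H 2%N isT); [nonneg|right; exact: mulr_gt0 (mulr_gt0 s0 cp0) lM0].
- by apply: lt_equot (H 3%N isT); [nonneg|right].
- by apply: lt_equot (H 4%N isT); [nonneg|right].
Qed.

End Thresholds.

Section Coercivity.
Context {R : realType}.
Variable p : params R.
Hypothesis hp : constants_ok p.
Hypothesis hS : structural_assumption p.
Implicit Types (K : coords R).

Local Notation l := (len p).
Local Notation rho := (rho p).
Local Notation Iw := (Iw p).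
Local Notation ms := (ms p).
Local Notation cw := (cw p).
Local Notation cphi := (cphi p).
Local Notation eps1 := (eps1 p).
Local Notation eps2 := (eps2 p).
Local Notation xc := (xc p).
Local Notation Iws := (Iws p).
Local Notation Jss := (Jss p).

(** All that coercivity uses of the boundary conditions at 0. *)
Definition coords_clamped K : Prop :=
  [/\ pi ^+ 4 * I2 l (kf K) (kf K) <= 16 * l ^+ 4 * I2 l (kf2 K) (kf2 K),
      pi ^+ 2 * kfl K ^+ 2 <= 4 * l ^+ 3 * I2 l (kf2 K) (kf2 K),
      pi ^+ 2 * I2 l (kh K) (kh K) <= 4 * l ^+ 2 * I2 l (kh1 K) (kh1 K)
    & khl K ^+ 2 <= l * I2 l (kh1 K) (kh1 K)].

Lemma crd_clamped X : inH p X -> coords_clamped (crd p X).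
Proof.
have l0 : 0 < l by case: hp => [[]].
have ll : 0 <= l <= l by rewrite lexx ltW.
move=> /(inHE l0) [hf _ hh _]; split.
- exact: H2L_poincare.
- exact: H2L_sup.
- exact: H1L_poincare.
- exact: H1L_sup.
Qed.

(** A squared norm without physical weights, the common yardstick for [ip1], [ip2] and the
    dissipation. *)
Definition nrm K : R :=
  I2 l (kf2 K) (kf2 K) + I2 l (kh1 K) (kh1 K) + I2 l (kg K) (kg K) + I2 l (kz K) (kz K)
  + kw K ^+ 2 + kp K ^+ 2.

Lemma nrm_ge0 K : 0 <= nrm K.
Proof. by rewrite !addr_ge0 ?I2_ge0 ?sqr_ge0. Qed.

Lemma young_norm (b c d s x y : R) : 0 <= b -> 0 <= d -> c ^+ 2 <= b * d -> s ^+ 2 = 1 ->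
  - (b * x ^+ 2 + d * y ^+ 2) <= s * (2 * c * (x * y)).
Proof.
move=> b0 d0 cbd s1; rewrite -subr_ge0 opprK.
have [b00|bn0] := eqVneq b 0.
  have c0 : c = 0 by apply/eqP; rewrite -sqrf_eq0 eq_le sqr_ge0 (le_trans cbd)// b00 mul0r.
  by rewrite b00 c0; rewrite mulr0 !mul0r mulr0 !add0r mulr_ge0// sqr_ge0.
have {bn0}b0' : 0 < b by rewrite lt_neqAle eq_sym bn0.
rewrite -(pmulr_rge0 _ b0').
have -> : b * (s * (2 * c * (x * y)) + (b * x ^+ 2 + d * y ^+ 2)) =
  (b * x + s * c * y) ^+ 2 + (b * d - s ^+ 2 * c ^+ 2) * y ^+ 2 by ring.
by rewrite s1 mul1r addr_ge0 ?sqr_ge0// mulr_ge0 ?sqr_ge0// subr_ge0.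
Qed.

Lemma ler_mul_divl (P Q A B : R) : 0 < P -> P * A <= Q * B -> A <= Q / P * B.
Proof. by move=> P0 h; rewrite mulrAC ler_pdivlMr// mulrC. Qed.

Local Notation q := (Num.sqrt rho).
Local Notation w := (Num.sqrt Iw * cphi).
Local Notation lM := (lambda_min (M p)).
Local Notation lMs := (lambda_min (Ms p)).

(** These are the coefficients left on the six squares of [nrm] once the cross terms of [Psi] are
    absorbed. The first two are the first entries of [Km1] and [Km2]; in the others, [eps1] and
    [eps2] each consume less than half of a smallest eigenvalue, whence the 2 in those
    thresholds. *)
Lemma coercive_coeffs :
  [/\ 0 < rho * cw ^+ 2 - eps1 * (1 + `|xc|) *
          (rho * q * cw * (16 * l ^+ 4 / pi ^+ 4) + ms * (4 * l ^+ 3 / pi ^+ 2)),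
      0 < Iw * cphi ^+ 2 - eps2 * ((Iws + rho * `|xc|) * w * (4 * l ^+ 2 / pi ^+ 2)
          + (Jss + ms * `|xc|) * l),
      0 < lM - eps1 * (q / cw) - eps2 * (rho * `|xc| / w),
      0 < lM - eps1 * (`|xc| * (q / cw)) - eps2 * (Iws / w)
    & 0 < lMs - eps1 * ms - eps2 * (ms * `|xc|) /\
      0 < lMs - eps1 * (ms * `|xc|) - eps2 * Jss].
Proof.
have [lM0 lMs0 [h1 h2 h3 h4 h5]] := Km1_bounds hp hS.
have [m1 m2 m3 m4 m5] := Km2_bounds hp hS.
rewrite -[_ * Num.sqrt Iw * cphi]mulrA in m1.
case: hp => [[L0 r0 i0 _ _] [c0 cp0 _ _] _ _ _].
have p0 := pi_gt0 R.
have q0 : 0 < q by rewrite sqrtr_gt0.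
have w0 : 0 < w by rewrite mulr_gt0// sqrtr_gt0.
move: (q) (w) (lM) (lMs) (Iws) (Jss) (`|xc|) (pi : R) q0 w0 lM0 lMs0 p0 h1 h2 h3 h4 h5 m1 m2 m3 m4 m5.
move=> q' w' lM' lMs' Iws' Jss' x P q0 w0 lM0 lMs0 P0 h1 h2 h3 h4 h5 m1 m2 m3 m4 m5.
have P4 : 0 < P ^+ 4 by rewrite exprn_gt0.
have P2 : 0 < P ^+ 2 by rewrite exprn_gt0.
have Pn : P != 0 by rewrite gt_eqF.
have wn : w' != 0 by rewrite gt_eqF.
have cn : cw != 0 by rewrite gt_eqF.
split.
- rewrite -(pmulr_rgt0 _ P4).
  have -> : P ^+ 4 * (rho * cw ^+ 2 - eps1 * (1 + x) *
     (rho * q' * cw * (16 * l ^+ 4 / P ^+ 4) + ms * (4 * l ^+ 3 / P ^+ 2))) =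
     P ^+ 4 * rho * cw ^+ 2 -
     eps1 * (4 * l ^+ 3 * (1 + x) * (4 * l * (rho * q') * cw + P ^+ 2 * ms)) by field.
  by rewrite subr_gt0.
- rewrite -(pmulr_rgt0 _ P2).
  have -> : P ^+ 2 * (Iw * cphi ^+ 2 -
     eps2 * ((Iws' + rho * x) * w' * (4 * l ^+ 2 / P ^+ 2) + (Jss' + ms * x) * l)) =
     P ^+ 2 * Iw * cphi ^+ 2 -
     eps2 * (4 * l ^+ 2 * (Iws' + rho * x) * w' + P ^+ 2 * l * (Jss' + ms * x)) by field.
  by rewrite subr_gt0.
- have e1 : eps1 * (q' / cw) < lM' / 2.
    by rewrite mulrA ltr_pdivrMr//; lra.
  have e2 : eps2 * (rho * x / w') < lM' / 2.
    by rewrite mulrA ltr_pdivrMr//; lra.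
  lra.
- have e1 : eps1 * (x * (q' / cw)) < lM' / 2.
    by rewrite !mulrA ltr_pdivrMr//; lra.
  have e2 : eps2 * (Iws' / w') < lM' / 2.
    by rewrite mulrA ltr_pdivrMr//; lra.
  lra.
- by split; lra.
Qed.

Lemma coercive : exists2 c, 0 < c & forall K s, coordsL2 p K -> coords_clamped K ->
  s ^+ 2 = 1 -> c * nrm K <= form1 p K K + s * formPsi p K K.
Proof.
have := coercive_coeffs.
set cA := (X in 0 < X); set cB := (X in [/\ _, 0 < X, _, _ & _]).
set cG := (X in [/\ _, _, 0 < X, _ & _]); set cZ := (X in [/\ _, _, _, 0 < X & _]).
set cW := (X in [/\ _, _, _, _ & 0 < X /\ _]); set cP := (X in [/\ _, _, _, _ & _ /\ 0 < X]).
move=> [cA0 cB0 cG0 cZ0 [cW0 cP0]].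
pose c := Num.min (Num.min cA cB) (Num.min (Num.min cG cZ) (Num.min cW cP)).
exists c; first by rewrite !lt_min cA0 cB0 cG0 cZ0 cW0 cP0.
move=> K s [hf2 hh1 hg hz [hf hh]] [P1 P2 P3 P4] s1.
have : c <= c by [].
rewrite {2}/c !le_min => /andP[/andP[leA leB] /andP[/andP[leG leZ] /andP[leW leP]]].
apply: (@le_trans _ _ (cA * I2 l (kf2 K) (kf2 K) + cB * I2 l (kh1 K) (kh1 K)
   + cG * I2 l (kg K) (kg K) + cZ * I2 l (kz K) (kz K) + cW * kw K ^+ 2 + cP * kp K ^+ 2)).
  rewrite /nrm !mulrDr.
  by rewrite !lerD// ler_wpM2r// ?I2_ge0 ?sqr_ge0.
case: (hp) => [[L0 r0 i0 m0 j0] [c0 cp0 _ _] [_ _ e10 e20] _ _].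
have i'0 := Iws_gt0 hp; have j'0 := Jss_gt0 hp.
have q0 : 0 < q by rewrite sqrtr_gt0.
have w0 : 0 < w by rewrite mulr_gt0// sqrtr_gt0.
have qq : q ^+ 2 = rho by rewrite sqr_sqrtr// ltW.
have x0 : 0 <= `|xc| by [].
have xx : `|xc| ^+ 2 = xc ^+ 2 by rewrite real_normK// num_real.
have P20 : 0 < (pi : R) ^+ 2 by rewrite exprn_gt0// pi_gt0.
have P40 : 0 < (pi : R) ^+ 4 by rewrite exprn_gt0// pi_gt0.
have {}P1 := ler_mul_divl P40 P1; have {}P2 := ler_mul_divl P20 P2; have {}P3 := ler_mul_divl P20 P3.
(* The mass matrix minus its smallest eigenvalue is positive semidefinite by [lambda_minP]; [Y0'] is
   the same at the tip. *)
have Y0 : lM * (I2 l (kg K) (kg K) + I2 l (kz K) (kz K)) <=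
    rho * I2 l (kg K) (kg K) + 2 * (rho * xc) * I2 l (kg K) (kz K) + Iws * I2 l (kz K) (kz K).
  have [a0 d0 bd] := @lambda_minP R rho (rho * xc) Iws.
  have := @I2_young R l (kg K) (kz K) _ (- (rho * xc)) _ hg hz a0 d0.
  rewrite sqrrN => /(_ bd); rewrite -/(M p); lra.
have Y0' : lMs * (kw K ^+ 2 + kp K ^+ 2) <=
    ms * kw K ^+ 2 + 2 * (ms * xc) * (kw K * kp K) + Jss * kp K ^+ 2.
  have [a0 d0 bd] := @lambda_minP R ms (ms * xc) Jss.
  have := @young_norm _ (ms * xc) _ 1 (kw K) (kp K) a0 d0 bd.
  by rewrite expr1n mul1r => /(_ erefl); rewrite -/(Ms p); lra.
have cwn : cw != 0 by rewrite gt_eqF.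
have wn : w != 0 by rewrite gt_eqF.
(* In [Y1] to [Y4] the velocity receives the weight prescribed by [coercive_coeffs], and the
   displacement the weight whose product with it is the square of the cross coefficient. *)
have Y1 : - (eps1 * (q / cw) * I2 l (kg K) (kg K) + eps1 * (rho * q * cw) * I2 l (kf K) (kf K))
    <= s * (2 * (eps1 * rho) * I2 l (kg K) (kf K)).
  apply: I2_young_norm => //.
  - by rewrite mulr_ge0 ?divr_ge0// ltW.
  - by rewrite !mulr_ge0// ltW.
  - rewrite (_ : eps1 * (q / cw) * (eps1 * (rho * q * cw)) =
      eps1 ^+ 2 * rho * q ^+ 2); last by field.
    by rewrite qq le_eqVlt; apply/orP; left; apply/eqP; ring.
have Y2 : - (eps2 * (rho * `|xc| / w) * I2 l (kg K) (kg K)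
     + eps2 * (rho * `|xc| * w) * I2 l (kh K) (kh K))
    <= s * (2 * (eps2 * (rho * xc)) * I2 l (kg K) (kh K)).
  apply: I2_young_norm => //.
  - by rewrite mulr_ge0 ?divr_ge0 ?mulr_ge0// ltW.
  - by rewrite !mulr_ge0// ltW.
  - rewrite (_ : eps2 * (rho * `|xc| / w) * (eps2 * (rho * `|xc| * w)) =
      eps2 ^+ 2 * rho ^+ 2 * `|xc| ^+ 2); last by move: (w) wn => W wn; field.
    by rewrite xx le_eqVlt; apply/orP; left; apply/eqP; ring.
have Y3 : - (eps1 * (`|xc| * (q / cw)) * I2 l (kz K) (kz K)
     + eps1 * (`|xc| * (rho * q * cw)) * I2 l (kf K) (kf K))
    <= s * (2 * (eps1 * (rho * xc)) * I2 l (kz K) (kf K)).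
  apply: I2_young_norm => //.
  - by rewrite !mulr_ge0 ?invr_ge0// ltW.
  - by rewrite !mulr_ge0// ltW.
  - rewrite (_ : eps1 * (`|xc| * (q / cw)) * (eps1 * (`|xc| * (rho * q * cw))) =
      eps1 ^+ 2 * rho * q ^+ 2 * `|xc| ^+ 2); last by field.
    by rewrite qq xx le_eqVlt; apply/orP; left; apply/eqP; ring.
have Y4 : - (eps2 * (Iws / w) * I2 l (kz K) (kz K) + eps2 * (Iws * w) * I2 l (kh K) (kh K))
    <= s * (2 * (eps2 * Iws) * I2 l (kz K) (kh K)).
  apply: I2_young_norm => //.
  - by rewrite !mulr_ge0 ?invr_ge0// ltW.
  - by rewrite !mulr_ge0// ltW.
  - rewrite (_ : eps2 * (Iws / w) * (eps2 * (Iws * w)) = (eps2 * Iws) ^+ 2)//.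
    by move: (w) wn => W wn; field.
have T1 : - (eps1 * ms * kw K ^+ 2 + eps1 * ms * kfl K ^+ 2)
    <= s * (2 * (eps1 * ms) * (kw K * kfl K)).
  by apply: young_norm; [nonneg|nonneg|rewrite expr2|exact: s1].
have T2 : - (eps2 * (ms * `|xc|) * kw K ^+ 2 + eps2 * (ms * `|xc|) * khl K ^+ 2)
    <= s * (2 * (eps2 * (ms * xc)) * (kw K * khl K)).
  apply: young_norm => //; [by rewrite !mulr_ge0// ltW|by rewrite !mulr_ge0// ltW|].
  by rewrite -expr2 !exprMn xx.
have T3 : - (eps1 * (ms * `|xc|) * kp K ^+ 2 + eps1 * (ms * `|xc|) * kfl K ^+ 2)
    <= s * (2 * (eps1 * (ms * xc)) * (kp K * kfl K)).
  apply: young_norm => //; [by rewrite !mulr_ge0// ltW|by rewrite !mulr_ge0// ltW|].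
  by rewrite -expr2 !exprMn xx.
have T4 : - (eps2 * Jss * kp K ^+ 2 + eps2 * Jss * khl K ^+ 2)
    <= s * (2 * (eps2 * Jss) * (kp K * khl K)).
  by apply: young_norm; [nonneg|nonneg|rewrite expr2|exact: s1].
(* The total weights that the cross terms have put on [kf], [kfl], [kh] and [khl]; the Poincare
   inequalities are scaled by them so that only linear arithmetic remains. *)
have a1 : 0 <= eps1 * (1 + `|xc|) * (rho * q * cw) by nonneg.
have a2 : 0 <= eps1 * (1 + `|xc|) * ms by nonneg.
have a3 : 0 <= eps2 * ((Iws + rho * `|xc|) * w) by nonneg.
have a4 : 0 <= eps2 * (Jss + ms * `|xc|) by nonneg.
have {}P1 := ler_wpM2l a1 P1; have {}P2 := ler_wpM2l a2 P2.
have {}P3 := ler_wpM2l a3 P3; have {}P4 := ler_wpM2l a4 P4.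
rewrite /form1 /formPsi [I2 _ (kf K) (kg K)]I2C [I2 _ (kh K) (kg K)]I2C.
rewrite [I2 _ (kf K) (kz K)]I2C [I2 _ (kh K) (kz K)]I2C [I2 _ (kz K) (kg K)]I2C.
rewrite /cA /cB /cG /cZ /cW /cP.
clear leA leB leG leZ leW leP cA0 cB0 cG0 cZ0 cW0 cP0 c cA cB cG cZ cW cP.
move: (16 * l ^+ 4 / pi ^+ 4) (4 * l ^+ 3 / pi ^+ 2) (4 * l ^+ 2 / pi ^+ 2)
  P1 P2 P3 P4 => n1 n2 n3 P1 P2 P3 P4.
move: (q / cw) Y1 Y3 => qc Y1 Y3.
move: (lM) (lMs) Y0 Y0' => LM LMs Y0 Y0'.
move: (w^-1) (w) Y2 Y4 P3 {w0 wn a3} => iw W Y2 Y4 P3.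
lra.
Qed.

End Coercivity.

(** * Dissipation *)

Section IntegrationByParts.
Context {R : realType}.
Implicit Types (l : R) (f u m t : R -> R).

Lemma I2_by_parts l t u : 0 < l -> H1 l t -> H1L l u ->
  I2 l (wderiv l t) u = acrep l t l * acrep l u l - I2 l t (wderiv l u).
Proof.
move=> l0 ht [hu u0]; have l0' := ltW l0.
have [_ lt pt et] := H1_wderiv l0 ht; have [_ lu pu eu] := H1_wderiv l0 hu.
have lat := prim_L2 l0' pt; have lau := prim_L2 l0' pu.
rewrite [LHS]I2C (I2_ae hu.1 lau lt eu) (I2_ae ht.1 lat lu et).
have := Rint_by_parts l0' pt pu.
rewrite (RintD (L2_intgM lt lau) (L2_intgM lat lu)) u0 mulr0 subr0 => <-.
by rewrite [I2 l _ (wderiv l t)]I2C addrK.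
Qed.

(** The clamping of [u] removes the boundary terms at 0 and the free end removes the product of [m]
    and [u'] at [l]; only the shear term at the tip survives. *)
Lemma I2_by_parts2 l m u : 0 < l -> H2 l m -> H2L l u -> acrep l m l = 0 ->
  I2 l (wderivn l 2 m) u =
  acrep l (wderivn l 1 m) l * acrep l u l + I2 l m (wderivn l 2 u).
Proof.
move=> l0 [h1 h2] hu m0.
have := I2_by_parts l0 h1 (H2L_wderiv hu); rewrite m0 mul0r sub0r.
have := I2_by_parts l0 h2 (H2L_H1L hu) => -> E.
by rewrite E opprK.
Qed.

Lemma I2_comb3 l (a b c : R) f g h v : inL2 l f -> inL2 l g -> inL2 l h -> inL2 l v ->
  I2 l (fun y => a * f y + b * g y + c * h y) v
  = a * I2 l f v + b * I2 l g v + c * I2 l h v.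
Proof.
move=> hf hg hh hv; have hbg := L2_scale b hg; have hch := L2_scale c hh.
have E : forall y, 0 <= y <= l ->
    a * f y + b * g y + c * h y = a * f y + (b * g y + c * h y).
  by move=> y _; rewrite addrA.
have L := L2_add hbg hch.
have L' : inL2 l (fun y => a * f y + b * g y + c * h y).
  by apply: L2_eq (L2_add (L2_scale a hf) L) => y /E ->.
rewrite (I2_relin hf L L' hv (eq_ae_on E)) (I2_linl b hg hch hv) addrA; congr (_ + _).
by rewrite [LHS]I2C I2Zr// I2C.
Qed.

End IntegrationByParts.

Section Solve2.
Context {R : realType}.
Implicit Types a b d u v : R.

Lemma solve_mx2 a b d u v : a * d - b ^+ 2 != 0 ->
  (invmx (mx2 a b b d) *m cv2 u v) 0 0 = (d * u - b * v) / (a * d - b ^+ 2) /\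
  (invmx (mx2 a b b d) *m cv2 u v) 1 0 = (a * v - b * u) / (a * d - b ^+ 2).
Proof.
move=> D0; set A := mx2 a b b d; set D := a * d - b ^+ 2 in D0 *.
have detA : \det A = D.
  rewrite (expand_det_row _ 0) !big_ord_recl big_ord0 /cofactor !det_mx11 !mxE /= /bump/= /D.
  ring.
have uA : A \in unitmx by rewrite unitmxE unitfE detA.
have -> : cv2 u v = A *m cv2 ((d * u - b * v) / D) ((a * v - b * u) / D).
  apply/colP => i; rewrite !mxE !big_ord_recl big_ord0 !mxE /=.
  case: i => [[|[|//]] ?] /=; rewrite /D; field; exact: D0.
by rewrite mulKmx// !mxE.
Qed.

End Solve2.

Section Dissipation.
Context {R : realType}.
Variable p : params R.
Hypothesis hp : constants_ok p.
Implicit Types (X : state R).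

Local Notation l := (len p).
Local Notation rho := (rho p).
Local Notation Iw := (Iw p).
Local Notation ms := (ms p).
Local Notation Js := (Js p).
Local Notation cw := (cw p).
Local Notation cphi := (cphi p).
Local Notation etaw := (etaw p).
Local Notation etaphi := (etaphi p).
Local Notation k1 := (k1 p).
Local Notation k2 := (k2 p).
Local Notation eps1 := (eps1 p).
Local Notation eps2 := (eps2 p).
Local Notation xc := (xc p).
Local Notation alw := (alw p).
Local Notation bew := (bew p).
Local Notation gaw := (gaw p).
Local Notation alphi := (alphi p).
Local Notation bephi := (bephi p).
Local Notation gaphi := (gaphi p).
Local Notation Iws := (Iws p).
Local Notation Jss := (Jss p).
Local Notation D1 := (wderivn l 1).
Local Notation D2 := (wderivn l 2).
Local Notation tip f := (acrep l f l).

Let l0 : 0 < l. Proof. by case: hp => [[]]. Qed.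

Lemma detM_gt0 : 0 < rho * Iws - (rho * xc) ^+ 2.
Proof.
case: hp => [[_ r0 i0 _ _] _ _ _ _].
by rewrite /Defs.Iws (_ : _ - _ = rho * Iw); [rewrite mulr_gt0|ring].
Qed.

Lemma detMs_gt0 : 0 < ms * Jss - (ms * xc) ^+ 2.
Proof.
case: hp => [[_ _ _ m0 j0] _ _ _ _].
by rewrite /Defs.Jss (_ : _ - _ = ms * Js); [rewrite mulr_gt0|ring].
Qed.

Lemma inDE X : inD p X ->
  [/\ inH p X, H2L l (cg X), H1L l (cz X), H2 l (moment p X) & H1 l (torsion p X)] /\
  [/\ tip (moment p X) = 0, czw X = tip (cg X) & czphi X = tip (cz X)].
Proof.
move=> [hX [h1 h2 h3 h4] tips _ _]; split => //; split.
- exact: hX.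
- exact: (sobolevL2E _ l0).1 h1.
- exact: (sobolevL1E _ l0).1 h2.
- exact: (sobolev2E _ l0).1 h3.
- exact: (sobolev1E _ _).1 h4.
Qed.

(** With [forceQ], the right-hand sides of the equations of motion before they are multiplied by the
    inverse of [M]. *)
Definition forceP X y := - (rho * cw ^+ 2) * D2 (moment p X) y
  + (alw * ch X y + bew * cz X y + gaw * cg X y).
Definition forceQ X y := Iw * cphi ^+ 2 * D1 (torsion p X) y
  + (alphi * ch X y + bephi * cz X y + gaphi * cg X y).

Lemma force_L2 X : inD p X -> inL2 l (forceP X) /\ inL2 l (forceQ X).
Proof.
move=> /inDE [[hX g2 z1 m2 t1] _].
have [_ hg _ hz [_ hh]] := inH_L2 l0 hX.
have lm := H2_L2 l0 m2; have [_ lt _ _] := H1_wderiv l0 t1.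
split; apply: L2_add; try exact: L2_scale;
  by apply: L2_add; [apply: L2_add|]; exact: L2_scale.
Qed.

Lemma AopE X y : let D := rho * Iws - (rho * xc) ^+ 2 in
  cg (Aop p X) y = Iws / D * forceP X y + - (rho * xc / D) * forceQ X y /\
  cz (Aop p X) y = rho / D * forceQ X y + - (rho * xc / D) * forceP X y.
Proof.
move=> D; have D0 : D != 0 by rewrite gt_eqF// detM_gt0.
have oppE (B : 'cV[R]_2) i : (- B) i 0 = - B i 0 by rewrite mxE.
rewrite /Aop /A1 /A2 /addS /= /M !oppE.
have S u v := solve_mx2 u v D0.
rewrite -/D in S; rewrite !(S _ _).1 !(S _ _).2 /forceP /forceQ /wderivn /=.
by split; field.
Qed.

Lemma cf_Aop X : cf (Aop p X) = cg X.
Proof. by apply/funext => y /=; rewrite addr0. Qed.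

Lemma ch_Aop X : ch (Aop p X) = cz X.
Proof. by apply/funext => y /=; rewrite addr0. Qed.

Lemma zeta_Aop X (U := rho * cw ^+ 2 * tip (D1 (moment p X)) - k1 * (tip (cg X) + eps1 * tip (cf X)))
    (V := - (Iw * cphi ^+ 2 * tip (torsion p X)) - k2 * (tip (cz X) + eps2 * tip (ch X))) :
  ms * czw (Aop p X) + ms * xc * czphi (Aop p X) = U /\
  ms * xc * czw (Aop p X) + Jss * czphi (Aop p X) = V.
Proof.
have D0 : ms * Jss - (ms * xc) ^+ 2 != 0 by rewrite gt_eqF// detMs_gt0.
rewrite /Aop /A1 /A2 /addS /= /Ms !addr0 -/U -/V.
have S u v := solve_mx2 u v D0.
rewrite !(S _ _).1 !(S _ _).2.
by split; field.
Qed.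

Lemma Aop_L2 X : inD p X -> inL2 l (cg (Aop p X)) /\ inL2 l (cz (Aop p X)).
Proof.
move=> hX; have [hP hQ] := force_L2 hX; split.
- apply: L2_eq (L2_add (L2_scale _ hP) (L2_scale _ hQ)) => y _.
  by rewrite (AopE X y).1.
- apply: L2_eq (L2_add (L2_scale _ hQ) (L2_scale _ hP)) => y _.
  by rewrite (AopE X y).2.
Qed.

Lemma inH_Aop X : inD p X -> inH p (Aop p X).
Proof.
move=> hX; have [lg lz] := Aop_L2 hX; have [[_ hg hz _ _] _] := inDE hX.
by apply/(inHE l0); split; [rewrite cf_Aop|exact: lg|rewrite ch_Aop|exact: lz].
Qed.

(** The forms pair accelerations through [M], which cancels the inverse in [Aop]: the energy
    computation sees the forces only. *)
Lemma I2_Aop X v : inD p X -> inL2 l v ->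
  rho * I2 l (cg (Aop p X)) v + rho * xc * I2 l (cz (Aop p X)) v = I2 l (forceP X) v /\
  rho * xc * I2 l (cg (Aop p X)) v + Iws * I2 l (cz (Aop p X)) v = I2 l (forceQ X) v.
Proof.
move=> hX hv; have [lg lz] := Aop_L2 hX; have [hP hQ] := force_L2 hX.
have D0 : rho * Iws - (rho * xc) ^+ 2 != 0 by rewrite gt_eqF// detM_gt0.
set D := rho * Iws - (rho * xc) ^+ 2 in D0 *.
have E (a b : R) (f g u : R -> R) : inL2 l f -> inL2 l g -> inL2 l u ->
    (forall y, u y = a * f y + b * g y) -> I2 l u v = a * I2 l f v + b * I2 l g v.
  move=> hf hg hu uE.
  rewrite (I2_relin hf (L2_scale b hg) hu hv (eq_ae_on (fun y _ => uE y))); congr (_ + _).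
  by rewrite [LHS]I2C I2Zr// I2C.
rewrite (E _ _ _ _ _ hP hQ lg (fun y => (AopE X y).1)).
rewrite (E _ _ _ _ _ hQ hP lz (fun y => (AopE X y).2)) -/D.
by split; rewrite /D; field.
Qed.

Lemma I2_forceP X u : inD p X -> H2L l u ->
  I2 l (forceP X) u = - (rho * cw ^+ 2) * (tip (D1 (moment p X)) * tip u
      + I2 l (D2 (cf X)) (D2 u) + etaw * I2 l (D2 (cg X)) (D2 u))
    + (alw * I2 l (ch X) u + bew * I2 l (cz X) u + gaw * I2 l (cg X) u).
Proof.
move=> hX hu; have [[hX1 g2 z1 m2 t1] [m0 _ _]] := inDE hX.
have [lf2 hg _ hz [_ hh]] := inH_L2 l0 hX1.
have lm := H2_L2 l0 m2; have [[[lu _] hu2] _ _] := hu.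
have lu2 := H2_L2 l0 (conj (H2L_H1L hu).1 hu2); have [g2' _ _] := g2; have lg2 := H2_L2 l0 g2'.
have L3 : inL2 l (fun y => alw * ch X y + bew * cz X y + gaw * cg X y).
  by apply: L2_add; [apply: L2_add|]; exact: L2_scale.
rewrite /forceP (I2_linl _ lm L3 lu) (I2_comb3 _ _ _ hh hz hg lu); congr (_ * _ + _).
have E : I2 l (moment p X) (D2 u) =
    etaw * I2 l (D2 (cg X)) (D2 u) + I2 l (D2 (cf X)) (D2 u).
  apply: (I2_relin lg2 lf2 m2.1.1 lu2).
  by apply: eq_ae_on => y _; rewrite /moment addrC.
apply: etrans (I2_by_parts2 l0 m2 hu m0) _; apply: etrans (congr1 (+%R _) E) _.
exact: etrans (addrA _ _ _) (addrAC _ _ _).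
Qed.

Lemma I2_forceQ X u : inD p X -> H1L l u ->
  I2 l (forceQ X) u = Iw * cphi ^+ 2 * (tip (torsion p X) * tip u
      - I2 l (D1 (ch X)) (D1 u) - etaphi * I2 l (D1 (cz X)) (D1 u))
    + (alphi * I2 l (ch X) u + bephi * I2 l (cz X) u + gaphi * I2 l (cg X) u).
Proof.
move=> hX hu; have [[hX1 g2 z1 m2 t1] _] := inDE hX.
have [_ hg lh1 hz [_ hh]] := inH_L2 l0 hX1.
have [_ lt _ _] := H1_wderiv l0 t1; have lu := hu.1.1.
have [_ lu1 _ _] := H1_wderiv l0 hu.1; have [_ lz1 _ _] := H1_wderiv l0 z1.1.
have L3 : inL2 l (fun y => alphi * ch X y + bephi * cz X y + gaphi * cg X y).
  by apply: L2_add; [apply: L2_add|]; exact: L2_scale.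
rewrite /forceQ (I2_linl _ lt L3 lu) (I2_comb3 _ _ _ hh hz hg lu); congr (_ * _ + _).
rewrite (I2_by_parts l0 t1 hu) -addrA -opprD; congr (_ - _).
rewrite addrC; apply: (I2_relin lz1 lh1 t1.1 lu1).
by apply: eq_ae_on => y _; rewrite /torsion addrC.
Qed.

(* The energy balance: the boundary feedback cancels the boundary terms of the
   two integrations by parts. *)
Lemma ip2_Aop X : inD p X -> ip2 p (Aop p X) X =
  - (rho * cw ^+ 2) * (etaw * I2 l (D2 (cg X)) (D2 (cg X))
       + eps1 * I2 l (D2 (cf X)) (D2 (cf X))
       + eps1 * etaw * I2 l (D2 (cg X)) (D2 (cf X)))
  - Iw * cphi ^+ 2 * (etaphi * I2 l (D1 (cz X)) (D1 (cz X))
       + eps2 * I2 l (D1 (ch X)) (D1 (ch X))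
       + eps2 * etaphi * I2 l (D1 (cz X)) (D1 (ch X)))
  - k1 * (czw X + eps1 * tip (cf X)) ^+ 2 - k2 * (czphi X + eps2 * tip (ch X)) ^+ 2
  + (alw * I2 l (ch X) (cg X) + bew * I2 l (cz X) (cg X) + gaw * I2 l (cg X) (cg X))
  + eps1 * (alw * I2 l (ch X) (cf X) + bew * I2 l (cz X) (cf X) + gaw * I2 l (cg X) (cf X))
  + (alphi * I2 l (ch X) (cz X) + bephi * I2 l (cz X) (cz X) + gaphi * I2 l (cg X) (cz X))
  + eps2 * (alphi * I2 l (ch X) (ch X) + bephi * I2 l (cz X) (ch X)
            + gaphi * I2 l (cg X) (ch X))
  + eps1 * rho * I2 l (cg X) (cg X) + (eps1 + eps2) * (rho * xc) * I2 l (cg X) (cz X)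
  + eps2 * Iws * I2 l (cz X) (cz X)
  + eps1 * ms * czw X ^+ 2 + (eps1 + eps2) * (ms * xc) * (czw X * czphi X)
  + eps2 * Jss * czphi X ^+ 2.
Proof.
move=> hX; have hA := inH_Aop hX; have [[hX1 g2 z1 m2 t1] [_ ew ep]] := inDE hX.
have [_ hg _ hz [hf hh]] := inH_L2 l0 hX1.
have [f2 _ h1 _] := (inHE l0 X).1 hX1.
have [Z1 Z2] := zeta_Aop X; rewrite -ew -ep in Z1 Z2.
have [Eg _] := I2_Aop hX hg; have [_ Ez] := I2_Aop hX hz.
have [Ef _] := I2_Aop hX hf; have [_ Eh] := I2_Aop hX hh.
rewrite (I2_forceP hX g2) in Eg; rewrite (I2_forceQ hX z1) in Ez.
rewrite (I2_forceP hX f2) in Ef; rewrite (I2_forceQ hX h1) in Eh.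
rewrite -ew in Eg; rewrite -ep in Ez.
have {}Ef := congr1 ( *%R eps1) Ef; have {}Eh := congr1 ( *%R eps2) Eh.
(* The tip equations are multiplied by the argument of the feedback, which turns the [k1] and [k2]
   terms into squares. *)
have {}Z1 := congr1 ( *%R (czw X + eps1 * tip (cf X))) Z1.
have {}Z2 := congr1 ( *%R (czphi X + eps2 * tip (ch X))) Z2.
have := ip1E l0 hA hX1; have := PsiE l0 hA hX1.
(* The domain conditions identify the tip values of the velocities with the last two components of
   [X]. *)
have -> : crd p (Aop p X) = Coords (D2 (cg X)) (D1 (cz X)) (cg (Aop p X))
    (cz (Aop p X)) (cg X) (cz X) (czw (Aop p X)) (czphi (Aop p X)) (czw X) (czphi X).
  by rewrite /crd cf_Aop ch_Aop ew ep.
have -> : crd p X = Coords (D2 (cf X)) (D1 (ch X)) (cg X) (cz X) (cf X) (ch X)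
    (czw X) (czphi X) (tip (cf X)) (tip (ch X)) by [].
rewrite /ip2 => -> ->.
move: (cg (Aop p X)) (cz (Aop p X)) (czw (Aop p X)) (czphi (Aop p X))
  Eg Ez Ef Eh Z1 Z2 => gA zA wA pA Eg Ez Ef Eh Z1 Z2.
move: Eg Ez Ef Eh Z1 Z2; move: (D2 (cf X)) (D2 (cg X)) (D1 (ch X)) (D1 (cz X)) => f'' g'' h' z'.
move: (tip (cf X)) (tip (ch X)) (tip (D1 (moment p X))) (tip (torsion p X)).
move: (cf X) (cg X) (ch X) (cz X) (czw X) (czphi X) => f g h z zw zp fl hl ml tl.
rewrite /form1 /formPsi /=.
rewrite [I2 _ z g]I2C.
rewrite [I2 _ f'' g'']I2C [I2 _ h' z']I2C.
move=> Eg Ez Ef Eh Z1 Z2.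
lra.
Qed.

End Dissipation.

Section RealInequality.
Context {R : realType}.

(* The scalar content of the dissipation estimate: [a], [b] stand for
   [rho cw^2], [Iw cphi^2], [i_j] for [r_j^-1], and the remaining letters for
   integrals of products of components of a state. *)
Lemma dissipation_scalar
  (a b rho ms Iws Jss l n1 n2 n3 k1 k2 e1 e2 ew ep x xc : R)
  (aw bw gw ap bp gp r1 r2 r3 r4 r5 r6 r7 r8 i1 i2 i3 i4 i5 i6 i7 i8 : R)
  (A Ag B Bz F G H Z gf2 zh1 gf hf zf hg zg zh w p sw sp : R) :
  [/\ 0 <= a, 0 <= b, 0 <= rho, 0 <= ms & 0 <= Iws] ->
  [/\ 0 <= Jss, 0 <= e1, 0 <= e2, 0 <= ew & 0 <= ep] ->
  [/\ 0 <= aw, 0 <= bw & 0 <= gw] -> [/\ 0 <= ap, 0 <= bp & 0 <= gp] ->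
  [/\ 0 <= r3, 0 <= r5, 0 <= r7 & 0 <= r8] -> [/\ 0 <= r4, 0 <= r6, 0 <= x & True] ->
  [/\ 0 <= i3, 0 <= i4, 0 <= i5 & 0 <= i6] -> [/\ 0 <= i7, 0 <= i8, 0 <= k1 & 0 <= k2] ->
  [/\ F <= n1 * A, H <= n3 * B, G <= n1 * Ag & Z <= n3 * Bz] ->
  [/\ w ^+ 2 <= n2 * Ag, p ^+ 2 <= l * Bz, 0 <= sw & 0 <= sp] ->
  [/\ - (2 * gf2) <= r1 * Ag + i1 * A, - (2 * zh1) <= r2 * Bz + i2 * B,
      2 * gf <= r3 * G + i3 * F, 2 * hf <= r4 * H + i4 * F & 2 * zf <= r5 * Z + i5 * F] ->
  [/\ 2 * hg <= r6 * H + i6 * G, 2 * zg <= r7 * Z + i7 * G, 2 * zh <= r8 * Z + i8 * H,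
      2 * xc * zg <= x * G + x * Z & 2 * xc * (w * p) <= x * w ^+ 2 + x * p ^+ 2] ->
  - a * (ew * Ag + e1 * A + e1 * ew * gf2) - b * (ep * Bz + e2 * B + e2 * ep * zh1)
  - k1 * sw - k2 * sp
  + (aw * hg + bw * zg + gw * G) + e1 * (aw * hf + bw * zf + gw * gf)
  + (ap * zh + bp * Z + gp * zg) + e2 * (ap * H + bp * zh + gp * hg)
  + e1 * rho * G + (e1 + e2) * (rho * xc) * zg + e2 * Iws * Z
  + e1 * ms * w ^+ 2 + (e1 + e2) * (ms * xc) * (w * p) + e2 * Jss * p ^+ 2 <=
  - (a * (e1 - e1 * ew / 2 * i1) - e1 * n1 / 2 * (aw * i4 + bw * i5 + gw * i3)) * A
  - (a * ew - e2 * x * (rho * n1 + ms * n2) / 2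
     - e1 * (rho * (2 + x) * n1 / 2 + a * ew * r1 / 2 + (2 + x) * ms * n2 / 2)
     - n1 * (gw + (aw + e2 * gp) / 2 * i6 + e1 * gw * r3 / 2 + (bw + gp) / 2 * i7)) * Ag
  - (b * (e2 - e2 * ep / 2 * i2)
     - n3 * ((aw + e2 * gp) * r6 / 2 + (ap + e2 * bp) / 2 * i8 + e1 * aw * r4 / 2
             + e2 * ap)) * B
  - (b * ep - e1 * x * (rho * n3 + ms * l) / 2
     - e2 * ((2 * Iws + x * rho) * n3 / 2 + b * ep * r2 / 2 + l * (2 * Jss + x * ms) / 2)
     - n3 * (bp + (bw + gp) * r7 / 2 + (ap + e2 * bp) * r8 / 2 + e1 * bw * r5 / 2)) * Bz.
Proof.
move=> [a0 b0 rho0 ms0 Iws0] [Jss0 e10 e20 ew0 ep0] [aw0 bw0 gw0] [ap0 bp0 gp0].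
move=> [r30 r50 r70 r80] [r40 r60 x0 _] [i30 i40 i50 i60] [i70 i80 k10 k20].
move=> [PF PH PG PZ] [Pw Pp sw0 sp0] [y1 y2 y3 y4 y5] [y6 y7 y8 y9 y10].
(* Each Young inequality is scaled by the coefficient of its cross term, and each Poincare
   inequality by the total weight then resting on its square; what remains is linear in the
   products. *)
have Y1 := ler_wpM2l (_ : 0 <= a * e1 * ew) y1.
have {Y1 y1}Y1 := Y1 ltac:(nonneg).
have {y2}Y2 := ler_wpM2l (_ : 0 <= b * e2 * ep) y2.
have {}Y2 := Y2 ltac:(nonneg).
have {y3}Y3 := ler_wpM2l (_ : 0 <= e1 * gw) y3.
have {}Y3 := Y3 ltac:(nonneg).
have {y4}Y4 := ler_wpM2l (_ : 0 <= e1 * aw) y4.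
have {}Y4 := Y4 ltac:(nonneg).
have {y5}Y5 := ler_wpM2l (_ : 0 <= e1 * bw) y5.
have {}Y5 := Y5 ltac:(nonneg).
have {y6}Y6 := ler_wpM2l (_ : 0 <= aw + e2 * gp) y6.
have {}Y6 := Y6 ltac:(nonneg).
have {y7}Y7 := ler_wpM2l (_ : 0 <= bw + gp) y7.
have {}Y7 := Y7 ltac:(nonneg).
have {y8}Y8 := ler_wpM2l (_ : 0 <= ap + e2 * bp) y8.
have {}Y8 := Y8 ltac:(nonneg).
have {y9}Y9 := ler_wpM2l (_ : 0 <= (e1 + e2) * rho) y9.
have {}Y9 := Y9 ltac:(nonneg).
have {y10}Y10 := ler_wpM2l (_ : 0 <= (e1 + e2) * ms) y10.
have {}Y10 := Y10 ltac:(nonneg).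
have QF := ler_wpM2l (_ : 0 <= e1 * (aw * i4 + bw * i5 + gw * i3)) PF.
have {PF}QF := QF ltac:(nonneg).
have QH := ler_wpM2l (_ : 0 <= (aw + e2 * gp) * r6 + (ap + e2 * bp) * i8 + e1 * aw * r4
   + 2 * e2 * ap) PH.
have {PH}QH := QH ltac:(nonneg).
have QG := ler_wpM2l (_ : 0 <= 2 * e1 * rho + (e1 + e2) * rho * x + 2 * gw
   + (aw + e2 * gp) * i6 + e1 * gw * r3 + (bw + gp) * i7) PG.
have {PG}QG := QG ltac:(nonneg).
have QZ := ler_wpM2l (_ : 0 <= 2 * e2 * Iws + (e1 + e2) * rho * x + 2 * bp
   + (bw + gp) * r7 + (ap + e2 * bp) * r8 + e1 * bw * r5) PZ.
have {PZ}QZ := QZ ltac:(nonneg).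
have Qw := ler_wpM2l (_ : 0 <= 2 * e1 * ms + (e1 + e2) * ms * x) Pw.
have {Pw}Qw := Qw ltac:(nonneg).
have Qp := ler_wpM2l (_ : 0 <= 2 * e2 * Jss + (e1 + e2) * ms * x) Pp.
have {Pp}Qp := Qp ltac:(nonneg).
have Ssw := mulr_ge0 k10 sw0; have Ssp := mulr_ge0 k20 sp0.
clear a0 b0 rho0 ms0 Iws0 Jss0 e10 e20 ew0 ep0 aw0 bw0 gw0 ap0 bp0 gp0 r30 r50 r70 r80
  r40 r60 x0 i30 i40 i50 i60 i70 i80 k10 k20 sw0 sp0.
lra.
Qed.

(** Turns the positivity of [mu_3] and [mu_6] into that of the coefficients of the velocity
    derivatives in [dissipation_weights]. *)
Lemma margin_gt0 (P Q a b : R) : 0 < P -> 0 < Q -> 0 < P * a / Q - b -> 0 < a - Q / P * b.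
Proof.
move=> P0 Q0; rewrite !subr_gt0 ltr_pdivlMr// => h.
by rewrite mulrAC ltr_pdivrMr// mulrC [a * P]mulrC.
Qed.

Lemma weaken_weights (d dA dG dB dZ A G B Z : R) :
  0 <= A -> 0 <= G -> 0 <= B -> 0 <= Z -> d <= dA -> d <= dG -> d <= dB -> d <= dZ ->
  - dA * A - dG * G - dB * B - dZ * Z <= - d * (A + G + B + Z).
Proof.
move=> A0 G0 B0 Z0 /(ler_wpM2r A0) + /(ler_wpM2r G0) + /(ler_wpM2r B0) + /(ler_wpM2r Z0).
lra.
Qed.

Lemma sum_le_dissipation (A Ag B Bz G Z w q n1 n2 n3 l : R) :
  0 < n1 -> 0 < n2 -> 0 < n3 -> 0 < l -> 0 <= A -> 0 <= Ag -> 0 <= B -> 0 <= Bz ->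
  G <= n1 * Ag -> Z <= n3 * Bz -> w <= n2 * Ag -> q <= l * Bz ->
  A + B + G + Z + w + q <= (1 + n1 + n2 + n3 + l) * (A + Ag + B + Bz).
Proof.
move=> n10 n20 n30 l0 A0 Ag0 B0 Bz0 hG hZ hw hq.
have P (n a : R) : 0 < n -> 0 <= a -> 0 <= n * a by move=> /ltW; exact: mulr_ge0.
have := (P _ _ n10 A0, P _ _ n10 B0, P _ _ n10 Bz0, P _ _ n20 A0, P _ _ n20 B0, P _ _ n20 Bz0).
have := (P _ _ n30 A0, P _ _ n30 B0, P _ _ n30 Ag0, P _ _ l0 A0, P _ _ l0 B0, P _ _ l0 Ag0).
move=> [[[[[? ?] ?] ?] ?] ?] [[[[[? ?] ?] ?] ?] ?]; clear P.
lra.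
Qed.

End RealInequality.

Section DissipationInequality.
Context {R : realType}.
Variable p : params R.
Hypothesis hp : constants_ok p.
Implicit Types (X : state R).

Local Notation l := (len p).
Local Notation rho := (rho p).
Local Notation Iw := (Iw p).
Local Notation ms := (ms p).
Local Notation cw := (cw p).
Local Notation cphi := (cphi p).
Local Notation etaw := (etaw p).
Local Notation etaphi := (etaphi p).
Local Notation eps1 := (eps1 p).
Local Notation eps2 := (eps2 p).
Local Notation xc := (xc p).
Local Notation alw := (alw p).
Local Notation bew := (bew p).
Local Notation gaw := (gaw p).
Local Notation alphi := (alphi p).
Local Notation bephi := (bephi p).
Local Notation gaphi := (gaphi p).
Local Notation Iws := (Iws p).
Local Notation Jss := (Jss p).
Local Notation D1 := (wderivn l 1).
Local Notation D2 := (wderivn l 2).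
Local Notation tip f := (acrep l f l).

Let l0 : 0 < l. Proof. by case: hp => [[]]. Qed.

Definition dissip X : R :=
  I2 l (D2 (cf X)) (D2 (cf X)) + I2 l (D2 (cg X)) (D2 (cg X))
  + I2 l (D1 (ch X)) (D1 (ch X)) + I2 l (D1 (cz X)) (D1 (cz X)).

(* The Poincare constants: |u|^2 <= n1 |u''|^2, u(l)^2 <= n2 |u''|^2 and
   |v|^2 <= n3 |v'|^2. *)
Let n1 : R := 16 * l ^+ 4 / pi ^+ 4.
Let n2 : R := 4 * l ^+ 3 / pi ^+ 2.
Let n3 : R := 4 * l ^+ 2 / pi ^+ 2.

Let pi2_gt0 : 0 < (pi : R) ^+ 2. Proof. by rewrite exprn_gt0// pi_gt0. Qed.
Let pi4_gt0 : 0 < (pi : R) ^+ 4. Proof. by rewrite exprn_gt0// pi_gt0. Qed.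
Let n1_gt0 : 0 < n1. Proof. by rewrite divr_gt0// mulr_gt0// exprn_gt0. Qed.
Let n2_gt0 : 0 < n2. Proof. by rewrite divr_gt0// mulr_gt0// exprn_gt0. Qed.
Let n3_gt0 : 0 < n3. Proof. by rewrite divr_gt0// mulr_gt0// exprn_gt0. Qed.

Lemma inD_poincare X : inD p X ->
  [/\ I2 l (cf X) (cf X) <= n1 * I2 l (D2 (cf X)) (D2 (cf X)),
      I2 l (ch X) (ch X) <= n3 * I2 l (D1 (ch X)) (D1 (ch X)),
      I2 l (cg X) (cg X) <= n1 * I2 l (D2 (cg X)) (D2 (cg X)),
      I2 l (cz X) (cz X) <= n3 * I2 l (D1 (cz X)) (D1 (cz X))
    & czw X ^+ 2 <= n2 * I2 l (D2 (cg X)) (D2 (cg X)) /\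
      czphi X ^+ 2 <= l * I2 l (D1 (cz X)) (D1 (cz X))].
Proof.
move=> hX; have [[hX1 g2 z1 m2 t1] [m0 -> ->]] := inDE hp hX.
have [f2 _ h1 _] := (inHE l0 X).1 hX1.
have ll : 0 <= l <= l by rewrite lexx ltW.
split.
- exact: ler_mul_divl pi4_gt0 (H2L_poincare l0 f2).
- exact: ler_mul_divl pi2_gt0 (H1L_poincare l0 h1).
- exact: ler_mul_divl pi4_gt0 (H2L_poincare l0 g2).
- exact: ler_mul_divl pi2_gt0 (H1L_poincare l0 z1).
- split; first exact: ler_mul_divl pi2_gt0 (H2L_sup l0 g2 ll).
  exact: H1L_sup l0 z1 ll.
Qed.

Lemma young_pos (r : R) (u v : R -> R) : 0 < r -> inL2 l u -> inL2 l v ->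
  2 * I2 l u v <= r * I2 l u u + r^-1 * I2 l v v.
Proof.
move=> r0 hu hv; have := @I2_young _ l u v r 1 r^-1 hu hv (ltW r0).
by rewrite invr_ge0 (ltW r0) divff ?gt_eqF// expr1n mulr1; apply.
Qed.

Lemma young_neg (r : R) (u v : R -> R) : 0 < r -> inL2 l u -> inL2 l v ->
  - (2 * I2 l u v) <= r * I2 l u u + r^-1 * I2 l v v.
Proof.
move=> r0 hu hv; have := @I2_young _ l u v r (- 1) r^-1 hu hv (ltW r0).
by rewrite invr_ge0 (ltW r0) divff ?gt_eqF// sqrrN expr1n mulrN1 mulNr; apply.
Qed.

Section Weights.
Variables r1 r2 r3 r4 r5 r6 r7 r8 : R.
Hypotheses (r10 : 0 < r1) (r20 : 0 < r2) (r30 : 0 < r3) (r40 : 0 < r4).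
Hypotheses (r50 : 0 < r5) (r60 : 0 < r6) (r70 : 0 < r7) (r80 : 0 < r8).

(** This and the next lemmas bring the quantities of the structural assumption to the shape of the
    coefficients in [dissipation_scalar], with [n1], [n2], [n3] named and quotients by [r_j] written
    as products. [lam1] and [lam4] come normalized by a stiffness, restored here. *)
Lemma lam1E : rho * cw ^+ 2 * lam1 p r1 r3 r4 r5 =
  rho * cw ^+ 2 * (eps1 - eps1 * etaw / 2 * r1^-1)
  - eps1 * n1 / 2 * (alw * r4^-1 + bew * r5^-1 + gaw * r3^-1).
Proof.
case: hp => [[_ r0 _ _ _] [c0 _ _ _] _ _ _]; rewrite /lam1 /n1.
move: (pi : R) pi2_gt0 pi4_gt0 => P P2 P4.
have Pn : P != 0 by rewrite -sqrf_eq0 gt_eqF.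
have [rn cn] : rho != 0 /\ cw != 0 by rewrite !gt_eqF.
have [rn1 rn3] : r1 != 0 /\ r3 != 0 by rewrite !gt_eqF.
have [rn4 rn5] : r4 != 0 /\ r5 != 0 by rewrite !gt_eqF.
by field; rewrite ?rn ?cn ?rn1 ?rn3 ?rn4 ?rn5 ?Pn.
Qed.

Lemma lam2E : lam2 p r3 r6 r7 = gaw + (alw + eps2 * gaphi) / 2 * r6^-1
  + eps1 * gaw * r3 / 2 + (bew + gaphi) / 2 * r7^-1.
Proof. by rewrite /lam2 !invfM !mulrA. Qed.

Lemma lam3E : lam3 p r1 = rho * cw ^+ 2 * etaw
  - eps2 * `|xc| * (rho * n1 + ms * n2) / 2
  - eps1 * (rho * (2 + `|xc|) * n1 / 2 + rho * cw ^+ 2 * etaw * r1 / 2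
            + (2 + `|xc|) * ms * n2 / 2).
Proof.
case: hp => [[_ r0 _ _ _] _ _ _ _]; rewrite /lam3 /n1 /n2.
move: (pi : R) pi2_gt0 pi4_gt0 => P P2 P4.
have Pn : P != 0 by rewrite -sqrf_eq0 gt_eqF.
have rn : rho != 0 by rewrite gt_eqF.
by field; rewrite ?rn ?Pn.
Qed.

Lemma lam4E : Iw * cphi ^+ 2 * lam4 p r2 r4 r6 r8 =
  Iw * cphi ^+ 2 * (eps2 - eps2 * etaphi / 2 * r2^-1)
  - n3 * ((alw + eps2 * gaphi) * r6 / 2 + (alphi + eps2 * bephi) / 2 * r8^-1
          + eps1 * alw * r4 / 2 + eps2 * alphi).
Proof.
case: hp => [[_ _ i0 _ _] [_ c0 _ _] _ _ _]; rewrite /lam4 /n3.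
move: (pi : R) pi2_gt0 pi4_gt0 => P P2 P4.
have Pn : P != 0 by rewrite -sqrf_eq0 gt_eqF.
have [rn cn] : Iw != 0 /\ cphi != 0 by rewrite !gt_eqF.
have [rn2 rn8] : r2 != 0 /\ r8 != 0 by rewrite !gt_eqF.
by field; rewrite ?rn ?cn ?rn2 ?rn8 ?Pn.
Qed.

Lemma lam6E : lam6 p r2 = Iw * cphi ^+ 2 * etaphi
  - eps1 * `|xc| * (rho * n3 + ms * l) / 2
  - eps2 * ((2 * Iws + `|xc| * rho) * n3 / 2 + Iw * cphi ^+ 2 * etaphi * r2 / 2
            + l * (2 * Jss + `|xc| * ms) / 2).
Proof.
case: hp => [[_ _ i0 _ _] _ _ _ _]; rewrite /lam6 /n3.
move: (pi : R) pi2_gt0 pi4_gt0 => P P2 P4.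
have Pn : P != 0 by rewrite -sqrf_eq0 gt_eqF.
have rn : Iw != 0 by rewrite gt_eqF.
by field; rewrite ?rn ?Pn.
Qed.

Lemma dissipation_weights X : inD p X ->
  ip2 p (Aop p X) X <=
    - (rho * cw ^+ 2 * lam1 p r1 r3 r4 r5) * I2 l (D2 (cf X)) (D2 (cf X))
    - (lam3 p r1 - n1 * lam2 p r3 r6 r7) * I2 l (D2 (cg X)) (D2 (cg X))
    - Iw * cphi ^+ 2 * lam4 p r2 r4 r6 r8 * I2 l (D1 (ch X)) (D1 (ch X))
    - (lam6 p r2 - n3 * lam5 p r5 r7 r8) * I2 l (D1 (cz X)) (D1 (cz X)).
Proof.
move=> hX; rewrite (ip2_Aop hp hX).
have [P1 P2 P3 P4 [P5 P6]] := inD_poincare hX.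
have [[hX1 g2 z1 _ _] _] := inDE hp hX.
have [lf2 hg lh1 hz [hf hh]] := inH_L2 l0 hX1.
have [g2' _ _] := g2; have lg2 := H2_L2 l0 g2'.
have [_ lz1 _ _] := H1_wderiv l0 z1.1.
rewrite lam1E lam2E lam3E lam4E lam6E /lam5.
have y1 := young_neg r10 lg2 lf2; have y2 := young_neg r20 lz1 lh1.
have y3 := young_pos r30 hg hf; have y4 := young_pos r40 hh hf.
have y5 := young_pos r50 hz hf; have y6 := young_pos r60 hh hg.
have y7 := young_pos r70 hz hg; have y8 := young_pos r80 hz hh.
have x0 : 0 <= `|xc| by [].
have xx : `|xc| ^+ 2 = xc ^+ 2 by rewrite real_normK// num_real.
have xle : xc ^+ 2 <= `|xc| * `|xc| by rewrite -expr2 xx.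
have y9 := I2_young hg hz x0 x0 xle.
have y10 : 2 * xc * (czw X * czphi X) <= `|xc| * czw X ^+ 2 + `|xc| * czphi X ^+ 2.
  have := @young_norm _ _ (- xc) _ 1 (czw X) (czphi X) x0 x0.
  rewrite sqrrN expr1n mul1r => /(_ xle erefl).
  by rewrite mulrN mulNr lerN2.
case: (hp) => [[_ r0 i0 m0 _] [c0 cp0 e0 ep0] [k10 k20 e10 e20] [aw0 bw0 gw0] [ap0 bp0 gp0]].
have i'0 := Iws_gt0 hp; have j'0 := Jss_gt0 hp.
rewrite [I2 _ (cg X) (cz X)]I2C in y9.
rewrite [I2 _ (ch X) (cz X)]I2C [I2 _ (cg X) (ch X)]I2C [I2 _ (cg X) (cz X)]I2C.
have a0 : 0 <= rho * cw ^+ 2 by rewrite mulr_ge0 ?sqr_ge0// ltW.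
have b0 : 0 <= Iw * cphi ^+ 2 by rewrite mulr_ge0 ?sqr_ge0// ltW.
have sw := sqr_ge0 (czw X + eps1 * tip (cf X)).
have sp := sqr_ge0 (czphi X + eps2 * tip (ch X)).
have iv (r : R) : 0 < r -> 0 <= r^-1 by rewrite invr_ge0 => /ltW.
exact: (dissipation_scalar (And5 a0 b0 (ltW r0) (ltW m0) (ltW i'0))
  (And5 (ltW j'0) (ltW e10) (ltW e20) (ltW e0) (ltW ep0)) (And3 aw0 bw0 gw0)
  (And3 ap0 bp0 gp0) (And4 (ltW r30) (ltW r50) (ltW r70) (ltW r80))
  (And4 (ltW r40) (ltW r60) x0 I) (And4 (iv _ r30) (iv _ r40) (iv _ r50) (iv _ r60))
  (And4 (iv _ r70) (iv _ r80) (ltW k10) (ltW k20)) (And4 P1 P2 P3 P4)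
  (And4 P5 P6 sw sp) (And5 y1 y2 y3 y4 y5) (And5 y6 y7 y8 y9 y10)).
Qed.

End Weights.

Lemma dissipation : structural_assumption p ->
  exists2 delta, 0 < delta & forall X, inD p X -> ip2 p (Aop p X) X <= - delta * dissip X.
Proof.
move=> [_ _ _ _ [r1 [r2 [r3 [r4 [r5 [r6 [r7 [r8]]]]]]]]].
move=> [[r10 r20 r30 r40] [r50 r60 r70 r80] [L1 L3 L4 L6] M3 M6].
case: (hp) => [[_ r0 i0 _ _] [c0 cp0 _ _] _ _ _].
pose dA := rho * cw ^+ 2 * lam1 p r1 r3 r4 r5.
pose dG := lam3 p r1 - n1 * lam2 p r3 r6 r7.
pose dB := Iw * cphi ^+ 2 * lam4 p r2 r4 r6 r8.
pose dZ := lam6 p r2 - n3 * lam5 p r5 r7 r8.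
have l4 : 0 < 16 * l ^+ 4 by rewrite mulr_gt0// exprn_gt0.
have l2 : 0 < 4 * l ^+ 2 by rewrite mulr_gt0// exprn_gt0.
have dA0 : 0 < dA := mulr_gt0 (mulr_gt0 r0 (exprn_gt0 2 c0)) L1.
have dB0 : 0 < dB := mulr_gt0 (mulr_gt0 i0 (exprn_gt0 2 cp0)) L4.
have dG0 : 0 < dG := margin_gt0 pi4_gt0 l4 M3.
have dZ0 : 0 < dZ := margin_gt0 pi2_gt0 l2 M6.
exists (Num.min (Num.min dA dG) (Num.min dB dZ)).
  by rewrite !lt_min dA0 dG0 dB0 dZ0.
set d := Num.min _ _ => X hX.
have : d <= d by [].
rewrite {2}/d !le_min => /andP[/andP[leA leG] /andP[leB leZ]].
have := dissipation_weights r10 r20 r30 r40 r50 r60 r70 r80 hX.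
rewrite -/dA -/dG -/dB -/dZ => /le_trans; apply; rewrite /dissip.
exact: (weaken_weights (I2_ge0 l (D2 (cf X))) (I2_ge0 l (D2 (cg X)))
  (I2_ge0 l (D1 (ch X))) (I2_ge0 l (D1 (cz X))) leA leG leB leZ).
Qed.

Lemma nrm_le_dissip : exists2 c, 0 < c & forall X, inD p X -> nrm p (crd p X) <= c * dissip X.
Proof.
exists (1 + n1 + n2 + n3 + l).
  by rewrite !addr_gt0.
move=> X hX; have [_ _ P3 P4 [P5 P6]] := inD_poincare hX.
rewrite /nrm /dissip /=.
apply: (sum_le_dissipation n1_gt0 n2_gt0 n3_gt0 l0 (I2_ge0 l (D2 (cf X))) (I2_ge0 l (D2 (cg X)))
  (I2_ge0 l (D1 (ch X))) (I2_ge0 l (D1 (cz X))) P3 P4 P5 P6).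
Qed.

End DissipationInequality.

(** * Linear algebra of states modulo almost everywhere equality *)

Section StateAlgebra.
Context {R : realType}.
Variable p : params R.
Implicit Types (X Y Z W : state R).

(** Linearity, of the forms and of the semigroup, is available for [addS (scaleS a X) Y] only, so
    differences and multiples are brought to this form; in [scaleSE] the factor [a - 1] dispenses
    with a zero state. *)
Lemma subSE X Y : subS X Y = addS (scaleS (-1) Y) X.
Proof. by congr State; (apply/funext => y || idtac); rewrite addrC. Qed.

Lemma scaleSE a X : scaleS a X = addS (scaleS (a - 1) X) X.
Proof. by congr State; (apply/funext => y || idtac); rewrite /= mulrBl mul1r subrK. Qed.

Lemma scale0S X Y : addS (scaleS 0 X) Y = Y.
Proof.
by case: Y => f g h z w q; congr State; (apply/funext => y || idtac); rewrite /= mul0r add0r.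
Qed.

Lemma eqH_refl X : eqH p X X.
Proof. by split=> //; exact: eq_ae_refl. Qed.

Lemma eqH_sym X Y : eqH p X Y -> eqH p Y X.
Proof.
move=> [f g h z [ew eq]]; split.
- exact: (eq_ae_sym f).
- exact: (eq_ae_sym g).
- exact: (eq_ae_sym h).
- exact: (eq_ae_sym z).
- by rewrite ew eq.
Qed.

Lemma eqH_trans Y X Z : eqH p X Y -> eqH p Y Z -> eqH p X Z.
Proof.
move=> [f1 g1 h1 z1 [w1 q1]] [f2 g2 h2 z2 [w2 q2]]; split.
- exact: eq_ae_trans f1 f2.
- exact: eq_ae_trans g1 g2.
- exact: eq_ae_trans h1 h2.
- exact: eq_ae_trans z1 z2.
- by rewrite w1 w2 q1 q2.
Qed.

Lemma eqH_lin a X X' Y Y' : eqH p X X' -> eqH p Y Y' ->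
  eqH p (addS (scaleS a X) Y) (addS (scaleS a X') Y').
Proof.
move=> [f1 g1 h1 z1 [w1 q1]] [f2 g2 h2 z2 [w2 q2]]; split.
- exact: eq_ae_lin f1 f2.
- exact: eq_ae_lin g1 g2.
- exact: eq_ae_lin h1 h2.
- exact: eq_ae_lin z1 z2.
- by rewrite /= w1 w2 q1 q2.
Qed.

Lemma eqH_sub X X' Y Y' : eqH p X X' -> eqH p Y Y' -> eqH p (subS X Y) (subS X' Y').
Proof. by rewrite !subSE => e1 e2; exact: eqH_lin. Qed.

Lemma eqH_scale a X X' : eqH p X X' -> eqH p (scaleS a X) (scaleS a X').
Proof. by rewrite scaleSE [in X in _ -> X](scaleSE a X') => e; exact: eqH_lin. Qed.

Hypothesis l0 : 0 < len p.

Lemma inH_sub X Y : inH p X -> inH p Y -> inH p (subS X Y).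
Proof. by rewrite subSE => hX hY; exact: (inH_lin l0). Qed.

Lemma inH_scale a X : inH p X -> inH p (scaleS a X).
Proof. by rewrite scaleSE => hX; exact: (inH_lin l0). Qed.

Lemma ip1_eqH X Y : inH p X -> inH p Y -> eqH p X Y -> ip1 p X X = ip1 p Y Y.
Proof.
move=> hX hY; rewrite -{1}[Y](scale0S Y) => e.
rewrite (ip1_lin l0 hY hY hX hX e) mul0r add0r (ip1C l0 hY hX).
by rewrite (ip1_lin l0 hY hY hX hY e) mul0r add0r.
Qed.

Lemma ip2_eqH X Y : inH p X -> inH p Y -> eqH p X Y -> ip2 p X X = ip2 p Y Y.
Proof.
move=> hX hY; rewrite -{1}[Y](scale0S Y) => e.
rewrite (ip2_lin l0 hY hY hX hX e) mul0r add0r (ip2C l0 hY hX).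
by rewrite (ip2_lin l0 hY hY hX hY e) mul0r add0r.
Qed.

Lemma norm1_eqH X Y : inH p X -> inH p Y -> eqH p X Y -> norm1 p X = norm1 p Y.
Proof. by move=> hX hY e; rewrite /norm1 (ip1_eqH hX hY e). Qed.

Lemma ip2_sqr_lin a X Y W : inH p X -> inH p Y -> inH p W ->
  eqH p W (addS (scaleS a X) Y) ->
  ip2 p W W = a ^+ 2 * ip2 p X X + 2 * a * ip2 p X Y + ip2 p Y Y.
Proof.
move=> hX hY hW e; rewrite (ip2_lin l0 hX hY hW hW e) (ip2C l0 hX hW) (ip2C l0 hY hW).
rewrite (ip2_lin l0 hX hY hW hX e) (ip2_lin l0 hX hY hW hY e) (ip2C l0 hY hX); ring.
Qed.

End StateAlgebra.

Lemma discriminant_le (R : realFieldType) (a b c : R) : 0 <= a ->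
  (forall x, 0 <= x ^+ 2 * a + 2 * x * b + c) -> b ^+ 2 <= a * c.
Proof.
move=> a0 h; have [a00|an0] := eqVneq a 0.
  have [-> | bn0] := eqVneq b 0; first by rewrite a00 expr2 !mul0r.
  (* An affine function with nonzero slope takes the value -1 here. *)
  have := h (- (c + 1) / (2 * b)); rewrite a00 mulr0 add0r.
  have -> : 2 * (- (c + 1) / (2 * b)) * b + c = -1 by field.
  by rewrite ler0N1.
have {an0}a1 : 0 < a by rewrite lt_neqAle eq_sym an0.
have := mulr_ge0 a0 (h (- b / a)).
have -> : a * ((- b / a) ^+ 2 * a + 2 * (- b / a) * b + c) = a * c - b ^+ 2.
  by field; rewrite gt_eqF.
by rewrite subr_ge0.
Qed.

Lemma sum_mul_le6 (R : realDomainType) (a b c d e f A B C D E F : R) :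
  [/\ 0 <= a, 0 <= b & 0 <= c] -> [/\ 0 <= d, 0 <= e & 0 <= f] ->
  [/\ 0 <= A, 0 <= B & 0 <= C] -> [/\ 0 <= D, 0 <= E & 0 <= F] ->
  a * A + b * B + c * C + d * D + e * E + f * F <=
  (a + b + c + d + e + f) * (A + B + C + D + E + F).
Proof.
move=> [a0 b0 c0] [d0 e0 f0] [A0 B0 C0] [D0 E0 F0].
have le (x X : R) : 0 <= X -> x <= a + b + c + d + e + f ->
  x * X <= (a + b + c + d + e + f) * X by move=> X0; exact: ler_wpM2r.
rewrite !(mulrDr (_ + _)) !lerD// le//; lra.
Qed.

(** * Equivalence of the norms *)

Section NormEquivalence.
Context {R : realType}.
Variable p : params R.
Hypotheses (hp : constants_ok p) (hS : structural_assumption p).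
Implicit Types (X Y : state R).

Let l0 : 0 < len p. Proof. by case: hp => [[]]. Qed.

Lemma form1_le : exists2 C, 0 < C & forall K, coordsL2 p K -> form1 p K K <= C * nrm p K.
Proof.
case: (hp) => [[_ r0 i0 m0 j0] [c0 cp0 _ _] _ _ _].
have i'0 := Iws_gt0 hp; have j'0 := Jss_gt0 hp.
pose cF := rho p * cw p ^+ 2; pose cH := Iw p * cphi p ^+ 2.
(* Young's inequality charges [rho] to [kg] and [rho * xc ^+ 2] to [kz] for the off-diagonal entries
   of [M]; [cW] and [cP] do the same for [Ms]. *)
pose cG := 2 * rho p; pose cZ := Iws p + rho p * xc p ^+ 2.
pose cW := 2 * ms p; pose cP := Jss p + ms p * xc p ^+ 2.
have [F0 H0 G0 Z0] : [/\ 0 < cF, 0 < cH, 0 < cG & 0 < cZ].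
  split; [exact: (mulr_gt0 r0 (exprn_gt0 2 c0))|exact: (mulr_gt0 i0 (exprn_gt0 2 cp0))| |].
    exact: (mulr_gt0 (ltr0Sn R 1) r0).
  exact: (ltr_wpDr (mulr_ge0 (ltW r0) (sqr_ge0 _)) i'0).
have [W0 P0] : 0 < cW /\ 0 < cP.
  split; first exact: (mulr_gt0 (ltr0Sn R 1) m0).
  exact: (ltr_wpDr (mulr_ge0 (ltW m0) (sqr_ge0 _)) j'0).
exists (cF + cH + cG + cZ + cW + cP); first exact: (addr_gt0 (addr_gt0 (addr_gt0 (addr_gt0 (addr_gt0 F0 H0) G0) Z0) W0) P0).
move=> K [hf2 hh1 hg hz _]; rewrite /form1 /nrm [I2 _ (kz K) (kg K)]I2C.
have Y1 := @I2_young _ (len p) (kg K) (kz K) (rho p) (rho p * xc p) (rho p * xc p ^+ 2) hg hz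
  (ltW r0) (mulr_ge0 (ltW r0) (sqr_ge0 _)).
have {}Y1 := Y1 ltac:(by rewrite exprMn expr2 mulrA).
have Y2 := @young_norm _ (ms p) (- (ms p * xc p)) (ms p * xc p ^+ 2) 1 (kw K) (kp K)
  (ltW m0) (mulr_ge0 (ltW m0) (sqr_ge0 _)).
have {}Y2 := Y2 ltac:(by rewrite sqrrN exprMn expr2 mulrA) (expr1n _ 2).
move: Y1 Y2 (I2_ge0 (len p) (kf2 K)) (I2_ge0 (len p) (kh1 K)) (I2_ge0 (len p) (kg K))
  (I2_ge0 (len p) (kz K)) (sqr_ge0 (kw K)) (sqr_ge0 (kp K)).
rewrite -/cF -/cH -!expr2.
move: (I2 _ (kf2 K) _) (I2 _ (kh1 K) _) (I2 _ (kg K) (kz K)) (I2 _ (kg K) (kg K)) (I2 _ (kz K) _).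
rewrite [kp K * kw K]mulrC.
move: (kw K ^+ 2) (kp K ^+ 2) (kw K * kp K) => w q wq A B gz G Z Y1 Y2 A0 B0 G0' Z0' w0 q0.
apply: le_trans (sum_mul_le6 (And3 (ltW F0) (ltW H0) (ltW G0)) (And3 (ltW Z0) (ltW W0) (ltW P0))
  (And3 A0 B0 G0') (And3 Z0' w0 q0)).
rewrite /cG /cZ /cW /cP; lra.
Qed.

(** The sign 1 in [coercive] gives the lower bound of [ip2]; the sign -1 gives [Psi <= ip1], hence
    the factor 2; their sum gives [0 <= ip1]. *)
Lemma norms_equiv : exists c C : R, [/\ 0 < c, 0 < C & forall X, inH p X ->
  [/\ 0 <= ip1 p X X, c * nrm p (crd p X) <= ip2 p X X, ip2 p X X <= 2 * ip1 p X X
    & ip1 p X X <= C * nrm p (crd p X)]].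
Proof.
have [c c0 hc] := coercive hp hS; have [C C0 hC] := form1_le.
exists c, C; split => // X hX.
have K2 := crdL2 l0 hX; have Kc := crd_clamped hp hX.
have := hc _ 1 K2 Kc (expr1n _ 2); have := hc _ (-1) K2 Kc ltac:(by rewrite sqrrN expr1n).
have := hC _ K2; have := mulr_ge0 (ltW c0) (nrm_ge0 p (crd p X)).
rewrite /ip2 (ip1E l0 hX hX) (PsiE l0 hX hX).
move: (form1 _ _ _) (formPsi _ _ _) (c * _) (C * _) => a b d e h1 h2 h3 h4.
by split; lra.
Qed.

Lemma ip2_ge0 X : inH p X -> 0 <= ip2 p X X.
Proof.
move=> hX; have [c [_ [c0 _ /(_ X hX)[_ + _ _]]]] := norms_equiv.
by apply: le_trans; exact: (mulr_ge0 (ltW c0) (nrm_ge0 p (crd p X))).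
Qed.

Lemma norm1_sqr X : inH p X -> norm1 p X ^+ 2 = ip1 p X X.
Proof.
by move=> hX; have [c [_ [_ _ /(_ X hX)[h _ _ _]]]] := norms_equiv; rewrite /norm1 sqr_sqrtr.
Qed.

Lemma norm2_sqr X : inH p X -> norm2 p X ^+ 2 = ip2 p X X.
Proof. by move=> hX; rewrite /norm2 sqr_sqrtr// ip2_ge0. Qed.

Lemma ip2_le_norm1 X : inH p X -> ip2 p X X <= 2 * norm1 p X ^+ 2.
Proof.
by move=> hX; have [c [_ [_ _ /(_ X hX)[_ _ h _]]]] := norms_equiv; rewrite norm1_sqr.
Qed.

Lemma ip2_cauchy X Y : inH p X -> inH p Y -> `|ip2 p X Y| <= norm2 p X * norm2 p Y.
Proof.
move=> hX hY; have n0 (Z : state R) : 0 <= norm2 p Z := sqrtr_ge0 _.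
rewrite -(@ler_pXn2r _ 2)// ?nnegrE ?mulr_ge0// exprMn !norm2_sqr// real_normK ?num_real//.
apply: discriminant_le (ip2_ge0 hX) _ => a.
have hW := inH_lin l0 a hX hY.
by rewrite -(ip2_sqr_lin l0 hX hY hW (eqH_refl _ _)) ip2_ge0.
Qed.

End NormEquivalence.

(** * Decay along orbits *)

Section Decay.
Context {R : realType}.

(** The infimum of the counterexamples would satisfy [P] by closure from the left, hence so would an
    interval to its right, which contradicts its choice. *)
Lemma real_induction (P : R -> Prop) : P 0 ->
  (forall t, 0 <= t -> P t -> exists2 d, 0 < d & forall h, 0 < h -> h < d -> P (t + h)) ->
  (forall t, 0 < t -> (forall s, 0 <= s -> s < t -> P s) -> P t) ->
  forall t, 0 <= t -> P t.
Proof.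
move=> P0 Pr Pl t t0; apply: contrapT => nPt.
pose S := [set s | 0 <= s /\ ~ P s].
have St : S t by [].
have S0 : lbound S 0 by move=> s [].
have hS : has_inf S by split; [exists t|exists 0].
have m0 : 0 <= inf S by apply: lb_le_inf => //; exists t.
have below s : 0 <= s -> s < inf S -> P s.
  move=> s0 sm; apply: contrapT => nPs; move: sm; apply/negP; rewrite -leNgt.
  by apply: ge_inf; [exists 0|].
have Pm : P (inf S).
  have [->|mn] := eqVneq (inf S) 0; first by [].
  by apply: Pl; rewrite ?lt_neqAle 1?eq_sym ?mn.
have [d d0 hd] := Pr _ m0 Pm.
have : inf S + d <= inf S; last by rewrite gerDl leNgt d0.
apply: lb_le_inf; first by exists t.
move=> s [s0 nPs]; rewrite leNgt; apply/negP => smd; apply: nPs.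
have [sm|] := ltP s (inf S); first exact: below.
rewrite le_eqVlt => /orP[/eqP<-//|ms].
by rewrite -(subrKC (inf S) s); apply: hd; rewrite ?subr_gt0// ltrBlDl.
Qed.

Lemma continuous_le_closed (f g : R -> R) (t : R) : 0 < t ->
  (forall e, 0 < e -> exists2 d, 0 < d &
     forall s, 0 <= s -> `|s - t| < d -> `|f s - f t| < e) ->
  {for t, continuous g} ->
  (forall s, 0 <= s -> s < t -> f s <= g s) -> f t <= g t.
Proof.
move=> t0 fc gc fg; rewrite leNgt; apply/negP => gf.
pose e := (f t - g t) / 2.
have e0 : 0 < e by rewrite divr_gt0// subr_gt0.
have [d d0 hd] := fc e e0.
have [d' /= d'0 hd'] : \forall s \near t, `|g t - g s| < e.
  by move/cvgrPdist_lt : gc; apply.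
pose k := Num.min (Num.min d d') t / 2.
have m0 : 0 < Num.min (Num.min d d') t by rewrite !lt_min d0 d'0 t0.
have k0 : 0 < k by rewrite divr_gt0.
have : k < Num.min (Num.min d d') t by rewrite /k ltr_pdivrMr// ltr_pMr// ltrDl.
rewrite !lt_min => /andP[/andP[kd kd'] kt].
have s0 : 0 <= t - k by rewrite subr_ge0 ltW.
have st : t - k < t by rewrite gtrBl.
have dist : `|t - (t - k)| = k by rewrite opprB addrC subrK gtr0_norm.
have := fg _ s0 st.
have := hd (t - k) s0; rewrite distrC dist => /(_ kd).
have := hd' (t - k); rewrite /= dist => /(_ kd').
rewrite !ltr_norml /e => /andP[h1 _] /andP[h2 _] h3.
lra.
Qed.

(** The comparison function [g] solves [g' = - L g + e expR (- L s)]: its source term leaves room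
    for the error in the Dini bound, so that [f <= g] extends to the right. Then [e] tends to 0. *)
Lemma dini_decay (f : R -> R) (L : R) : 0 < L -> (forall t, 0 <= t -> 0 <= f t) ->
  (forall t e, 0 <= t -> 0 < e -> exists2 d, 0 < d &
     forall s, 0 <= s -> `|s - t| < d -> `|f s - f t| < e) ->
  (forall t e, 0 <= t -> 0 < e -> exists2 d, 0 < d &
     forall h, 0 < h -> h < d -> f (t + h) <= f t + h * (- L * f t + e)) ->
  forall t, 0 <= t -> f t <= f 0 * expR (- L * t).
Proof.
move=> L0 f0 fc fd t t0; apply/ler_addgt0Pr => e0 e00.
(* At the final time the source contributes [e * t * expR (- L * t)], which this choice keeps at
   most [e0]; the [+ 1] keeps the denominator positive at [t = 0]. *)
pose e := e0 / (t * expR (- L * t) + 1).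
have te0 : 0 < t * expR (- L * t) + 1 by rewrite ltr_wpDl// mulr_ge0// expR_ge0.
have e_gt0 : 0 < e by rewrite divr_gt0.
pose g s := (f 0 + e * s) * expR (- L * s).
suff fg s : 0 <= s -> f s <= g s.
  apply: (le_trans (fg t t0)); rewrite /g mulrDl lerD2l -mulrA.
  by rewrite /e mulrAC ler_pdivrMr// ler_pM2l// lerDl.
move: s; apply: (real_induction (P := fun s => f s <= g s)).
- by rewrite /g !mulr0 addr0 expR0 mulr1.
- move=> s s0 fgs.
  (* A lower bound of [expR (- L * (s + h))] for all [h < 1], so the Dini error can be chosen before
     [h]. The further bound by [L^-1] makes [1 - L * h] nonnegative. *)
  pose E := expR (- L * (s + 1)).
  have E0 : 0 < E by rewrite expR_gt0.
  have [d d0 hd] := fd s (e * E) s0 (mulr_gt0 e_gt0 E0).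
  exists (Num.min d (Num.min 1 L^-1)); first by rewrite !lt_min d0 ltr01 invr_gt0.
  move=> h h0; rewrite !lt_min => /andP[hd1 /andP[h1 hL]].
  apply: (le_trans (hd h h0 hd1)).
  have hL1 : L * h <= 1 by rewrite mulrC -ler_pdivlMr// mul1r ltW.
  apply: (@le_trans _ _ (g s * (1 - L * h) + e * h * E)).
    rewrite (_ : f s + _ = f s * (1 - L * h) + e * h * E); last by ring.
    by rewrite lerD2r ler_wpM2r// subr_ge0.
  have -> : g (s + h) = g s * expR (- L * h) + e * h * expR (- L * (s + h)).
    by rewrite /g !mulrDr expRD; ring.
  rewrite lerD//.
    apply: ler_wpM2l; last by rewrite -mulNr; exact: expR_ge1Dx.
    by rewrite /g mulr_ge0 ?expR_ge0// addr_ge0 ?f0// mulr_ge0// ltW.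
  apply: ler_wpM2l; first by rewrite mulr_ge0// ltW.
  by rewrite ler_expR !mulNr lerN2 ler_wpM2l ?(ltW L0)// lerD2l ltW.
- move=> s s0; apply: continuous_le_closed => //.
    by move=> e1; apply: fc; exact: ltW.
  apply: cvgM.
    by apply: cvgD; [exact: cvg_cst|apply: cvgM; [exact: cvg_cst|exact: cvg_id]].
  apply: continuous_comp; last exact: continuous_expR.
  by apply: cvgM; [exact: cvg_cst|exact: cvg_id].
Qed.

End Decay.

Section Quotients.
Context {R : realType}.
Implicit Types (X Y U : state R).

Lemma addS_subS X Y : X = addS (scaleS 1 (subS X Y)) Y.
Proof.
case: X Y => [f g h z w q] [f' g' h' z' w' q'].
by congr State; (apply/funext => y || idtac); rewrite /=; ring.
Qed.

(** A first-order expansion: with [D] the error of the difference quotient, [U = X + a (D + Y)],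
    arranged in the linear form for which [ip2_sqr_lin] is stated. *)
Lemma addS_quotient a U X Y : a != 0 ->
  U = addS (scaleS a (addS (scaleS 1 (subS (scaleS a^-1 (subS U X)) Y)) Y)) X.
Proof.
move=> a0; case: U X Y => [f g h z w q] [f' g' h' z' w' q'] [? ? ? ? ? ?].
by congr State; (apply/funext => y || idtac); rewrite /=; field.
Qed.

End Quotients.

(** * Orbits of the semigroup *)

Section Orbits.
Context {R : realType}.
Variable p : params R.
Hypotheses (hp : constants_ok p) (hS : structural_assumption p).
Variable T : R -> state R -> state R.
Hypothesis hT : generated_by_A p T.
Implicit Types (X Y Z : state R).

Let l0 : 0 < len p. Proof. by case: hp => [[]]. Qed.

Let T_inH t X : 0 <= t -> inH p X -> inH p (T t X).
Proof. by case: hT => [[[h _ _ _] _ _ _] _]; exact: h. Qed.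

Let T_lin t a X Y : 0 <= t -> inH p X -> inH p Y ->
  eqH p (T t (addS (scaleS a X) Y)) (addS (scaleS a (T t X)) (T t Y)).
Proof. by case: hT => [[[_ _ h _] _ _ _] _]; exact: h. Qed.

Let T_sub t X Y : 0 <= t -> inH p X -> inH p Y ->
  eqH p (T t (subS X Y)) (subS (T t X) (T t Y)).
Proof. by move=> t0 hX hY; rewrite !subSE; exact: T_lin. Qed.

Let T_scale t a X : 0 <= t -> inH p X -> eqH p (T t (scaleS a X)) (scaleS a (T t X)).
Proof. by move=> t0 hX; rewrite scaleSE (scaleSE a (T t X)); exact: T_lin. Qed.

Let T_comm s t X : 0 <= s -> 0 <= t -> inH p X -> eqH p (T s (T t X)) (T t (T s X)).
Proof.
case: hT => [[_ _ h _] _] s0 t0 hX.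
by apply: eqH_trans (h t s X t0 s0 hX); rewrite addrC; apply: eqH_sym; exact: h.
Qed.

(** [T t] is linear and commutes with [T h], so it maps the error of the difference quotient at [X]
    to the one at [T t X]; its operator bound [C] preserves the convergence to 0. *)
Lemma infinitesimal_orbit t X Y : 0 <= t -> inH p X -> inH p Y ->
  infinitesimal p T X Y -> infinitesimal p T (T t X) (T t Y).
Proof.
move=> t0 hX hY; case: (hT) => [[[_ _ _ /(_ t t0)[C hC]] _ _ _] _] XY.
have XYC : C * norm1 p (subS (scaleS h^-1 (subS (T h X) X)) Y) @[h --> 0^'+] --> (0 : R).
  have H := cvgM (cvg_cst C) XY; rewrite mulr0 in H; exact: H.
apply: (squeeze_cvgr _ (cvg_cst 0) XYC).
near=> h; apply/andP; split; first exact: sqrtr_ge0.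
have h0 : 0 <= h by apply: ltW; near: h; exact: nbhs_right_gt.
have hD : inH p (subS (T h X) X) by apply: inH_sub => //; exact: T_inH.
have hQ := inH_scale l0 h^-1 hD.
have hW : inH p (subS (scaleS h^-1 (subS (T h X) X)) Y) by exact: inH_sub.
apply: le_trans (hC _ hW); rewrite le_eqVlt; apply/orP; left; apply/eqP.
have hTX := T_inH t0 hX.
apply: norm1_eqH => //.
- apply: inH_sub => //; last exact: T_inH.
  by apply: inH_scale => //; apply: inH_sub => //; exact: T_inH.
- exact: T_inH.
- apply: eqH_sym; apply: eqH_trans (T_sub t0 hQ hY) _.
  apply: eqH_sub (eqH_refl _ _).
  apply: eqH_trans (T_scale _ t0 hD) _; apply: eqH_scale.
  apply: eqH_trans (T_sub t0 (T_inH h0 hX) hX) _.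
  by apply: eqH_sub (eqH_refl _ _); exact: T_comm.
Unshelve. all: by end_near. Qed.

(** Since the orbit of [T t X] is differentiable at time 0, the equality of graphs puts [T t X] in
    the domain. *)
Lemma orbit_inD t X : 0 <= t -> inD p X -> inD p (T t X).
Proof.
move=> t0 dX; have [hX _ _ _ _] := dX; have hA := inH_Aop hp dX.
have [_ gen] := hT.
have XA : infinitesimal p T X (Aop p X) by apply/gen => //; split => //; exact: eqH_refl.
have := infinitesimal_orbit t0 hX hA XA.
by move/(gen _ _ (T_inH t0 hX) (T_inH t0 hA)) => [].
Qed.

Lemma infinitesimalP X Y e : infinitesimal p T X Y -> 0 < e ->
  exists2 d, 0 < d & forall h, 0 < h -> h < d ->
    norm1 p (subS (scaleS h^-1 (subS (T h X) X)) Y) < e.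
Proof.
move=> XY e0; have [d /= d0 hd] := ((cvgr0Pnorm_lt _).1 XY) e e0.
exists d => // h h0 hd1; apply: le_lt_trans (ler_norm _) (hd h _ h0).
by rewrite /= sub0r normrN gtr0_norm.
Qed.

Lemma orbit_continuous X t e : inH p X -> 0 <= t -> 0 < e ->
  exists2 d, 0 < d & forall s, 0 <= s -> `|s - t| < d -> norm1 p (subS (T s X) (T t X)) < e.
Proof.
case: hT => [[_ _ _ h] _] hX t0 e0.
have [d /= d0 hd] := ((cvgr0Pnorm_lt _).1 (h X t hX t0)) e e0.
exists d => // s s0 sd; apply: le_lt_trans (ler_norm _) (hd s _ _).
  by rewrite /= distrC.
by rewrite /= in_itv /= s0.
Qed.

Lemma norm2_le_norm1 X : inH p X -> norm2 p X <= 2 * norm1 p X.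
Proof.
move=> hX; rewrite -(@ler_pXn2r _ 2)// ?nnegrE ?mulr_ge0 ?sqrtr_ge0//.
rewrite norm2_sqr// (le_trans (ip2_le_norm1 hp hS hX))// exprMn ler_wpM2r ?sqr_ge0//.
by rewrite expr2 ler_peMr// ler1n.
Qed.

Lemma ip2_orbit_continuous X t e : inH p X -> 0 <= t -> 0 < e ->
  exists2 d, 0 < d & forall s, 0 <= s -> `|s - t| < d ->
    `|ip2 p (T s X) (T s X) - ip2 p (T t X) (T t X)| < e.
Proof.
move=> hX t0 e0; have hXt := T_inH t0 hX.
pose n := norm2 p (T t X); have n0 : 0 <= n by exact: sqrtr_ge0.
(* The increment is the square of the norm of [D] plus twice its pairing with [T t X]; for a norm
   below [e' <= 1] this is less than [e' * (1 + 2 * n) <= e]. *)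
pose e' := Num.min 1 (e / (1 + 2 * n)).
have m0 : 0 < 1 + 2 * n by rewrite ltr_wpDr// mulr_ge0.
have e'0 : 0 < e' by rewrite lt_min ltr01 divr_gt0.
have [d d0 hd] := orbit_continuous hX t0 (divr_gt0 e'0 (ltr0Sn R 1)).
exists d => // s s0 /(hd s s0) hD.
have hXs := T_inH s0 hX; pose D := subS (T s X) (T t X).
have hDH : inH p D := inH_sub l0 hXs hXt.
have E : T s X = addS (scaleS 1 D) (T t X) := addS_subS _ _.
have nD : norm2 p D < e'.
  by apply: le_lt_trans (norm2_le_norm1 hDH) _; rewrite mulrC -ltr_pdivlMr.
have nD0 : 0 <= norm2 p D by exact: sqrtr_ge0.
rewrite (ip2_sqr_lin (a := 1) l0 hDH hXt hXs); last by rewrite -E; exact: eqH_refl.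
rewrite addrK expr1n mul1r mulr1 -(norm2_sqr hp hS hDH).
have := ip2_cauchy hp hS hDH hXt; rewrite -/n.
move: nD; rewrite /e' lt_min => /andP[n1]; rewrite ltr_pdivlMr// => n2.
move=> cs; apply: le_lt_trans (ler_normD _ _) _.
rewrite ger0_norm ?sqr_ge0// normrM ger0_norm//.
apply: le_lt_trans n2; rewrite mulrDr mulr1 lerD//.
  by rewrite expr2 ler_piMr// ltW.
by rewrite mulrCA ler_wpM2l.
Qed.

(** With [T h X = X + h Z] and [Z = D + Aop X], the square is [ip2 X X + 2 h ip2 Z X + h^2 ip2 Z Z].
    The contribution of [D] and the quadratic term are allotted [e / 2] each. *)
Lemma ip2_orbit_step X e : inD p X -> 0 < e ->
  exists2 d, 0 < d & forall h, 0 < h -> h < d ->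
    ip2 p (T h X) (T h X) <= ip2 p X X + h * (2 * ip2 p (Aop p X) X + e).
Proof.
move=> dX e0; have [hX _ _ _ _] := dX; have hA := inH_Aop hp dX.
have XA : infinitesimal p T X (Aop p X).
  by case: hT => _ gen; apply/gen => //; split => //; exact: eqH_refl.
pose n := norm2 p X; have n0 : 0 <= n by exact: sqrtr_ge0.
pose m := norm2 p (Aop p X); have m0 : 0 <= m by exact: sqrtr_ge0.
pose e' := Num.min 1 (e / 2 / (2 * n + 1)).
have k0 : 0 < 2 * n + 1 by rewrite ltr_wpDl// mulr_ge0.
have e'0 : 0 < e' by rewrite lt_min ltr01 !divr_gt0.
have [d d0 hd] := infinitesimalP XA (divr_gt0 e'0 (ltr0Sn R 1)).
have q0 : 0 < (1 + m) ^+ 2 by rewrite exprn_gt0// ltr_wpDr.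
exists (Num.min d (e / 2 / (1 + m) ^+ 2)); first by rewrite lt_min d0 !divr_gt0.
move=> h h0; rewrite lt_min => /andP[/(hd h h0)]; rewrite ltr_pdivlMr// => hD he.
have hXh := T_inH (ltW h0) hX.
set D := subS _ _ in hD.
have hDH : inH p D by apply: inH_sub => //; apply: inH_scale => //; exact: inH_sub.
pose Z := addS (scaleS 1 D) (Aop p X).
have hZ : inH p Z := inH_lin l0 1 hDH hA.
have E : T h X = addS (scaleS h Z) X by apply: addS_quotient; rewrite gt_eqF.
have nD : norm2 p D < e'.
  by apply: le_lt_trans (norm2_le_norm1 hDH) _; rewrite mulrC.
have nD0 : 0 <= norm2 p D by exact: sqrtr_ge0.
rewrite (ip2_sqr_lin (a := h) l0 hZ hX hXh); last by rewrite -E; exact: eqH_refl.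
rewrite (ip2_lin l0 hDH hA hZ hX (eqH_refl _ _)) mul1r.
have nZ : ip2 p Z Z <= (1 + m) ^+ 2.
  rewrite (ip2_sqr_lin (a := 1) l0 hDH hA hZ (eqH_refl _ _)) expr1n mul1r mulr1.
  have := le_trans (ler_norm _) (ip2_cauchy hp hS hDH hA).
  rewrite -(norm2_sqr hp hS hDH) -(norm2_sqr hp hS hA) -/m.
  have {}nD : norm2 p D <= 1 by rewrite ltW// (lt_le_trans nD)// ge_min lexx.
  have : norm2 p D * m <= m by rewrite ler_piMl.
  have : norm2 p D ^+ 2 <= 1 by rewrite expr_le1.
  rewrite sqrrD expr1n mul1r mulr2n; move: (norm2 p D ^+ 2) (norm2 p D * m) (ip2 p D _) (m ^+ 2).
  move=> *; lra.
have cD : 2 * ip2 p D X <= e / 2.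
  have := le_trans (ler_norm _) (ip2_cauchy hp hS hDH hX); rewrite -/n => cs.
  have {}nD : norm2 p D < e / 2 / (2 * n + 1) by rewrite (lt_le_trans nD)// ge_min lexx orbT.
  move: nD; rewrite ltr_pdivlMr// mulrDr mulr1 mulrCA.
  move: (norm2 p D * n) cs => *; lra.
have hZe : h * ip2 p Z Z <= e / 2.
  apply: le_trans (ler_wpM2l (ltW h0) nZ) _.
  by rewrite -ler_pdivlMr// ltW.
move: (ip2 p Z Z) (ip2 p D X) (ip2 p (Aop p X) X) cD hZe => z c a cD hZe.
rewrite addrC lerD2l (_ : _ + _ = h * (h * z + 2 * (c + a))); last by ring.
rewrite ler_wpM2l ?(ltW h0)//; lra.
Qed.

Lemma orbit_decay L X : 0 < L ->
  (forall Y, inD p Y -> 2 * ip2 p (Aop p Y) Y <= - L * ip2 p Y Y) -> inD p X ->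
  forall t, 0 <= t ->
  ip2 p (T t X) (T t X) <= ip2 p X X * expR (- L * t).
Proof.
move=> L0 hL dX t t0; have [hX _ _ _ _] := dX.
have [[_ /(_ X hX) T0 TD _] _] := hT.
rewrite -(ip2_eqH l0 (T_inH (lexx 0) hX) hX T0).
apply: (dini_decay (f := fun s => ip2 p (T s X) (T s X)) L0 _ _ _ t0).
- by move=> s s0; apply: (ip2_ge0 hp hS); exact: T_inH.
- by move=> s e s0 e0; exact: ip2_orbit_continuous.
- move=> s e s0 e0; have dXs := orbit_inD s0 dX.
  have [d d0 hd] := ip2_orbit_step dXs e0.
  exists d => // h h0 hd1.
  have sh : 0 <= s + h by rewrite addr_ge0// ltW.
  have hXs := T_inH s0 hX.
  (* The semigroup law reads the orbit after time [s] as an orbit started at [T s X], to which the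
     expansion at time 0 applies. *)
  have es := TD h s X (ltW h0) s0 hX; rewrite addrC in es.
  rewrite (ip2_eqH l0 (T_inH sh hX) (T_inH (ltW h0) hXs) es).
  apply: (le_trans (hd h h0 hd1)); rewrite lerD2l ler_wpM2l ?(ltW h0)// lerD2r.
  exact: hL.
Qed.

End Orbits.

(** * Sup norms, decay rate and conclusion *)

Section SupNorms.
Context {R : realType}.
Variable p : params R.
Hypotheses (hp : constants_ok p) (hS : structural_assumption p).
Implicit Types (X : state R).

Let l0 : 0 < len p. Proof. by case: hp => [[]]. Qed.

Lemma supnorm_le (l b : R) (f : R -> R) : 0 <= b ->
  (forall y, 0 <= y <= l -> acrep l f y ^+ 2 <= b ^+ 2) -> (supnorm l f <= b%:E)%E.
Proof.
move=> b0 h; apply: ge_ereal_sup => _ [y /= yl <-]; rewrite lee_fin.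
by rewrite -(@ler_pXn2r _ 2)// real_normK ?num_real// h// -in_itv.
Qed.

Lemma nrm_ge_I2 X : I2 (len p) (wderivn (len p) 2 (cf X)) (wderivn (len p) 2 (cf X))
    <= nrm p (crd p X) /\
  I2 (len p) (wderivn (len p) 1 (ch X)) (wderivn (len p) 1 (ch X)) <= nrm p (crd p X).
Proof.
rewrite /nrm /=.
have := I2_ge0 (len p) (wderivn (len p) 2 (cf X)).
have := I2_ge0 (len p) (wderivn (len p) 1 (ch X)).
have := I2_ge0 (len p) (cg X); have := I2_ge0 (len p) (cz X).
have := sqr_ge0 (czw X); have := sqr_ge0 (czphi X).
move: (I2 _ (wderivn _ 2 _) _) (I2 _ (wderivn _ 1 _) _) (I2 _ (cg X) _) (I2 _ (cz X) _).
move: (czw X ^+ 2) (czphi X ^+ 2) => *.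
by split; lra.
Qed.

Lemma sup_bounds : exists2 c, 0 < c & forall X (B : R), inH p X ->
  norm2 p X ^+ 2 <= B -> forall y, 0 <= y <= len p ->
  [/\ acrep (len p) (cf X) y ^+ 2 <= 4 * len p ^+ 3 / pi ^+ 2 / c * B,
      acrep (len p) (wderivn (len p) 1 (cf X)) y ^+ 2 <= len p / c * B
    & acrep (len p) (ch X) y ^+ 2 <= len p / c * B].
Proof.
have [c [C [c0 _ hc]]] := norms_equiv hp hS.
exists c => // X B hX; rewrite (norm2_sqr hp hS hX) => XB y yl.
have [_ lc _ _] := hc X hX; have [F H] := nrm_ge_I2 X.
have nB : nrm p (crd p X) <= c^-1 * B.
  by rewrite mulrC ler_pdivlMr// mulrC (le_trans lc).
have [hf _ hh _] := (inHE l0 X).1 hX.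
have k0 : 0 <= 4 * len p ^+ 3 / pi ^+ 2.
  by apply: divr_ge0; [apply: mulr_ge0 => //; apply: exprn_ge0; exact: ltW|exact: sqr_ge0].
have pi2 : 0 < (pi : R) ^+ 2 by apply: exprn_gt0; exact: pi_gt0.
split; rewrite -mulrA.
- apply: le_trans (ler_mul_divl pi2 (H2L_sup l0 hf yl)) _.
  exact: (ler_wpM2l k0 (le_trans F nB)).
- apply: le_trans (H1L_sup l0 (H2L_wderiv hf) yl) _.
  exact: (ler_wpM2l (ltW l0) (le_trans F nB)).
- apply: le_trans (H1L_sup l0 hh yl) _.
  exact: (ler_wpM2l (ltW l0) (le_trans H nB)).
Qed.

(** The chain [ip2 <= 2 * ip1 <= 2 * C * nrm <= 2 * C * k * dissip] compares with a dissipation of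
    at least [2 * d * dissip]; the quotient is the rate [d / (C * k)]. *)
Lemma decay_rate : exists2 L, 0 < L &
  forall X, inD p X -> 2 * ip2 p (Aop p X) X <= - L * ip2 p X X.
Proof.
have [c [C [_ C0 hC]]] := norms_equiv hp hS.
have [d d0 hd] := dissipation hp hS; have [k k0 hk] := nrm_le_dissip hp.
have Ck : 0 < C * k by rewrite mulr_gt0.
exists (d / (C * k)); first by rewrite divr_gt0.
move=> X dX; have [hX _ _ _ _] := dX; have [_ _ h1 h2] := hC X hX.
have := hd X dX; rewrite !mulNr.
have : d / (C * k) * ip2 p X X <= d / (C * k) * (2 * (C * k) * dissip p X).
  apply: ler_wpM2l; first by rewrite ltW// divr_gt0.
  apply: (le_trans h1); rewrite -!mulrA ler_wpM2l// (le_trans h2)//.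
  exact: (ler_wpM2l (ltW C0) (hk X dX)).
rewrite (_ : d / (C * k) * (2 * (C * k) * dissip p X) = 2 * (d * dissip p X)); last first.
  by move: (dissip p X) => D; field; rewrite !gt_eqF.
by move: (d / (C * k) * ip2 p X X) (d * dissip p X) (ip2 p (Aop p X) X) => *; lra.
Qed.

End SupNorms.

Theorem corollary17 (R : realType) (p : params R)
    (hp : constants_ok p) (hS : structural_assumption p) :
  exists Lambda K_w K_wy K_phi : R,
    [/\ 0 < Lambda, 0 < K_w, 0 < K_wy, 0 < K_phi &
      forall T : R -> state R -> state R, generated_by_A p T ->
      forall X0 : state R, inD p X0 ->
      forall t : R, 0 <= t ->
        let X := T t X0 in
        let bound K := K * Num.sqrt (energy p X0) * expR (- Lambda * t / 2) in
        [/\ norm2 p X ^+ 2 <= norm2 p X0 ^+ 2 * expR (- Lambda * t),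
            (supnorm (len p) (cf X) <= (bound K_w)%:E)%E,
            (supnorm (len p) (wderivn (len p) 1 (cf X)) <= (bound K_wy)%:E)%E &
            (supnorm (len p) (ch X) <= (bound K_phi)%:E)%E]].
Proof.
have l0 : 0 < len p by case: hp => [[]].
have [L L0 hL] := decay_rate hp hS; have [c c0 hc] := sup_bounds hp hS.
pose kw := 4 * len p ^+ 3 / pi ^+ 2 / c; pose kphi := len p / c.
have kphi0 : 0 < kphi := divr_gt0 l0 c0.
have kw0 : 0 < kw.
  apply: divr_gt0 => //; apply: divr_gt0; last by apply: exprn_gt0; exact: pi_gt0.
  by apply: mulr_gt0 => //; exact: exprn_gt0.
(* The 4 is the product of the 2 in [ip2 <= 2 * ip1] and of the 2 in [norm1 ^+ 2 = 2 * energy]. *)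
have s0 k : 0 < k -> 0 < Num.sqrt (4 * k) by move=> k0; rewrite sqrtr_gt0 mulr_gt0.
exists L, (Num.sqrt (4 * kw)), (Num.sqrt (4 * kphi)), (Num.sqrt (4 * kphi)).
split; [exact: L0|exact: s0|exact: s0|exact: s0|]; move=> T hT X0 dX0 t t0 X bound.
have [hX0 _ _ _ _] := dX0.
have [hX _ _ _ _] := orbit_inD hp hT t0 dX0.
have decay : norm2 p X ^+ 2 <= norm2 p X0 ^+ 2 * expR (- L * t).
  by rewrite !(norm2_sqr hp hS)//; exact: (orbit_decay hp hS hT).
have e0 : 0 <= energy p X0 by rewrite divr_ge0// sqr_ge0.
have b0 k : 0 <= bound (Num.sqrt k) by rewrite !mulr_ge0 ?sqrtr_ge0 ?expR_ge0.
have b2 k : 0 < k -> k * (4 * energy p X0 * expR (- L * t)) <= bound (Num.sqrt (4 * k)) ^+ 2.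
  move=> k0; rewrite !exprMn !sqr_sqrtr// ?mulr_ge0 ?(ltW k0)//.
  rewrite [expR _ ^+ 2]expr2 -expRD -splitr.
  by rewrite le_eqVlt; apply/orP; left; apply/eqP; ring.
have XB : norm2 p X ^+ 2 <= 4 * energy p X0 * expR (- L * t).
  apply: (le_trans decay); rewrite ler_wpM2r ?expR_ge0// (norm2_sqr hp hS hX0).
  rewrite (le_trans (ip2_le_norm1 hp hS hX0))// /energy; lra.
split; first exact: decay.
- apply: supnorm_le (b0 _) _ => y yl.
  by have [h _ _] := hc _ _ hX XB _ yl; exact: le_trans h (b2 _ kw0).
- apply: supnorm_le (b0 _) _ => y yl.
  by have [_ h _] := hc _ _ hX XB _ yl; exact: le_trans h (b2 _ kphi0).
- apply: supnorm_le (b0 _) _ => y yl.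
  by have [_ _ h] := hc _ _ hX XB _ yl; exact: le_trans h (b2 _ kphi0).
Qed.
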